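(* Consider the system $$\dot x_i=f_i(x_1,\dots,x_i,\boldsymbol\theta_i)+x_{i+1},\quad i=1,\dots,n-1,\qquad \dot x_n=f_n(x_1,\dots,x_n,\boldsymbol\theta_n)+u+\varepsilon(t),$$ with $\varepsilon(t)\in L_2$ and $\boldsymbol\theta_i\in\Omega_\theta$, and let a goal function $\psi(x_1)$, with target manifold $\psi(x_1)=0$, be given. Suppose that there exist functions $\boldsymbol\alpha_i(x_1,\dots,x_i)$, $i=1,\dots,n$, and constants $D,D_1>0$ such that, writing $\mathbf x_i=(x_1,\dots,x_i)^T$, for all $\mathbf x_i$, $\hat{\boldsymbol\theta}_i$ and $\boldsymbol\theta_i\in\Omega_\theta$: $$(f_i(\mathbf x_i,\hat{\boldsymbol\theta}_i)-f_i(\mathbf x_i,\boldsymbol\theta_i))\,\boldsymbol\alpha_i(\mathbf x_i)^T(\hat{\boldsymbol\theta}_i-\boldsymbol\theta_i)>0\quad\text{whenever } f_i(\mathbf x_i,\hat{\boldsymbol\theta}_i)\ne f_i(\mathbf x_i,\boldsymbol\theta_i),$$ $$D_1|\boldsymbol\alpha_i(\mathbf x_i)^T(\hat{\boldsymbol\theta}_i-\boldsymbol\theta_i)|\le|f_i(\mathbf x_i,\hat{\boldsymbol\theta}_i)-f_i(\mathbf x_i,\boldsymbol\theta_i)|\le D|\boldsymbol\alpha_i(\mathbf x_i)^T(\hat{\boldsymbol\theta}_i-\boldsymbol\theta_i)|.$$ Furthermore, suppose that there exist smooth functions $\bar D_i:R^i\times R^i\to R$ such that for any $\boldsymbol\theta_i\in\Omega_\theta$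 and all $\mathbf x_i,\mathbf x_i'\in R^i$ $$(f_i(\mathbf x_i,\boldsymbol\theta_i)-f_i(\mathbf x_i',\boldsymbol\theta_i))^2\le\bar D_i^2(\mathbf x_i,\mathbf x_i')\|\mathbf x_i-\mathbf x_i'\|^2;$$ that $\boldsymbol\alpha_i(x_1,\dots,x_i)$, $f_i(x_1,\dots,x_i,\boldsymbol\theta_i)$, $i=1,\dots,n$, and $\psi(x_1)$ are smooth; and that $\psi(x_1)\in L_\infty\Rightarrow x_1\in L_\infty$. Then there exist an auxiliary system $$\dot{\boldsymbol\xi}=\mathbf f_\xi(\mathbf x,\boldsymbol\xi,\boldsymbol\nu),\ \boldsymbol\xi_0\in R^n,\qquad \dot{\boldsymbol\nu}=\mathbf f_\nu(\mathbf x,\boldsymbol\xi,\boldsymbol\nu),\ \boldsymbol\nu_0\in R^m,$$ as well as smooth functions $\psi_i(x_i,t)$, $i=1,\dots,n$, $\hat{\boldsymbol\theta}_P(\mathbf x,\boldsymbol\xi)$, a control $u(\mathbf x,\hat{\boldsymbol\theta},\boldsymbol\xi,\boldsymbol\nu)$, and an adaptation algorithm $$\hat{\boldsymbol\theta}(\mathbf x,\boldsymbol\xi,\hat{\boldsymbol\theta}_I)=\gamma(\hat{\boldsymbol\theta}_P(\mathbf x,\boldsymbol\xi)+\hat{\boldsymbol\theta}_I),\ \gamma>0,\qquad \dot{\hat{\boldsymbol\theta}}_I=\mathbf f_{\hat\theta}(\mathbf x,\hat{\boldsymbol\theta},\boldsymbol\xi,\boldsymbol\nu),$$ such that 1) $\psi_i(x_i,t),\psi\in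 L_2\cap L_\infty$, $\dot\psi,\dot\psi_i\in L_2$, $i=1,\dots,n$; 2) $\hat{\boldsymbol\theta}\in L_\infty$ and $u(\mathbf x,\hat{\boldsymbol\theta},\boldsymbol\xi,\boldsymbol\nu)-u(\mathbf x,\boldsymbol\theta_n,\boldsymbol\xi,\boldsymbol\nu)\in L_2$; 3) $\mathbf x,\boldsymbol\xi,\boldsymbol\nu\in L_\infty$; 4) if $\varepsilon(t)\in L_\infty$ then $\dot\psi,\dot\psi_i\in L_\infty$, $\lim_{t\to\infty}\psi(x_1(t))=0$, and $\lim_{t\to\infty}\psi_i(x_i(t),t)=0$, $i=1,\dots,n$.
   Context: $\mathbf x=(x_1,\dots,x_n)^T$ is the state, $u\in R$ the control input, $\varepsilon$ an unknown disturbance, and $\boldsymbol\theta_i$ are vectors of unknown constant parameters in $\Omega_\theta\subset R^d$; $\hat{\boldsymbol\theta}_i\in R^d$ denotes a vector of controller parameters and $\boldsymbol\alpha_i$ takes values in $R^d$. In the conclusion $\hat{\boldsymbol\theta}$ is the vector of controller parameters entering the control $u$, and $\boldsymbol\xi_0,\boldsymbol\nu_0$ are the initial conditions of the auxiliary system. $\dot\psi,\dot\psi_i$ are total time derivatives along closed-loop solutions. ''Smooth'' means $C^\infty$. A function of time $t\ge0$ is in $L_2$ iff the integral of its squared Euclidean norm over $[0,\infty)$ is finite, and in $L_\infty$ iff it is bounded; membership of state-dependent quantities in these spaces is understood along solutions of the system.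
   Formalization: The formal theorem additionally assumes that the target manifold ψ(x_1)=0 is nonempty; without this the claim fails, e.g. for ψ(x_1)=x_1²+1, which is never in L_2 along a solution. *)

(* Defs.v *)
(* MathComp-Analysis, over an arbitrary R : realType. *)
From HB Require Import structures.
From mathcomp Require Export all_boot all_order all_algebra.
From mathcomp Require Export all_classical all_reals all_analysis.

Set Implicit Arguments.
Unset Strict Implicit.
Unset Printing Implicit Defensive.

Import Order.TTheory GRing.Theory Num.Theory.
Export numFieldNormedType.Exports.

Local Open Scope classical_set_scope.
Local Open Scope ring_scope.

(* C^infinity for maps between finite-dimensional spaces: every iterated
   directional derivative, including f itself (vs = [::]), exists and is
   Frechet differentiable at every point. *)
Definition smooth (R : realType) (V W : normedModType R) (f : V -> W) : Prop :=
  forall (vs : seq V) (x : V),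
    differentiable (foldr (fun v (g : V -> W) => 'D_v g) f vs) x.

Definition dot (R : realType) (k : nat) (a b : 'rV[R]_k) : R :=
  \sum_(j < k) a 0 j * b 0 j.

(* Squared Euclidean norm; the library norm on 'rV_k is the sup norm. *)
Definition sqnorm (R : realType) (k : nat) (v : 'rV[R]_k) : R := dot v v.

(* Signals are functions R -> _ of which only the values at t >= 0 matter. *)
Definition L2 (R : realType) (g : R -> R) : Prop :=
  measurable_fun (`[0, +oo[ : set R) g /\
  (\int[lebesgue_measure]_(t in `[0%R, +oo[) ((g t) ^+ 2)%:E < +oo)%E.

(* Boundedness at every t >= 0, not up to a null set. *)
Definition Linf (R : realType) (V : normedModType R) (g : R -> V) : Prop :=
  [bounded g t | t in `[0, +oo[].

(* Caratheodory solution of y' = v on [0, +oo[: y is a locally absolutely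
   continuous primitive of v. *)
Definition primitive_of (R : realType) (k : nat) (v y : R -> 'rV[R]_k) : Prop :=
  forall (i : 'I_k) (t : R), 0 <= t ->
    (@lebesgue_measure R).-integrable `[0, t] (fun s => (v s 0 i)%:E) /\
    y t 0 i = y 0 0 i + \int[lebesgue_measure]_(s in `[0, t]) v s 0 i.

(* The state dimension n >= 1 is written n.+1, and indices start at 0: the
   equation for x_(i+1) has index i : 'I_n.+1, and [prefix i x] is
   (x_1, ..., x_(i+1)). *)
Definition prefix (R : realType) (n : nat) (i : 'I_n.+1) (x : 'rV[R]_n.+1) :
    'rV[R]_i.+1 :=
  \row_j x 0 (widen_ord (ltn_ord i) j).

Definition plant (R : realType) (n d : nat)
    (f : forall i : 'I_n.+1, 'rV[R]_i.+1 -> 'rV[R]_d -> R)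
    (theta : 'I_n.+1 -> 'rV[R]_d) (x : 'rV[R]_n.+1) (u e : R) : 'rV[R]_n.+1 :=
  \row_i (f i (prefix i x) (theta i) +
          if (i < n)%N then x 0 (inord i.+1) else u + e).

Record controller (R : realType) (n d m : nat) := Controller {
  f_xi : 'rV[R]_n -> 'rV[R]_n -> 'rV[R]_m -> 'rV[R]_n;
  f_nu : 'rV[R]_n -> 'rV[R]_n -> 'rV[R]_m -> 'rV[R]_m;
  ctrl : 'rV[R]_n -> 'rV[R]_d -> 'rV[R]_n -> 'rV[R]_m -> R;
  gain : R;
  theta_P : 'rV[R]_n -> 'rV[R]_n -> 'rV[R]_d;
  f_theta : 'rV[R]_n -> 'rV[R]_d -> 'rV[R]_n -> 'rV[R]_m -> 'rV[R]_d }.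

Definition smooth_controller (R : realType) (n d m : nat)
    (C : controller R n d m) : Prop :=
  [/\ smooth (fun p : 'rV[R]_n * 'rV[R]_n * 'rV[R]_m => f_xi C p.1.1 p.1.2 p.2),
      smooth (fun p : 'rV[R]_n * 'rV[R]_n * 'rV[R]_m => f_nu C p.1.1 p.1.2 p.2),
      smooth (fun p : 'rV[R]_n * 'rV[R]_d * 'rV[R]_n * 'rV[R]_m =>
                ctrl C p.1.1.1 p.1.1.2 p.1.2 p.2),
      smooth (fun p : 'rV[R]_n * 'rV[R]_n => theta_P C p.1 p.2) &
      smooth (fun p : 'rV[R]_n * 'rV[R]_d * 'rV[R]_n * 'rV[R]_m =>
                f_theta C p.1.1.1 p.1.1.2 p.1.2 p.2)].

Definition theta_hat (R : realType) (n d m : nat) (C : controller R n d m)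
    (x xi : 'rV[R]_n) (theta_I : 'rV[R]_d) : 'rV[R]_d :=
  gain C *: (theta_P C x xi + theta_I).

Record trajectory (R : realType) (n d m : nat) := Trajectory {
  tx : R -> 'rV[R]_n;
  txi : R -> 'rV[R]_n;
  tnu : R -> 'rV[R]_m;
  ttheta_I : R -> 'rV[R]_d }.

Definition theta_hat_at (R : realType) (n d m : nat)
    (C : controller R n d m) (z : trajectory R n d m) (t : R) : 'rV[R]_d :=
  theta_hat C (tx z t) (txi z t) (ttheta_I z t).

Definition xdot (R : realType) (n d m : nat)
    (f : forall i : 'I_n.+1, 'rV[R]_i.+1 -> 'rV[R]_d -> R)
    (theta : 'I_n.+1 -> 'rV[R]_d) (eps : R -> R) (C : controller R n.+1 d m)
    (z : trajectory R n.+1 d m) (t : R) : 'rV[R]_n.+1 :=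
  plant f theta (tx z t)
    (ctrl C (tx z t) (theta_hat_at C z t) (txi z t) (tnu z t)) (eps t).

Definition closed_loop (R : realType) (n d m : nat)
    (f : forall i : 'I_n.+1, 'rV[R]_i.+1 -> 'rV[R]_d -> R)
    (theta : 'I_n.+1 -> 'rV[R]_d) (eps : R -> R) (C : controller R n.+1 d m)
    (z : trajectory R n.+1 d m) : Prop :=
  [/\ primitive_of (xdot f theta eps C z) (tx z),
      primitive_of (fun t => f_xi C (tx z t) (txi z t) (tnu z t)) (txi z),
      primitive_of (fun t => f_nu C (tx z t) (txi z t) (tnu z t)) (tnu z) &
      primitive_of
        (fun t => f_theta C (tx z t) (theta_hat_at C z t) (txi z t) (tnu z t))
        (ttheta_I z)].

(* Total derivative at time t of [phi (y t) t] when y has velocity [v t].  The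
   solutions are differentiable only almost everywhere, so the chain-rule
   expression, which is defined for every t, is used; it agrees with the
   derivative of [fun t => phi (y t) t] for almost every t. *)
Definition total_deriv (R : realType) (phi : R -> R -> R) (y v : R -> R)
    (t : R) : R :=
  derive1 (fun s => phi s t) (y t) * v t + derive1 (phi (y t)) t.

(* Main.v *)
From HB Require Import structures.
Require Import Defs.
From mathcomp Require Import all_boot all_order all_algebra.
From mathcomp Require Import all_classical all_reals all_analysis.
From mathcomp Require Import measurable_realfun ring lra.
Import Order.TTheory GRing.Theory Num.Theory.
Import numFieldNormedType.Exports.
Set Implicit Arguments.
Unset Strict Implicit.
Unset Printing Implicit Defensive.
Local Open Scope classical_set_scope.
Local Open Scope ring_scope.

(** The closed loop is built from one design state S with n.+1 rows, row i
    consisting of the plant state x_i, an observer state xi_i and a stored part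
    nu_i of a parameter estimate.

    Adaptation in finite form. Write e_i = x_i - xi_i and let p_i be the point
    (x_0, ..., x_(i-1), xi_i). The estimate of theta_i is
    th_i = nu_i + e_i alpha_i(p_i), and F_i = f_i(p_i, th_i) is used in place of
    f_i(x, theta_i). The error rho_i = f_i(x, theta_i) - F_i + eps_i that is made
    in this way cannot be measured, but it is, up to known terms, the velocity
    of e_i. As p_i does not involve x_i, subtracting the known terms through nu_i
    gives
       th_i' = rho_i alpha_i(p_i) + e_i sum_(j < i) rho_j (d alpha_i / d x_j),
    which is the gradient law that would need rho_i ([derive_estimate]).

    Estimation. Put q_i = f_i(p_i, th_i) - f_i(p_i, theta_i). Monotonicity and the
    sector condition turn the product of q_i and alpha_i . (th_i - theta_i)
    into a multiple of q_i^2; the distance from p_i to the plant state is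
    |e_i|, so the Lipschitz term is absorbed by a large nonlinear observer gain.
    Hence W_i = (|th_i - theta_i|^2 + e_i^2) / 2 satisfies
       W_i' <= - dissipation + C eps_i^2 + W_i sum_(j < i) rho_j^2
    ([est_energy_decrease]), where the dissipation controls rho_i^2 up to eps_i^2
    ([residual_sq_le]). By induction on i, rho_j is square integrable for j < i,
    the logarithm of 1 + W_i stays bounded, and rho_i is square integrable with a
    bound that is uniform in time ([estimator_bound]). This does
    not presuppose that the state is bounded.

    Tracking. Choose c with psi(c) = 0. The rho_j being square integrable
    perturbations, backstepping with nonlinear damping makes x_i follow a
    virtual control v_i with v_0 = c: for z_i = x_i - v_i and V = |z|^2 / 2,
       V' <= - |z|^2 + (n + 2) |rho|^2
    ([track_energy_decrease]). So z is bounded and square integrable. As v_i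
    depends on the first i rows of S only, z_i, e_i and th_i bound the rows of S
    one after the other ([state_bound]).

    Conclusion. The a priori bound does not depend on time, so solutions exist
    on the whole half line ([ode_global]). Now x_0 - c and its velocity
    z_1 - 3 z_0 + rho_0 are square integrable, and psi is Lipschitz on bounded
    sets with psi(c) = 0; so psi(x_0) and its derivative are square integrable,
    and psi(x_0) tends to 0 ([square_integrable_cvg0]). The first goal function is
    psi and the others are 0. All estimates are kept in nu, so that theta_hat is
    a constant and the control takes the same value at theta_hat and at theta_n.

    The disturbance is only square integrable, so solutions are absolutely
    continuous and energies are differentiated along them by a chain rule in
    integral form ([abscont_chain]). *)

(** * Calculus of smooth maps *)

Section Smooth.
Context {R : realType}.

(** Differentiability of order k.+1, by recursion on the order: closure
    properties of [smooth] are proved by induction on k, since the derivative of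
    a sum, product or composite is again built from such operations. *)
Fixpoint Cdiff (V W : normedModType R) (k : nat) (g : V -> W) : Prop :=
  (forall x, differentiable g x) /\
  (if k is k'.+1 then forall v : V, Cdiff k' ('D_v g) else True).

Lemma smoothP (V W : normedModType R) (g : V -> W) :
  smooth g <-> forall k, Cdiff k g.
Proof.
split=> [sg k|Cg vs].
  elim: k g sg => [|k IH] g sg; first by split=> [x|//]; exact: (sg [::] x).
  split=> [x|v]; first exact: (sg [::]).
  by apply: IH => vs x; have := sg (rcons vs v) x; rewrite foldr_rcons.
elim/last_ind: vs g Cg => [|vs v IH] g Cg x.
  have [dg _] := Cg 0%N; exact: dg.
by rewrite foldr_rcons; apply: IH => k; have [_ DC] := Cg k.+1; exact: DC.
Qed.

Lemma CdiffW (V W : normedModType R) k (g : V -> W) : Cdiff k.+1 g -> Cdiff k g.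
Proof.
elim: k g => [|k IH] g [dg Dg]; first by split.
by split=> // v; apply/IH/Dg.
Qed.

Lemma Cdiff_cst (V W : normedModType R) k (a : W) : Cdiff k (fun _ : V => a).
Proof.
elim: k a => [|k IH] a; (split; [by move=> x; exact: differentiable_cst | move=> //]).
move=> v.
rewrite (_ : 'D_v _ = fun=> 0) //.
by apply/funext => x; exact: (derive_cst a).
Qed.

Lemma CdiffD (V W : normedModType R) k (g h : V -> W) :
  Cdiff k g -> Cdiff k h -> Cdiff k (fun x => g x + h x).
Proof.
elim: k g h => [|k IH] g h [dg Dg] [dh Dh]; (split; [by move=> x;
  exact: differentiableD | move=> //]).
move=> v.
rewrite (_ : 'D_v _ = fun x => 'D_v g x + 'D_v h x); first exact: (IH _ _ (Dg v) (Dh v)).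
by apply/funext => x; apply: deriveD; exact: diff_derivable.
Qed.

Lemma CdiffM (V : normedModType R) k (g h : V -> R) :
  Cdiff k g -> Cdiff k h -> Cdiff k (fun x => g x * h x).
Proof.
elim: k g h => [|k IH] g h Cg Ch; have [dg Dg] := Cg; have [dh Dh] := Ch;
  (split; [by move=> x; exact: differentiableM | move=> //]).
move=> v.
rewrite (_ : 'D_v _ = fun x => g x * 'D_v h x + h x * 'D_v g x).
  apply: CdiffD; apply: IH; [exact: CdiffW|exact: Dh|exact: CdiffW|exact: Dg].
by apply/funext => x; rewrite (@deriveM _ _ g h x v)//; exact: diff_derivable.
Qed.

Lemma Cdiff_sum (V W : normedModType R) k (I : Type) (r : seq I) (P : pred I)
    (g : I -> V -> W) :
  (forall i, P i -> Cdiff k (g i)) -> Cdiff k (fun x => \sum_(i <- r | P i) g i x).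
Proof.
move=> Cg; elim: r => [|i r IH].
  by under eq_fun do rewrite big_nil; exact: Cdiff_cst.
have [Pi|nPi] := boolP (P i).
  by under eq_fun do rewrite big_cons Pi; apply: CdiffD => //; exact: Cg.
by under eq_fun do rewrite big_cons (negbTE nPi).
Qed.

Lemma Cdiff_precomp (U V W : normedModType R) k (L : {linear U -> V})
    (g : V -> W) :
  continuous L -> Cdiff k g -> Cdiff k (fun x => g (L x)).
Proof.
move=> cL; elim: k g => [|k IH] g [dg Dg]; (split; [by move=> x;
  apply: differentiable_comp => //; exact: linear_differentiable | move=> //]).
move=> v.
rewrite (_ : 'D_v _ = fun x => 'D_(L v) g (L x)); first exact: (IH _ (Dg (L v))).
apply/funext => x; have dL := linear_differentiable x cL.
rewrite !deriveE//; last exact: (differentiable_comp dL (dg _)).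
by rewrite (@diff_comp _ _ _ _ L g x)//= diff_lin.
Qed.

Lemma differentiable_mx (V : normedModType R) m n (g : V -> 'M[R]_(m, n)) x :
  (forall i j, differentiable (fun y => g y i j) x) -> differentiable g x.
Proof.
move=> dg.
have -> : g = \sum_(i < m) \sum_(j < n) (fun y => g y i j *: delta_mx i j).
  apply/funext => y; rewrite [LHS]matrix_sum_delta fct_sumE.
  by apply: eq_bigr => i _; rewrite fct_sumE.
apply: differentiable_sum => i; apply: differentiable_sum => j.
exact: differentiableZl.
Qed.

Lemma Cdiff_mx (V : normedModType R) m n k (g : V -> 'M[R]_(m, n)) :
  (forall i j, Cdiff k (fun y => g y i j)) -> Cdiff k g.
Proof.
elim: k g => [|k IH] g Cg; (split; [by move=> x; apply: differentiable_mx => i j;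
  have [dg _] := Cg i j; exact: dg | move=> //]).
move=> v.
apply: IH => i j; have [_ /(_ v)] := Cg i j.
congr Cdiff; apply/funext => x; rewrite derive_mx ?mxE//.
apply/diff_derivable; apply: differentiable_mx => a b.
by case: (Cg a b).
Qed.

Lemma Cdiff_coord (V : normedModType R) m n k (g : V -> 'M[R]_(m, n)) i j :
  Cdiff k g -> Cdiff k (fun y => g y i j).
Proof.
elim: k g => [|k IH] g [dg Dg].
  split=> // x.
  exact: (differentiable_comp (dg x) (differentiable_coord (g x) i j)).
split=> [x|v].
  exact: (differentiable_comp (dg x) (differentiable_coord (g x) i j)).
have := IH _ (Dg v); congr Cdiff; apply/funext => x.
rewrite derive_mx ?mxE//; exact: diff_derivable.
Qed.

(** A derivative in a varying direction is a combination of finitely many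
    partial derivatives, whose coefficients are the entries of the direction. *)
Lemma derive_sum_delta (W : normedModType R) m n (g : 'M[R]_(m, n) -> W) x v :
  differentiable g x ->
  'D_v g x = \sum_i \sum_j v i j *: 'D_(delta_mx i j) g x.
Proof.
move=> dg; rewrite deriveE// {1}(matrix_sum_delta v) linear_sum.
apply: eq_bigr => i _; rewrite linear_sum; apply: eq_bigr => j _.
by rewrite linearZ /= deriveE.
Qed.

(** The intermediate space is a matrix space in order that the derivative of the
    composite be a finite sum of products of partial derivatives, to which the
    induction hypothesis and [CdiffM] apply. *)
Lemma Cdiff_comp (V : normedModType R) m n k (h : V -> 'M[R]_(m, n))
    (g : 'M[R]_(m, n) -> R) :
  Cdiff k h -> Cdiff k g -> Cdiff k (fun x => g (h x)).
Proof.
elim: k g h => [|k IH] g h Ch Cg; have [dh Dh] := Ch; have [dg Dg] := Cg;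
  (split; [by move=> x; exact: differentiable_comp | move=> //]).
move=> v.
rewrite (_ : 'D_v _ =
    fun x => \sum_i \sum_j 'D_v h x i j * 'D_(delta_mx i j) g (h x)).
  apply: Cdiff_sum => i _; apply: Cdiff_sum => j _; apply: CdiffM.
    exact/Cdiff_coord/Dh.
  exact: (IH ('D_(delta_mx i j) g) h (CdiffW Ch) (Dg _)).
apply/funext => x.
rewrite deriveE; last exact: (differentiable_comp (dh x) (dg (h x))).
rewrite (@diff_comp _ _ _ _ h g x)//= -!deriveE//.
by rewrite (derive_sum_delta _ (dg (h x))).
Qed.

Lemma smooth_differentiable (V W : normedModType R) (g : V -> W) :
  smooth g -> forall x, differentiable g x.
Proof. by move=> sg x; exact: (sg [::]). Qed.

Lemma smooth_derive (V W : normedModType R) (g : V -> W) v :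
  smooth g -> smooth ('D_v g).
Proof. by move/smoothP=> Cg; apply/smoothP => k; have [_ DC] := Cg k.+1; exact: DC. Qed.

Lemma smooth_continuous (V W : normedModType R) (g : V -> W) :
  smooth g -> continuous g.
Proof.
by move=> sg x; exact/differentiable_continuous/smooth_differentiable.
Qed.

Lemma smooth_cst (V W : normedModType R) (a : W) : smooth (fun _ : V => a).
Proof. by apply/smoothP => k; exact: Cdiff_cst. Qed.

Lemma smoothD (V W : normedModType R) (g h : V -> W) :
  smooth g -> smooth h -> smooth (fun x => g x + h x).
Proof.
by move=> /smoothP sg /smoothP sh; apply/smoothP => k; exact: CdiffD.
Qed.

Lemma smoothM (V : normedModType R) (g h : V -> R) :
  smooth g -> smooth h -> smooth (fun x => g x * h x).
Proof.
by move=> /smoothP sg /smoothP sh; apply/smoothP => k; exact: CdiffM.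
Qed.

Lemma smoothX2 (V : normedModType R) (g : V -> R) :
  smooth g -> smooth (fun x => g x ^+ 2).
Proof.
by move=> sg; under eq_fun do rewrite expr2; exact: smoothM.
Qed.

Lemma smoothN (V : normedModType R) (g : V -> R) :
  smooth g -> smooth (fun x => - g x).
Proof.
move=> sg; under eq_fun do rewrite -mulN1r.
by apply: smoothM => //; exact: smooth_cst.
Qed.

Lemma smoothB (V : normedModType R) (g h : V -> R) :
  smooth g -> smooth h -> smooth (fun x => g x - h x).
Proof. by move=> sg sh; apply: smoothD => //; exact: smoothN. Qed.

Lemma smooth_sum (V W : normedModType R) (I : Type) (r : seq I) (P : pred I)
    (g : I -> V -> W) :
  (forall i, P i -> smooth (g i)) -> smooth (fun x => \sum_(i <- r | P i) g i x).
Proof.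
move=> sg; apply/smoothP => k; apply: Cdiff_sum => i Pi.
by have /smoothP := sg i Pi.
Qed.

Lemma smooth_precomp (U V W : normedModType R) (L : {linear U -> V})
    (g : V -> W) :
  continuous L -> smooth g -> smooth (fun x => g (L x)).
Proof.
by move=> cL /smoothP sg; apply/smoothP => k; exact: Cdiff_precomp.
Qed.

Lemma smooth_mx (V : normedModType R) m n (g : V -> 'M[R]_(m, n)) :
  (forall i j, smooth (fun y => g y i j)) -> smooth g.
Proof.
move=> sg; apply/smoothP => k; apply: Cdiff_mx => i j.
by have /smoothP := sg i j.
Qed.

Lemma smooth_coord (V : normedModType R) m n (g : V -> 'M[R]_(m, n)) i j :
  smooth g -> smooth (fun y => g y i j).
Proof. by move=> /smoothP sg; apply/smoothP => k; exact: Cdiff_coord. Qed.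

Lemma smooth_comp (V : normedModType R) m n (h : V -> 'M[R]_(m, n))
    (g : 'M[R]_(m, n) -> R) :
  smooth h -> smooth g -> smooth (fun x => g (h x)).
Proof.
by move=> /smoothP sh /smoothP sg; apply/smoothP => k; exact: Cdiff_comp.
Qed.

Lemma smooth_linear (V W : normedModType R) (L : {linear V -> W}) :
  continuous L -> smooth L.
Proof.
move=> cL.
have sid : smooth (@id W).
  apply/smoothP => -[|k]; split=> // v.
  rewrite (_ : 'D_v id = fun=> v); first exact: Cdiff_cst.
  by apply/funext => x; rewrite derive_id.
exact: (smooth_precomp cL sid).
Qed.

(** Lie derivatives along smooth vector fields are smooth; backstepping iterates
    them. *)
Lemma smooth_derive_along (m n : nat) (h : 'M[R]_(m, n) -> 'M[R]_(m, n))
    (g : 'M[R]_(m, n) -> R) :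
  smooth h -> smooth g -> smooth (fun x => 'D_(h x) g x).
Proof.
move=> sh sg.
rewrite (_ : (fun x => _) =
    fun x => \sum_i \sum_j h x i j * 'D_(delta_mx i j) g x); last first.
  by apply/funext => x; rewrite derive_sum_delta//; exact: smooth_differentiable.
apply: smooth_sum => i _; apply: smooth_sum => j _; apply: smoothM.
  exact: smooth_coord.
exact: smooth_derive.
Qed.

Lemma smooth_precomp_lin (U V W : normedModType R) (L : U -> V) (g : V -> W) :
  linear L -> continuous L -> smooth g -> smooth (fun x => g (L x)).
Proof.
move=> lL cL; pose LM := GRing.isLinear.Build _ _ _ _ _ lL.
pose L' : {linear U -> V} := HB.pack L LM.
exact: (@smooth_precomp _ _ _ L').
Qed.

Lemma smooth_id (V : normedModType R) : smooth (@id V).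
Proof. by apply: (@smooth_linear V V idfun) => x; exact: cvg_id. Qed.

Lemma smooth_fst (V W : normedModType R) : smooth (@fst V W).
Proof.
apply: (@smooth_precomp_lin _ _ _ fst id) => //; last exact: smooth_id.
by move=> x; exact: cvg_fst.
Qed.

Lemma smooth_snd (V W : normedModType R) : smooth (@snd V W).
Proof.
apply: (@smooth_precomp_lin _ _ _ snd id) => //; last exact: smooth_id.
by move=> x; exact: cvg_snd.
Qed.

(** A pair of row vectors is read as one row vector by concatenation, which
    reduces the claim to [smooth_comp]. *)
Lemma smooth_pair (U : normedModType R) m n (g : 'rV[R]_m * 'rV[R]_n -> R)
    (h1 : U -> 'rV[R]_m) (h2 : U -> 'rV[R]_n) :
  smooth g -> smooth h1 -> smooth h2 -> smooth (fun x => g (h1 x, h2 x)).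
Proof.
move=> sg s1 s2.
have sg' : smooth (fun M : 'rV[R]_(m + n) => g (lsubmx M, rsubmx M)).
  apply: (@smooth_precomp_lin _ _ _ (fun M => (lsubmx M, rsubmx M)) g) => //.
    by move=> a u v; rewrite !linearP.
  move=> M.
  have c1 := differentiable_continuous (@differentiable_lsubmx _ 1 m n M).
  have c2 := differentiable_continuous (@differentiable_rsubmx _ 1 m n M).
  exact: (cvg_pair c1 c2).
rewrite (_ : (fun x => _) = fun x =>
    (fun M : 'rV[R]_(m + n) => g (lsubmx M, rsubmx M)) (row_mx (h1 x) (h2 x)));
  last by apply/funext => x; rewrite row_mxKl row_mxKr.
apply: (@smooth_comp _ _ _ (fun x => row_mx (h1 x) (h2 x)) _ _ sg').
apply: smooth_mx => i j.
case: (split_ordP j) => k ->.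
  by under eq_fun do rewrite row_mxEl; exact: smooth_coord.
by under eq_fun do rewrite row_mxEr; exact: smooth_coord.
Qed.

End Smooth.

(** * Absolutely continuous curves *)

Section abscont.
Context {R : realType}.
Notation mu := (@lebesgue_measure R).
Implicit Types (T t a b : R) (w y c : R -> R).

Definition integ T w := mu.-integrable `[0, T] (EFin \o w).
Definition prim w t : R := \int[mu]_(s in `[0, t]) w s.
Definition abscont T w y :=
  integ T w /\ forall t, 0 <= t <= T -> y t = y 0 + prim w t.

Lemma integ_sub T w p q : integ T w -> 0 <= p -> q <= T ->
  mu.-integrable `]p, q] (EFin \o w).
Proof.
move=> iw p0 qT; apply: integrableS iw => //= s /=; rewrite !in_itv /=.
by move=> /andP[ps sq]; rewrite (le_trans p0 (ltW ps)) (le_trans sq qT).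
Qed.

Lemma integ_le T T' w : integ T w -> T' <= T -> integ T' w.
Proof.
move=> iw TT'; apply: integrableS iw => //= s /=; rewrite !in_itv /=.
by move=> /andP[-> sq] /=; exact: le_trans TT'.
Qed.

Lemma prim0 w : prim w 0 = 0.
Proof. by rewrite /prim set_itv1 Rintegral_set1. Qed.

Lemma primB T w p q : integ T w -> 0 <= p -> p <= q -> q <= T ->
  prim w q - prim w p = \int[mu]_(s in `]p, q]) w s.
Proof.
move=> iw p0 pq qT; rewrite /prim Rintegral_itvB //.
exact: integ_le qT.
Qed.

Lemma prim_abscont T w : integ T w -> abscont T w (prim w).
Proof. by move=> iw; split=> // t _; rewrite prim0 add0r. Qed.

Lemma abscontB T w y p q : abscont T w y -> 0 <= p -> p <= q -> q <= T ->
  y q - y p = \int[mu]_(s in `]p, q]) w s.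
Proof.
move=> [iw yE] p0 pq qT; rewrite -(primB iw p0 pq qT).
rewrite (yE q) ?(le_trans p0 pq)// (yE p) ?p0 ?(le_trans pq qT)//; ring.
Qed.

Lemma abscont_le T T' w y : abscont T w y -> T' <= T -> abscont T' w y.
Proof.
move=> [iw yE] TT'; split; first exact: integ_le TT'.
by move=> t /andP[t0 tT]; apply: yE; rewrite t0 (le_trans tT).
Qed.

Lemma abscont_continuous T w y : abscont T w y -> {within `[0, T], continuous y}.
Proof.
move=> [iw yE]; have [T0|T0] := leP 0 T; last first.
  by rewrite set_itv_ge ?bnd_simp -?ltNge//; exact: continuous_subspace0.
have := parameterized_integral_continuous T0 iw => cI.
apply: (@subspace_eq_continuous _ _ _ (fun t => y 0 + prim w t)).
  by move=> t; rewrite inE /= in_itv /= => tT; rewrite -yE.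
by move=> t; apply: cvgD; [exact: cvg_cst|exact: cI].
Qed.

Lemma within_nearP (V : normedModType R) T (Y : R -> V) :
  {within `[0, T], continuous Y} <->
  forall a, 0 <= a <= T -> forall e, 0 < e ->
    \forall b \near a, 0 <= b <= T -> `|Y a - Y b| < e.
Proof.
rewrite subspace_continuousP; split=> [cY a aT e e0|cY a].
  have /cvgrPdist_lt/(_ e e0) := cY a ltac:(by rewrite /= in_itv).
  rewrite near_withinE; apply: filterS => b h bT; apply: h.
  by rewrite /= in_itv.
rewrite /= in_itv /= => aT; apply/cvgrPdist_lt => e e0.
rewrite near_withinE; apply: filterS (cY a aT e e0) => b h.
by rewrite /= in_itv /= => /h.
Qed.

Lemma integ_continuous T y : {within `[0, T], continuous y} -> integ T y.
Proof.
by move=> cy; apply: continuous_compact_integrable => //; exact: segment_compact.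
Qed.

Lemma within_measurable T y :
  {within `[0, T], continuous y} -> measurable_fun `[0, T] y.
Proof. by move=> cy; exact: subspace_continuous_measurable_fun. Qed.

Lemma within_bounded (V : normedModType R) T (y : R -> V) :
  {within `[0, T], continuous y} -> [bounded y t | t in `[0, T]].
Proof.
move=> cy; have /compact_bounded[M [Mr HM]] :=
  continuous_compact cy (@segment_compact R 0 T).
by exists M; split=> // z /HM h t tT; apply: h; exists t.
Qed.

Lemma integM T w c :
  integ T w -> {within `[0, T], continuous c} -> integ T (fun s => w s * c s).
Proof.
move=> iw cc.
exact: (@integrableMl _ _ _ mu `[0, T] _ (EFin \o w) c iw
  (within_measurable cc) (within_bounded cc)).
Qed.

Lemma integD T w w' : integ T w -> integ T w' -> integ T (fun s => w s + w' s).
Proof. by move=> iw iw'; exact: (integrableD _ iw iw'). Qed.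

Lemma integZ T w k : integ T w -> integ T (fun s => k * w s).
Proof. by move=> iw; exact: (integrableZl _ k iw). Qed.

Lemma integ_sum T (I : Type) (r : seq I) (P : pred I) (w : I -> R -> R) :
  (forall i, P i -> integ T (w i)) ->
  integ T (fun s => \sum_(i <- r | P i) w i s).
Proof.
move=> iw; have := @integrable_sum _ _ _ mu `[0, T] _ I r P
  (fun i => EFin \o w i) iw.
have E : (fun s => \sum_(i <- r | P i) (w i s)%:E)%E =
    EFin \o (fun s => \sum_(i <- r | P i) w i s).
  by apply/funext => s; rewrite /= sumEFin.
by rewrite /= E; exact.
Qed.

Lemma integ_norm T w : integ T w -> integ T (fun s => `|w s|).
Proof. by move=> iw; exact: integrable_norm. Qed.

Lemma abscontD T w w' y y' : abscont T w y -> abscont T w' y' ->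
  abscont T (fun s => w s + w' s) (fun s => y s + y' s).
Proof.
move=> [iw yE] [iw' yE']; split; first exact: integD.
move=> t /andP[t0 tT]; rewrite yE ?t0// yE' ?t0//.
have [jw jw'] := (integ_le iw tT, integ_le iw' tT).
rewrite /prim (RintegralD _ jw jw')//; ring.
Qed.

Lemma abscontZ T k w y : abscont T w y -> abscont T (fun s => k * w s) (fun s => k * y s).
Proof.
move=> [iw yE]; split; first exact: integZ.
move=> t /andP[t0 tT]; rewrite yE ?t0//.
by have jw := integ_le iw tT; rewrite /prim (RintegralZl _ _ jw)//; ring.
Qed.

Lemma abscont_cst T k : abscont T (fun=> 0) (fun=> k).
Proof.
split; first exact: integrable0.
by move=> t _; rewrite /prim Rintegral_cst// mul0r addr0.
Qed.

Lemma abscont_sum T (I : Type) (r : seq I) (P : pred I) (w y : I -> R -> R) :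
  (forall i, P i -> abscont T (w i) (y i)) ->
  abscont T (fun s => \sum_(i <- r | P i) w i s) (fun s => \sum_(i <- r | P i) y i s).
Proof.
move=> ac; elim: r => [|i r IH].
  by under eq_fun do rewrite big_nil; under [X in abscont _ _ X]eq_fun do rewrite big_nil;
    exact: abscont_cst.
have [Pi|nPi] := boolP (P i).
  under eq_fun do rewrite big_cons Pi.
  by under [X in abscont _ _ X]eq_fun do rewrite big_cons Pi; apply: abscontD => //;
    exact: ac.
under eq_fun do rewrite big_cons (negbTE nPi).
by under [X in abscont _ _ X]eq_fun do rewrite big_cons (negbTE nPi).
Qed.

Lemma abscont_mono T w w' y y' a b : abscont T w y -> abscont T w' y' ->
  0 <= a -> a <= b -> b <= T ->
  (forall s, a <= s <= b -> w s <= w' s) -> y b - y a <= y' b - y' a.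
Proof.
move=> ac ac' a0 ab bT ww'.
rewrite (abscontB ac)// (abscontB ac')//; apply: le_Rintegral => //.
- by apply: (integ_sub ac.1).
- by apply: (integ_sub ac'.1).
by move=> s /=; rewrite in_itv /= => /andP[/ltW a_s sb]; apply: ww'; rewrite a_s.
Qed.

(** An increment bound near each point, to either side, sums up over [0, T]:
    the set of times up to which the bound holds has a supremum m; m itself
    belongs to it by the bound to the left of m, and m < T would contradict the
    bound to the right of m. *)
Lemma local_to_global (T eta : R) (P I : R -> R) : 0 <= T ->
  (forall a, 0 <= a <= T -> \forall b \near a,
     0 <= b <= T -> `|P b - P a| <= eta * `|I b - I a|) ->
  (forall a b, 0 <= a -> a <= b -> b <= T -> I a <= I b) ->
  `|P T - P 0| <= eta * (I T - I 0).
Proof.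
move=> T0 loc mI.
pose S := [set t | 0 <= t <= T /\ `|P t - P 0| <= eta * (I t - I 0)].
have S0 : S 0 by split; [rewrite lexx|rewrite !subrr normr0 mulr0].
have Sub : ubound S T by move=> t [/andP[]].
have hS : has_sup S by split; [exists 0|exists T].
pose m := sup S.
have m0 : 0 <= m by exact: (ub_le_sup hS.2).
have mT : m <= T by exact: (ge_sup hS.1).
have mm : 0 <= m <= T by rewrite m0.
have /nbhs_normP[d /= d0 locm] := loc m mm.
have Sm : S m.
  have [t St mdt] := sup_adherent d0 hS; rewrite -/m in mdt.
  have tm : t <= m by exact: (ub_le_sup hS.2).
  have [/andP[t0 tT] Pt] := St; split=> //.
  have := locm t; rewrite /= ger0_norm ?subr_ge0// => /(_ ltac:(lra)).
  rewrite t0 tT => /(_ isT).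
  have Itm := mI _ _ t0 tm mT.
  rewrite (distrC (P t)) (distrC (I t)) (ger0_norm (x := I m - I t)) ?subr_ge0//.
  move=> Pm; have := ler_normD (P m - P t) (P t - P 0).
  rewrite (_ : P m - P t + (P t - P 0) = P m - P 0); last by ring.
  lra.
have [<-|mneT] := eqVneq m T; first by case: Sm.
have ltmT : m < T by rewrite lt_neqAle mneT.
pose b := Num.min (m + d / 2) T.
have mb : m < b by rewrite /b lt_min ltmT andbT; lra.
have bT : b <= T by rewrite /b ge_min lexx orbT.
have bd : b < m + d by rewrite /b gt_min; apply/orP; left; lra.
suff Sb : S b by have := ub_le_sup hS.2 Sb; rewrite leNgt mb.
have b0 : 0 <= b by lra.
split; first by rewrite b0.
have := locm b; rewrite /= distrC ger0_norm ?subr_ge0 ?(ltW mb)//.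
move=> /(_ ltac:(lra)); rewrite b0 bT => /(_ isT).
have Imb := mI _ _ m0 (ltW mb) bT.
rewrite (ger0_norm (x := I b - I m)) ?subr_ge0//.
move=> Pb; have [_ Pm] := Sm; have := ler_normD (P b - P m) (P m - P 0).
rewrite (_ : P b - P m + (P m - P 0) = P b - P 0); last by ring.
lra.
Qed.

(** First-order expansion of the integral of w c at a: near a, the factor c may
    be frozen at its value at a, with an error that is small compared with the
    integral of |w|. *)
Lemma abscont_local T w y c (a eta : R) : abscont T w y ->
  {within `[0, T], continuous c} -> 0 <= a <= T -> 0 < eta ->
  \forall b \near a, 0 <= b <= T ->
   `|(prim (fun s => w s * c s) b - prim (fun s => w s * c s) a)
     - c a * (y b - y a)|
   <= eta * `|prim (fun s => `|w s|) b - prim (fun s => `|w s|) a|.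
Proof.
move=> ac cc aT eta0.
have iw := ac.1; have iwc := integM iw cc; have iwn := integ_norm iw.
have key (p q : R) : 0 <= p -> p <= q -> q <= T ->
  (forall s, p < s -> s <= q -> `|c a - c s| <= eta) ->
  `|prim (fun s => w s * c s) q - prim (fun s => w s * c s) p
    - c a * (y q - y p)| <=
  eta * (prim (fun s => `|w s|) q - prim (fun s => `|w s|) p).
  move=> p0 pq qT H.
  rewrite (abscontB ac)// (primB iwc)// (primB iwn)//.
  have jw := integ_sub iw p0 qT; have jwc := integ_sub iwc p0 qT.
  have jwn := integ_sub iwn p0 qT.
  rewrite -(RintegralZl _ _ jw)// -RintegralB//; last exact: (integrableZl _ (c a) jw).
  rewrite -(RintegralZl _ _ jwn)//.
  have jd : mu.-integrable `]p, q] (EFin \o (fun s => w s * c s - c a * w s)).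
    exact: (integrableB _ jwc (integrableZl _ (c a) jw)).
  apply: le_trans (le_normr_Rintegral _ jd) _ => //.
  apply: le_Rintegral => //; first exact: integrable_norm.
    exact: (integrableZl _ eta jwn).
  move=> s /=; rewrite in_itv /= => /andP[ps sq].
  rewrite (_ : w s * c s - c a * w s = w s * (c s - c a)); last by ring.
  rewrite normrM mulrC; apply: ler_wpM2r => //.
  by rewrite distrC; exact: H.
have /within_nearP/(_ a aT eta eta0)/nbhs_normP[d /= d0 Hd] := cc.
apply/nbhs_normP; exists d => // b /= bd /andP[b0 bT].
have [ab|ba] := leP a b.
  have [a0 _] := andP aT.
  apply: le_trans (key a b a0 ab bT _) _.
    move=> s as' sb; apply/ltW/Hd => /=; last by rewrite (le_trans sb bT) andbT; lra.
    rewrite distrC ger0_norm ?subr_ge0 ?(ltW as')//.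
    by move: bd; rewrite distrC ger0_norm ?subr_ge0//; lra.
  by rewrite ler_wpM2l ?(ltW eta0)// ler_norm.
have [a0 aT'] := andP aT.
rewrite -normrN (_ : - (prim (fun s => w s * c s) b -
    prim (fun s => w s * c s) a - c a * (y b - y a)) =
  prim (fun s => w s * c s) a - prim (fun s => w s * c s) b - c a * (y a - y b));
  last by ring.
apply: le_trans (key b a b0 (ltW ba) aT' _) _.
  move=> s bs sa; apply/ltW/Hd => /=; last by rewrite (le_trans sa aT') andbT; lra.
  rewrite ger0_norm ?subr_ge0//.
  by move: bd; rewrite ger0_norm ?subr_ge0 ?(ltW ba)//; lra.
by rewrite ler_wpM2l ?(ltW eta0)// distrC ler_norm.
Qed.

Lemma near_forall2 (I J : finType) (P : I -> J -> set R) (a : R) :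
  (forall i j, \forall b \near a, P i j b) ->
  \forall b \near a, forall i j, P i j b.
Proof.
move=> H.
apply: (@filter_forall R I (fun i b => forall j, P i j b) (nbhs a) _) => i.
exact: (@filter_forall R J (P i) (nbhs a) _ (H i)).
Qed.

Definition abscont_mx m n T (w Y : R -> 'M[R]_(m, n)) :=
  forall i j, abscont T (fun t => w t i j) (fun t => Y t i j).

Lemma within_mx m n T (Y : R -> 'M[R]_(m, n)) :
  (forall i j, {within `[0, T], continuous (fun t => Y t i j)}) ->
  {within `[0, T], continuous Y}.
Proof.
move=> cY; apply/within_nearP => a aT e e0.
have : \forall b \near a, forall i : 'I_m, forall j : 'I_n,
    0 <= b <= T -> `|Y a i j - Y b i j| < e.
  apply: (@near_forall2 _ _ (fun i j b => 0 <= b <= T -> `|Y a i j - Y b i j| < e)).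
  by move=> i j; have /within_nearP := cY i j; exact.
apply: filterS => b H bT.
rewrite [ltLHS]/Num.Def.normr /= mx_normrE; apply/bigmax_ltP; split=> //= -[i j] _.
by rewrite !mxE; exact: H.
Qed.

Lemma abscont_mx_continuous m n T (w Y : R -> 'M[R]_(m, n)) :
  abscont_mx T w Y -> {within `[0, T], continuous Y}.
Proof. by move=> ac; apply: within_mx => i j; exact: abscont_continuous (ac i j). Qed.

Lemma within_comp (U V : topologicalType) T (Y : R -> U) (g : U -> V) :
  {within `[0, T], continuous Y} -> continuous g ->
  {within `[0, T], continuous (fun t => g (Y t))}.
Proof. by move=> cY cg x; apply: continuous_comp; [exact: cY|exact: cg]. Qed.

Lemma mx_norm_le m n (M : 'M[R]_(m, n)) e : 0 <= e ->
  (forall i j, `|M i j| <= e) -> `|M| <= e.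
Proof.
move=> e0 H; rewrite [leLHS]/Num.Def.normr /= mx_normrE.
by apply/bigmax_leP; split=> //= -[i j] _; exact: H.
Qed.

Lemma le_mx_norm m n (M : 'M[R]_(m, n)) i j : `|M i j| <= `|M|.
Proof.
rewrite [leRHS]/Num.Def.normr /= mx_normrE.
exact: (le_bigmax _ (fun ij : 'I_m * 'I_n => `|M ij.1 ij.2|) (i, j)).
Qed.

(** Chain rule along absolutely continuous curves. Let P be the difference of
    g o Y and the integral of the claimed derivative, and let I be the sum of the
    integrals of the entries of |w|. Differentiability of g and [abscont_local]
    give |P b - P a| <= e |I b - I a| for b near a, hence over [0, T] by
    [local_to_global]; as e is arbitrary, P is constant. Differentiability of Y at
    almost every time is thus avoided. *)
Lemma abscont_chain m n T (w Y : R -> 'M[R]_(m, n)) (g : 'M[R]_(m, n) -> R) :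
  abscont_mx T w Y -> (forall x, differentiable g x) ->
  (forall i j, continuous ('D_(delta_mx i j) g)) ->
  abscont T (fun t => 'D_(w t) g (Y t)) (fun t => g (Y t)).
Proof.
move=> ac dg cg; have cY := abscont_mx_continuous ac.
pose c i j t := 'D_(delta_mx i j) g (Y t).
have cc i j : {within `[0, T], continuous (c i j)} by exact: (within_comp cY (cg i j)).
rewrite (_ : (fun t => 'D__ g _) = fun t => \sum_i \sum_j w t i j * c i j t);
  last by apply/funext => t; rewrite derive_sum_delta.
have iwc i j : integ T (fun t => w t i j * c i j t).
  by apply: integM => //; exact: (ac i j).1.
pose J t := \sum_i \sum_j prim (fun s => w s i j * c i j s) t.
have acJ : abscont T (fun t => \sum_i \sum_j w t i j * c i j t) J.
  by apply: abscont_sum => i _; apply: abscont_sum => j _; exact: prim_abscont.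
split; first exact: acJ.1.
move=> t /andP[t0 tT].
have J0 : J 0 = 0.
  by rewrite /J big1// => i _; rewrite big1// => j _; rewrite prim0.
have -> : prim (fun t => \sum_i \sum_j w t i j * c i j t) t = J t.
  by rewrite (acJ.2 t) ?t0// J0 add0r.
pose I t := \sum_i \sum_j prim (fun s => `|w s i j|) t.
have iwn i j : integ T (fun s => `|w s i j|) by apply: integ_norm; exact: (ac i j).1.
have mIij i j a b : 0 <= a -> a <= b -> b <= T ->
    0 <= prim (fun s => `|w s i j|) b - prim (fun s => `|w s i j|) a.
  move=> a0 ab bT; rewrite (primB (iwn i j))//.
  by apply: Rintegral_ge0.
have IB a b : I b - I a = \sum_i \sum_j
    (prim (fun s => `|w s i j|) b - prim (fun s => `|w s i j|) a).
  by rewrite /I -sumrB; apply: eq_bigr => i _; rewrite -sumrB.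
have mI a b : 0 <= a -> a <= b -> b <= T -> I a <= I b.
  move=> a0 ab bT; rewrite -subr_ge0 IB; apply: sumr_ge0 => i _.
  by apply: sumr_ge0 => j _; exact: mIij.
have absI a b : 0 <= a <= T -> 0 <= b <= T -> `|I b - I a| = \sum_i \sum_j
    `|prim (fun s => `|w s i j|) b - prim (fun s => `|w s i j|) a|.
  move=> /andP[a0 aT] /andP[b0 bT]; have [ab|/ltW ba] := leP a b.
    rewrite ger0_norm ?subr_ge0 ?mI// IB; apply: eq_bigr => i _.
    by apply: eq_bigr => j _; rewrite ger0_norm ?mIij.
  rewrite distrC ger0_norm ?subr_ge0 ?mI// IB; apply: eq_bigr => i _.
  by apply: eq_bigr => j _; rewrite distrC ger0_norm ?mIij.
pose P t := g (Y t) - J t.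
suff : forall e, 0 < e -> `|P t - P 0| <= e * (I t - I 0).
  move=> H; suff : P t - P 0 = 0 by rewrite /P J0; lra.
  apply/eqP; rewrite -normr_le0; apply/ler_addgt0Pr => e e0; rewrite add0r.
  have I0 : 0 <= I t - I 0 by rewrite subr_ge0; exact: mI.
  apply: le_trans (H (e / (I t - I 0 + 1)) _) _; first by rewrite divr_gt0//; lra.
  rewrite mulrAC ler_pdivrMr; last lra.
  by rewrite ler_wpM2l ?(ltW e0)//; lra.
move=> e e0.
apply: local_to_global => // [a /andP[a0 at']|a b a0 ab bt]; last first.
  by apply: mI => //; exact: le_trans tT.
have aT : 0 <= a <= T by rewrite a0 (le_trans at' tT).
have e20 : 0 < e / 2 by rewrite divr_gt0.
have near1 : \forall b \near a, 0 <= b <= T ->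
    `|g (Y b) - g (Y a) - 'D_(Y b - Y a) g (Y a)| <= e / 2 * `|Y b - Y a|.
  have /eqaddoP := diff_locally (dg (Y a)).
  move=> /(_ _ e20) /nbhs_normP[d /= d0 Hd].
  have /within_nearP/(_ a aT d d0) := cY.
  apply: filterS => b H bT.
  have := Hd (Y b - Y a); rewrite /= sub0r normrN distrC => /(_ (H bT)).
  by rewrite /= !fctE /= subrK deriveE// opprD addrA.
have near2 : \forall b \near a, forall i j, 0 <= b <= T ->
   `|(prim (fun s => w s i j * c i j s) b - prim (fun s => w s i j * c i j s) a)
     - c i j a * (Y b i j - Y a i j)|
   <= e / 2 * `|prim (fun s => `|w s i j|) b - prim (fun s => `|w s i j|) a|.
  apply: (@near_forall2 _ _ (fun i j b => 0 <= b <= T ->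
   `|(prim (fun s => w s i j * c i j s) b - prim (fun s => w s i j * c i j s) a)
     - c i j a * (Y b i j - Y a i j)|
   <= e / 2 * `|prim (fun s => `|w s i j|) b - prim (fun s => `|w s i j|) a|)).
  by move=> i j; exact: (abscont_local (ac i j) (cc i j) aT e20).
near=> b; move=> /andP[b0 bt].
have bT : 0 <= b <= T by rewrite b0 (le_trans bt tT).
have h1 : `|g (Y b) - g (Y a) - 'D_(Y b - Y a) g (Y a)| <= e / 2 * `|Y b - Y a|.
  by move: bT; near: b.
have h2 : forall i j,
   `|(prim (fun s => w s i j * c i j s) b - prim (fun s => w s i j * c i j s) a)
     - c i j a * (Y b i j - Y a i j)|
   <= e / 2 * `|prim (fun s => `|w s i j|) b - prim (fun s => `|w s i j|) a|.
  by move=> i j; move: i j bT; near: b.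
have h3 : `|Y b - Y a| <= `|I b - I a|.
  apply: mx_norm_le => // i j; rewrite absI// !mxE.
  apply: (@le_trans _ _ `|prim (fun s => `|w s i j|) b - prim (fun s => `|w s i j|) a|).
    have acij := ac i j.
    have incr p q : 0 <= p -> p <= q -> q <= T -> `|Y q i j - Y p i j| <=
        `|prim (fun s => `|w s i j|) q - prim (fun s => `|w s i j|) p|.
      move=> p0 pq qT; rewrite (abscontB acij)// [leRHS]ger0_norm; last exact: mIij.
      rewrite (primB (iwn i j))//; apply: le_normr_Rintegral => //.
      exact: (integ_sub acij.1).
    have [ab|/ltW ba] := leP a b.
      by apply: incr => //; case/andP: bT.
    by rewrite distrC [leRHS]distrC; apply: incr => //; case/andP: aT.
  rewrite (bigD1 i)//= (bigD1 j)//= -!addrA lerDl addr_ge0// sumr_ge0// => k _.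
  by rewrite sumr_ge0.
have h4 : `|(J b - J a) - 'D_(Y b - Y a) g (Y a)| <= e / 2 * `|I b - I a|.
  rewrite absI// derive_sum_delta// /J -!sumrB mulr_sumr.
  apply: le_trans (ler_norm_sum _ _ _) _; apply: ler_sum => i _.
  rewrite -!sumrB mulr_sumr; apply: le_trans (ler_norm_sum _ _ _) _.
  apply: ler_sum => j _; apply: le_trans (h2 i j).
  by rewrite !mxE [X in _ - X]mulrC.
rewrite /P (_ : g (Y b) - J b - (g (Y a) - J a) =
  (g (Y b) - g (Y a) - 'D_(Y b - Y a) g (Y a)) -
  ((J b - J a) - 'D_(Y b - Y a) g (Y a))); last by ring.
apply: le_trans (ler_normB _ _) _.
have := ler_wpM2l (ltW e20) h3; lra.
Unshelve. all: by end_near.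
Qed.

End abscont.

(** * Global solutions of differential equations with integrable forcing *)

Section ODE.
Context {R : realType}.
Notation mu := (@lebesgue_measure R).

Lemma bounded_on_ball m n (g : 'M[R]_(m, n) -> R) (r : R) : continuous g ->
  exists2 K, 0 <= K & forall x, `|x| <= r -> `|g x| <= K.
Proof.
move=> cg; pose A := [set v : 'rV[R]_(m * n) | `|v| <= r].
have cA : compact A.
  apply: bounded_closed_compact.
    by exists r; split; [exact: num_real|move=> z rz v /= vr; exact: le_trans vr (ltW rz)].
  apply: (@preimage_closed _ _ (fun v : 'rV[R]_(m * n) => `|v|) [set x | x <= r]).
    by move=> v _; exact: norm_continuous.
  exact: closed_le.
have cvec : continuous (fun v : 'rV[R]_(m * n) => vec_mx v : 'M[R]_(m, n)).
  apply: smooth_continuous; apply: smooth_mx => i j.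
  under eq_fun do rewrite mxE.
  exact/smooth_coord/smooth_id.
have cgv : continuous (fun v : 'rV[R]_(m * n) => g (vec_mx v)).
  by move=> v; apply: (continuous_comp (cvec v)); exact: cg.
have /compact_bounded[M [Mr HM]] := continuous_compact (continuous_subspaceT cgv) cA.
exists (`|M| + 1); first by rewrite addr_ge0.
move=> x xr; apply: (HM (`|M| + 1)); first by rewrite (le_lt_trans (ler_norm M))// ltrDl.
exists (mxvec x); last by rewrite mxvecK.
have [r0 _] : 0 <= r /\ True by split=> //; exact: le_trans xr.
rewrite /A /=; apply: mx_norm_le => // i j.
case/mxvec_indexP: j => a b; rewrite ord1 mxvecE.
exact: le_trans (le_mx_norm _ _ _) xr.
Qed.

Lemma derive_norm_le m n (g : 'M[R]_(m, n) -> R) x v K : differentiable g x ->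
  (forall i j, `|'D_(delta_mx i j) g x| <= K i j) ->
  `|'D_v g x| <= (\sum_i \sum_j K i j) * `|v|.
Proof.
move=> dg HK; rewrite derive_sum_delta// mulr_suml.
apply: le_trans (ler_norm_sum _ _ _) _; apply: ler_sum => i _.
rewrite mulr_suml; apply: le_trans (ler_norm_sum _ _ _) _; apply: ler_sum => j _.
rewrite normrM mulrC; apply: ler_pM => //; exact: le_mx_norm.
Qed.

(** Mean value theorem on the segment from y to x, which stays in the ball. *)
Lemma lipschitz_on_ball m n (g : 'M[R]_(m, n) -> R) (r : R) : smooth g ->
  exists2 L, 0 <= L &
    forall x y, `|x| <= r -> `|y| <= r -> `|g x - g y| <= L * `|x - y|.
Proof.
move=> sg; have dg := smooth_differentiable sg.
have /choice[K HK] : forall ij : 'I_m * 'I_n, exists K : R, 0 <= K /\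
    forall x, `|x| <= r -> `|'D_(delta_mx ij.1 ij.2) g x| <= K.
  move=> ij; have [K K0 HK] := bounded_on_ball r
    (smooth_continuous (smooth_derive (delta_mx ij.1 ij.2) sg)).
  by exists K.
exists (\sum_i \sum_j K (i, j)).
  by apply: sumr_ge0 => i _; apply: sumr_ge0 => j _; case: (HK (i, j)).
move=> x y xr yr; pose v := x - y.
pose phi (t : R) := g (t *: v + y).
have dphi (t : R) : is_derive t (1 : R) phi ('D_v g (t *: v + y)).
  have E : (fun h : R => h^-1 *: ((phi \o shift t) (h *: 1) - phi t)) =
      fun h => h^-1 *: ((g \o shift (t *: v + y)) (h *: v) - g (t *: v + y)).
    apply/funext => h; rewrite /phi /= /shift /= scalerDl addrA.
    by congr (_ *: (g (_ *: _ + _ + _) - _)); rewrite -[_ *: 1]/(h * 1) mulr1.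
  split; first by rewrite /derivable E;
    exact: (@diff_derivable _ _ _ g (t *: v + y) v (dg _)).
  by rewrite /derive E.
have cphi : {within `[0, 1], continuous phi}.
  apply: continuous_subspaceT => t.
  apply: differentiable_continuous; apply/derivable1_diffP.
  by case: (dphi t).
have [c /[!in_itv]/= /andP[c0 c1]] := @MVT_segment R phi
  (fun t => 'D_v g (t *: v + y)) 0 1 ler01 (fun t _ => dphi t) cphi.
rewrite /phi scale1r scale0r add0r subrK subr0 mulr1 => ->.
apply: derive_norm_le => // i j; apply: (HK (i, j)).2.
rewrite (_ : c *: v + y = c *: x + (1 - c) *: y); last first.
  by apply/matrixP => a b; rewrite /v !mxE; ring.
apply: le_trans (ler_normD _ _) _; rewrite !normrZ !ger0_norm ?subr_ge0//.
have := ler_wpM2l c0 xr; have := @ler_wpM2l R (1 - c) ltac:(lra) _ _ yr; lra.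
Qed.

(** The entrywise truncation is a 1-Lipschitz retraction onto the ball, as the
    norm of matrices is the sup norm. Composing a smooth field with it makes the
    field bounded and globally Lipschitz. *)
Definition clamp m n (r : R) (x : 'M[R]_(m, n)) : 'M[R]_(m, n) :=
  map_mx (fun a => Num.max (- r) (Num.min a r)) x.

Lemma clamp_cases (r a : R) : 0 <= r ->
  let c := Num.max (- r) (Num.min a r) in
  [\/ c = a /\ - r <= a <= r, c = r /\ r < a | c = - r /\ a < - r].
Proof.
move=> r0 /=; have [ar|ra] := leP a r.
  have [ra|ar'] := leP (- r) a; first by constructor 1; split=> //; apply/andP.
  by constructor 3.
by have [_|h] := leP (- r) r; [constructor 2|lra].
Qed.

Lemma clamp1 (r a b : R) : 0 <= r ->
  `|Num.max (- r) (Num.min a r)| <= r /\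
  `|Num.max (- r) (Num.min a r) - Num.max (- r) (Num.min b r)| <= `|a - b| /\
  (`|a| <= r -> Num.max (- r) (Num.min a r) = a).
Proof.
move=> r0; have := clamp_cases a r0; have := clamp_cases b r0.
set c := Num.max _ _; set c' := Num.max _ _ => /= Hc Hc'.
split; [|split].
- by rewrite ler_norml; case: Hc' => -[-> h]; lra.
- have [ab|ab] := leP b a.
    rewrite (ger0_norm (x := a - b)) ?subr_ge0// ler_norml.
    by case: Hc => -[-> h]; case: Hc' => -[-> h']; lra.
  rewrite (distrC a) (ger0_norm (x := b - a)) ?subr_ge0 ?(ltW ab)// ler_norml.
  by case: Hc => -[-> h]; case: Hc' => -[-> h']; lra.
- by rewrite ler_norml => h2; case: Hc' => -[-> h]; lra.
Qed.

Lemma clamp_norm m n r (x : 'M[R]_(m, n)) : 0 <= r -> `|clamp r x| <= r.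
Proof.
by move=> r0; apply: mx_norm_le => // i j; rewrite mxE; case: (clamp1 (x i j) 0 r0).
Qed.

Lemma clamp_lip m n r (x y : 'M[R]_(m, n)) : 0 <= r ->
  `|clamp r x - clamp r y| <= `|x - y|.
Proof.
move=> r0; apply: mx_norm_le => // i j; rewrite !mxE.
have [_ [h _]] := clamp1 (x i j) (y i j) r0; apply: le_trans h _.
by have := le_mx_norm (x - y) i j; rewrite !mxE.
Qed.

Lemma clamp_id m n r (x : 'M[R]_(m, n)) : `|x| <= r -> clamp r x = x.
Proof.
move=> xr; have r0 : 0 <= r by exact: le_trans xr.
apply/matrixP => i j; rewrite mxE; have [_ [_]] := clamp1 (x i j) 0 r0.
by apply; apply: le_trans xr; exact: le_mx_norm.
Qed.

Lemma lip_continuous m n p q (g : 'M[R]_(m, n) -> 'M[R]_(p, q)) L : 0 <= L ->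
  (forall x y, `|g x - g y| <= L * `|x - y|) -> continuous g.
Proof.
move=> L0 H x.
apply/(@cvgrPdist_lt _ _ _ (nbhs x) (nbhs_filter x)) => e e0.
have d0 : 0 < e / (L + 1) by rewrite divr_gt0//; lra.
apply: (@filterS _ (nbhs x) (nbhs_filter x) _ _ _ (nbhsx_ballx x _ d0)) => y.
rewrite -ball_normE /= ltr_pdivlMr; last lra.
move=> xy; apply: le_lt_trans (H x y) _.
have := normr_ge0 (x - y); nra.
Qed.

Lemma prim_expR_le (L t : R) : 0 < L -> 0 <= t ->
  prim (fun s => L * expR (L * s)) t <= expR (L * t).
Proof.
move=> L0; rewrite le_eqVlt => /predU1P[<-|t0]; first by rewrite prim0 expR_ge0.
have d (s : R) : is_derive s (1 : R) (fun s : R => expR (L * s)) (L * expR (L * s)).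
  by apply: is_derive_eq; rewrite ?scaler1 /GRing.scale /=; ring.
have cE : continuous (fun s => expR (L * s)).
  move=> s; apply: differentiable_continuous; apply/derivable1_diffP.
  by case: (d s).
have := @continuous_FTC2 R (fun s => L * expR (L * s)) (fun s => expR (L * s)) 0 t t0.
rewrite /prim /Rintegral => ->.
- by rewrite mulr0 expR0 /= gerBl.
- apply: continuous_subspaceT => s.
  by apply: cvgM; [exact: cvg_cst|exact: cE].
- split.
  + by move=> s _; case: (d s).
  + exact/cvg_at_right_filter/cE.
  + exact/cvg_at_left_filter/cE.
- by move=> s _; rewrite derive1E; case: (d s).
Qed.

Lemma prim_norm_le (T t : R) (w w' : R -> R) : integ T w -> integ T w' -> 0 <= t <= T ->
  (forall s, 0 <= s <= t -> `|w s| <= w' s) -> `|prim w t| <= prim w' t.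
Proof.
move=> iw iw' /andP[t0 tT] H.
have [jw jw'] := (integ_le iw tT, integ_le iw' tT).
apply: le_trans (le_normr_Rintegral _ jw) _ => //.
apply: le_Rintegral => //; first exact: integrable_norm.
Qed.

Lemma prim_cst (K t : R) : 0 <= t -> prim (fun=> K) t = K * t.
Proof.
move=> t0; rewrite /prim Rintegral_cst//; congr (_ * _).
have E : mu `[0, t] = t%:E.
  apply: etrans (lebesgue_measure_itv `[0, t]) _.
  by rewrite /= lte_fin; case: ltgtP t0 => // [_ _|<- //]; rewrite oppr0 adde0.
exact: (congr1 fine E).
Qed.

Lemma geometric_steps_cvg (u : nat -> R) M : 
  (forall k, `|u k.+1 - u k| <= M * (2^-1) ^+ k) -> cvgn u.
Proof.
move=> H.
have -> : u = fun n => u 0%N + series (telescope u) n.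
  by apply/funext => n; rewrite -eq_sum_telescope.
apply: is_cvgD; first exact: is_cvg_cst.
apply: normed_cvg; apply: (series_le_cvg (v_ := geometric M 2^-1)) => //.
- by move=> n; exact: normr_ge0.
- by move=> n; exact: (le_trans (normr_ge0 _) (H n)).
- by apply: is_cvg_geometric_series; rewrite ger0_norm ?invr_ge0// invf_lt1// ltr1n.
Qed.

(** Picard iteration. With the weight exp(2 L t) each step halves the distance
    of consecutive iterates, so they converge at every time of the half line; the
    limit passes under the integral by dominated convergence, K being a bound of
    the integrands. *)
Lemma picard m n (G : 'M[R]_(m, n) -> 'M[R]_(m, n)) (h : R -> 'M[R]_(m, n))
    (y0 : 'M[R]_(m, n)) (K L : R) : 0 <= K -> 0 < L ->
  (forall x, `|G x| <= K) -> (forall x y, `|G x - G y| <= L * `|x - y|) ->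
  (forall T i j, integ T (fun t => h t i j)) ->
  exists Y, Y 0 = y0 /\ forall T, abscont_mx T (fun t => G (Y t) + h t) Y.
Proof.
move=> K0 L0 HK HL ih; have cG := lip_continuous (ltW L0) HL.
pose H t : 'M[R]_(m, n) := y0 + \matrix_(i, j) prim (fun s => h s i j) t.
pose next (Z : R -> 'M[R]_(m, n)) t : 'M[R]_(m, n) :=
  H t + \matrix_(i, j) prim (fun s => G (Z s) i j) t.
pose Z k := iter k next H.
have cGZ k T : {within `[0, T], continuous (Z k)} ->
    forall i j, {within `[0, T], continuous (fun s => G (Z k s) i j)}.
  move=> cZ i j.
  exact: (@within_comp _ _ _ _ _ (fun x : 'M[R]_(m, n) => x i j)
    (within_comp cZ cG) (@coord_continuous _ m n i j)).
have cH T i j : {within `[0, T], continuous (fun t => H t i j)}.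
  have cp := abscont_continuous (prim_abscont (ih T i j)).
  rewrite (_ : (fun t => _) = fun t => y0 i j + prim (fun s => h s i j) t); last first.
    by apply/funext => t; rewrite !mxE.
  by move=> t; apply: cvgD; [exact: cvg_cst|exact: cp].
have cZ k T : {within `[0, T], continuous (Z k)}.
  elim: k => [|k IH]; first by apply: within_mx => i j; exact: cH.
  apply: within_mx => i j.
  rewrite (_ : (fun t => _) = fun t => H t i j + prim (fun s => G (Z k s) i j) t);
    last by apply/funext => t; rewrite /Z /= /next !mxE.
  have cp := abscont_continuous (prim_abscont (integ_continuous (cGZ _ _ IH i j))).
  by move=> t; apply: cvgD; [exact: cH|exact: cp].
have iGZ k T i j : integ T (fun s => G (Z k s) i j).
  by apply: integ_continuous; exact: cGZ.
(* This value of C gives K t <= C exp(2 L t), the bound of the first step. *)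
pose C := K / L.
have C0 : 0 <= C by rewrite divr_ge0// ltW.
have diffk k t : 0 <= t ->
    `|Z k.+1 t - Z k t| <= C * 2^-1 ^+ k * expR (2 * L * t).
  elim: k t => [|k IH] t t0.
    rewrite expr0 mulr1; apply: mx_norm_le => [|i j]; first by rewrite mulr_ge0 ?expR_ge0.
    rewrite /Z /= /next !mxE addrC addrA addNr add0r.
    apply: le_trans (prim_norm_le (w' := fun=> K) (iGZ 0%N t i j) _ _ _) _.
    - by apply: integ_continuous; apply: continuous_subspaceT => s; exact: cvg_cst.
    - by rewrite t0 lexx.
    - by move=> s _; apply: le_trans (HK _); exact: le_mx_norm.
    rewrite prim_cst// /C mulrAC ler_pdivlMr// -(mulrA K); apply: ler_wpM2l => //.
    have := expR_ge1Dx (2 * L * t); have := mulr_ge0 (ltW L0) t0; nra.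
  have e0 : 0 <= C * 2^-1 ^+ k.+1 by rewrite mulr_ge0// exprn_ge0.
  apply: mx_norm_le => [|i j]; first by rewrite mulr_ge0 ?expR_ge0.
  rewrite [Z k.+2]/(next (Z k.+1)) [in X in _ - X]/Z /= -/(Z k) /next !mxE.
  rewrite opprD addrACA subrr add0r -RintegralB//; last 2 first.
    exact: (iGZ k.+1 t i j).
    exact: (iGZ k t i j).
  have L2 : 0 < 2 * L by rewrite mulr_gt0.
  have iE : integ t (fun s => 2 * L * expR (2 * L * s)).
    apply: integ_continuous; apply: continuous_subspaceT => s.
    apply: cvgM; first exact: cvg_cst.
    apply: (@continuous_comp _ _ _ (fun s => 2 * L * s) expR); last exact: continuous_expR.
    by apply: cvgM; [exact: cvg_cst|exact: cvg_id].
  apply: le_trans (prim_norm_le (T := t)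
    (w' := fun s => C * 2^-1 ^+ k.+1 * (2 * L * expR (2 * L * s))) _ _ _ _) _.
  - exact: (integrableB _ (iGZ k.+1 t i j) (iGZ k t i j)).
  - exact: integZ.
  - by rewrite t0 lexx.
  - move=> s /andP[s0 st].
    have := le_mx_norm (G (Z k.+1 s) - G (Z k s)) i j; rewrite !mxE => /le_trans; apply.
    apply: le_trans (HL _ _) _.
    rewrite (_ : C * _ * _ = L * (C * 2^-1 ^+ k * expR (2 * L * s)));
      last by rewrite exprS; field.
    by rewrite ler_wpM2l ?(ltW L0)//; exact: IH.
  rewrite /prim RintegralZl//; apply: ler_wpM2l => //.
  exact: (prim_expR_le L2 t0).
have cvgZ t i j : 0 <= t -> cvgn (fun k => Z k t i j).
  move=> t0; apply: (@geometric_steps_cvg _ (C * expR (2 * L * t))) => k.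
  rewrite mulrAC; apply: le_trans (diffk k t t0).
  by have := le_mx_norm (Z k.+1 t - Z k t) i j; rewrite !mxE.
pose Y t : 'M[R]_(m, n) := \matrix_(i, j) limn (fun k => Z k t i j).
have ZY t : 0 <= t -> Z ^~ t @ \oo --> Y t.
  move=> t0; apply/cvgrPdist_lt => e e0.
  have near_ij : \forall k \near \oo, forall ij : 'I_m * 'I_n,
      `|Y t ij.1 ij.2 - Z k t ij.1 ij.2| < e.
    apply: (@filter_forall _ _ (fun (ij : 'I_m * 'I_n) k =>
      `|Y t ij.1 ij.2 - Z k t ij.1 ij.2| < e) \oo _) => ij.
    rewrite mxE; have /cvgrPdist_lt := cvgZ t ij.1 ij.2 t0; exact.
  apply: filterS near_ij => k Hk.
  rewrite [ltLHS]/Num.Def.normr /= mx_normrE; apply/bigmax_ltP; split=> //= ij _.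
  by rewrite !mxE; have := Hk ij; rewrite mxE.
have GZY t i j : 0 <= t -> (fun k => G (Z k t) i j) @ \oo --> G (Y t) i j.
  move=> t0.
  have c1 : (fun x => G x i j) y @[y --> Y t] --> G (Y t) i j.
    exact: (continuous_comp (cG (Y t)) (@coord_continuous _ _ _ i j (G (Y t)))).
  exact: (cvg_comp _ _ (ZY t t0) c1).
have limint T i j : 0 <= T -> integ T (fun s => G (Y s) i j) /\
    (fun k => prim (fun s => G (Z k s) i j) T) @ \oo --> prim (fun s => G (Y s) i j) T.
  move=> T0.
  have mGZ k : measurable_fun `[0, T] (fun s => G (Z k s) i j).
    exact: within_measurable (cGZ _ _ (cZ k T) i j).
  have mE k : measurable_fun `[0, T] (fun s => (G (Z k s) i j)%:E).
    exact/measurable_EFinP.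
  have [i1 _ i3] := @dominated_convergence _ _ _ mu `[0, T] ltac:(by [])
    (fun k s => (G (Z k s) i j)%:E) (fun s => (G (Y s) i j)%:E) (fun=> K%:E)
    mE
    ltac:(apply/measurable_EFinP; apply: (measurable_fun_cvg mGZ) => s /=;
          rewrite in_itv /= => /andP[s0 _]; exact: GZY)
    ltac:(apply: aeW => s /=; rewrite in_itv /= => /andP[s0 _];
          apply/fine_cvgP; split; [exact: nearW|exact: GZY])
    ltac:(apply: integ_continuous; apply: continuous_subspaceT => s; exact: cvg_cst)
    ltac:(apply: aeW => s k _; rewrite lee_fin; apply: le_trans (HK _); exact: le_mx_norm).
  split; first exact: i1.
  have fn : (\int[mu]_(s in `[0%R, T]) (G (Y s) i j)%:E)%E \is a fin_num.
    exact: (integrable_fin_num _ i1).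
  move: i3; rewrite -(fineK fn) => i3; exact: (fine_cvg i3).
exists Y.
have YE t i j : 0 <= t ->
    Y t i j = H t i j + prim (fun s => G (Y s) i j) t.
  move=> t0; rewrite mxE; apply/cvg_lim => //.
  rewrite -(cvg_shiftS (fun k => Z k t i j)).
  rewrite (_ : (fun k => _) = fun k => H t i j + prim (fun s => G (Z k s) i j) t);
    last by apply/funext => k; rewrite /Z /= /next !mxE.
  by apply: cvgD; [exact: cvg_cst|exact: (limint t i j t0).2].
have Y0 : Y 0 = y0.
  by apply/matrixP => i j; rewrite YE// !mxE !prim0 !addr0.
split=> // T i j; have [T0|T0] := leP 0 T; last first.
  split; first by rewrite /integ set_itv_ge ?bnd_simp -?ltNge//; exact: integrable_set0.
  by move=> t /andP[t0 tT]; have := le_trans t0 tT; rewrite leNgt T0.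
have iGY := (limint T i j T0).1.
have E : (fun t => (G (Y t) + h t) i j) = fun t => G (Y t) i j + h t i j.
  by apply/funext => t; rewrite mxE.
rewrite E; split; first exact: integD.
move=> t /andP[t0 tT]; rewrite Y0 YE// !mxE /prim RintegralD//.
- ring.
- exact: integ_le tT.
- exact: ih.
Qed.

(** A smooth field truncated to the ball of radius r > B has a solution Y on the
    half line ([picard]). As long as Y stays in the ball it solves the given
    equation, so its norm is at most B < r, and by continuity it can never leave
    the ball. The bound B must not depend on T for the radius to be chosen. *)
Lemma ode_global m n (G : 'M[R]_(m, n) -> 'M[R]_(m, n)) (h : R -> 'M[R]_(m, n))
    (y0 : 'M[R]_(m, n)) (B : R) :
  (forall i j, smooth (fun x => G x i j)) ->
  (forall T i j, integ T (fun t => h t i j)) ->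
  (forall T Y, 0 <= T -> Y 0 = y0 -> abscont_mx T (fun t => G (Y t) + h t) Y ->
     `|Y T| <= B) ->
  exists Y, Y 0 = y0 /\ forall T, abscont_mx T (fun t => G (Y t) + h t) Y.
Proof.
move=> sG ih apriori.
pose r := `|B| + `|y0| + 1.
have r0 : 0 <= r by rewrite /r !addr_ge0.
have /choice[K HK] : forall ij : 'I_m * 'I_n, exists K : R, 0 <= K /\
    forall x, `|x| <= r -> `|G x ij.1 ij.2| <= K.
  move=> ij; have [K K0 H] := bounded_on_ball r (smooth_continuous (sG ij.1 ij.2)).
  by exists K.
have /choice[L HL] : forall ij : 'I_m * 'I_n, exists L : R, 0 <= L /\
    forall x y, `|x| <= r -> `|y| <= r ->
      `|G x ij.1 ij.2 - G y ij.1 ij.2| <= L * `|x - y|.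
  move=> ij; have [L L0 H] := lipschitz_on_ball r (sG ij.1 ij.2).
  by exists L.
pose KK := \sum_ij K ij; pose LL := \sum_ij L ij + 1.
have KKle ij : K ij <= KK.
  rewrite /KK (bigD1 ij)//= lerDl sumr_ge0// => kl _; by case: (HK kl).
have LLle ij : L ij <= LL.
  rewrite /LL (bigD1 ij)//= -addrA lerDl addr_ge0// sumr_ge0// => kl _; by case: (HL kl).
have KK0 : 0 <= KK by rewrite sumr_ge0// => ij _; case: (HK ij).
have LL0 : 0 < LL by rewrite ltr_wpDl// sumr_ge0// => ij _; case: (HL ij).
have [|||Y [Y0 acY]] := @picard m n (fun x => G (clamp r x)) h y0 KK LL KK0 LL0.
- move=> x; apply: mx_norm_le => // i j.
  have [_ H] := HK (i, j); apply: le_trans (H _ (clamp_norm x r0)) _; exact: KKle.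
- move=> x y; apply: mx_norm_le => [|i j]; first by rewrite mulr_ge0// ltW.
  rewrite !mxE; have [L1 H] := HL (i, j).
  apply: le_trans (H _ _ (clamp_norm x r0) (clamp_norm y r0)) _.
  by apply: ler_pM; [exact: L1|exact: normr_ge0|exact: LLle|exact: clamp_lip].
- exact: ih.
exists Y; split=> //.
have restr T : 0 <= T -> (forall t, 0 <= t <= T -> `|Y t| <= r) ->
    abscont_mx T (fun t => G (Y t) + h t) Y.
  move=> T0 Yr i j; have [iw yE] := acY T i j.
  have eqw t : 0 <= t <= T -> (G (clamp r (Y t)) + h t) i j = (G (Y t) + h t) i j.
    by move=> tT; rewrite clamp_id ?Yr.
  split.
    apply: eq_integrable iw => // t /[!inE] /=; rewrite in_itv /= => tT.
    by rewrite /= eqw.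
  move=> t tT; rewrite yE//; congr (_ + _); apply: eq_Rintegral => s /[!inE] /=.
  rewrite in_itv /= => /andP[s0 st]; rewrite eqw// s0 /=.
  by case/andP: tT => _; exact: le_trans.
suff Yr t : 0 <= t -> `|Y t| <= r.
  move=> T; have [T0|T0] := leP 0 T; first by apply: restr => // t /andP[t0 _]; exact: Yr.
  move=> i j; split; first by rewrite /integ set_itv_ge ?bnd_simp -?ltNge//;
    exact: integrable_set0.
  by move=> t /andP[t0 tT]; have := le_trans t0 tT; rewrite leNgt T0.
move=> t0_ge0; rename t into t0.
pose S := [set t | 0 <= t <= t0 /\ forall s, 0 <= s <= t -> `|Y s| <= r].
have y0r : `|y0| <= r by rewrite /r; have := normr_ge0 B; lra.
have S0 : S 0.
  by split; [rewrite lexx|move=> s; rewrite -eq_le => /eqP <-; rewrite Y0].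
have hS : has_sup S by split; [exists 0|exists t0 => t [/andP[]]].
(* If Y leaves the ball before t0, then T is the time of first exit; the gap
   r - B >= 1 leaves room beyond T. *)
pose T := sup S.
have T0 : 0 <= T by exact: (ub_le_sup hS.2).
have Tt0 : T <= t0 by apply: (ge_sup hS.1) => t [/andP[]].
have cY := abscont_mx_continuous (acY (t0 + 1)).
have YB s : 0 <= s -> s < T -> `|Y s| <= B.
  move=> s0 sT; have d0 : 0 < T - s by rewrite subr_gt0.
  have [t [/andP[t_0 tt0] Ht] st] := sup_adherent d0 hS.
  apply: (apriori s Y s0 Y0); apply: restr => // u /andP[u0 us]; apply: Ht.
  rewrite u0 (le_trans us)//; move: st; rewrite -/T; lra.
have YT : `|Y T| <= r.
  have := T0; rewrite le_eqVlt => /predU1P[<-|Tpos]; first by rewrite Y0.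
  have /within_nearP/(_ T _ 1 ltr01) := cY.
  have TT : 0 <= T <= t0 + 1 by rewrite T0 (le_trans Tt0)// lerDl.
  move=> /(_ TT)/nbhs_normP[d /= d0 Hd].
  pose s := Num.max 0 (T - d / 2).
  have s0 : 0 <= s by rewrite /s le_max lexx.
  have sT : s < T by rewrite /s gt_max Tpos; lra.
  have sd : T - d / 2 <= s by rewrite /s le_max lexx orbT.
  have := Hd s; rewrite /= ger0_norm ?subr_ge0 ?(ltW sT)// => /(_ ltac:(lra)).
  have hs : 0 <= s <= t0 + 1 by apply/andP; split=> //; lra.
  move=> /(_ hs) h1.
  have := ler_normD (Y T - Y s) (Y s); rewrite subrK.
  have := YB s s0 sT; have := ler_norm B; have := normr_ge0 y0.
  by rewrite /r; lra.
have HT s : 0 <= s <= T -> `|Y s| <= r.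
  move=> /andP[s0]; rewrite le_eqVlt => /predU1P[->//|sT].
  have := YB s s0 sT; have := ler_norm B; have := normr_ge0 y0; rewrite /r; lra.
have YTB : `|Y T| <= B by apply: (apriori T Y T0 Y0); exact: restr.
have [TE|Tne] := eqVneq T t0; first by rewrite -TE; apply: HT; rewrite T0 lexx.
have ltT : T < t0 by rewrite lt_neqAle Tne.
have /within_nearP/(_ T _ 1 ltr01) := cY.
have TT : 0 <= T <= t0 + 1 by rewrite T0 (le_trans Tt0)// lerDl.
move=> /(_ TT)/nbhs_normP[d /= d0 Hd].
pose s := Num.min t0 (T + d / 2).
have sT : T < s by rewrite /s lt_min ltT; lra.
have st0 : s <= t0 by rewrite /s ge_min lexx.
have sd : s <= T + d / 2 by rewrite /s ge_min lexx orbT.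
suff Ss : S s by have := ub_le_sup hS.2 Ss; rewrite -/T leNgt sT.
split; first by rewrite st0 (le_trans T0 (ltW sT)).
move=> u /andP[u0 us]; have [uT|Tu] := leP u T; first by apply: HT; rewrite u0.
have := Hd u; rewrite /= ler0_norm ?subr_le0 ?(ltW Tu)// => /(_ ltac:(lra)).
have hu : 0 <= u <= t0 + 1 by apply/andP; split=> //; lra.
move=> /(_ hu) h1.
have := ler_normD (Y u - Y T) (Y T); rewrite subrK distrC.
have := ler_norm B; have := normr_ge0 y0.
by rewrite /r; lra.
Qed.

End ODE.

(** * Quadratic inequalities *)

Section Alg.
Context {R : realFieldType}.

Lemma mul_le_scaled (D a b : R) : 0 < D -> a * b <= a ^+ 2 / (4 * D) + D * b ^+ 2.
Proof.
move=> D0; rewrite -subr_ge0.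
rewrite (_ : _ - _ = (a - 2 * D * b) ^+ 2 / (4 * D)); last by field; lra.
by rewrite divr_ge0 ?sqr_ge0//; lra.
Qed.

(** Here s stands for alpha . (th - theta), q for the mismatch, de for the
    Lipschitz error with constant B, ep for the disturbance and e for the observer
    error. Since q and s have the same sign, q s >= q^2 / D; since
    |s| <= |q| / D1, the product s (de + ep) costs q^2 / (4 D), and so does e q.
    This leaves - q^2 / (2 D). *)
Lemma estimator_ineq (D D1 q s de ep e B : R) : 0 < D -> 0 < D1 ->
  D1 * `|s| <= `|q| -> `|q| <= D * `|s| -> (q <> 0 -> 0 < q * s) ->
  de ^+ 2 <= B ^+ 2 * e ^+ 2 ->
  s * (de - q + ep) + e * (de - q + ep) <=
  - (q ^+ 2 / (2 * D)) + 2 * (D / D1 ^+ 2 + 1 / 2) * ep ^+ 2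
  + (1 / 2 + D + 2 * (D / D1 ^+ 2 + 1 / 2) * B ^+ 2) * e ^+ 2.
Proof.
move=> D0 D10 h1 h2 h3 h4.
pose g := de + ep.
have qs : q ^+ 2 / D <= q * s.
  rewrite ler_pdivrMr//; have [->|/eqP q0] := eqVneq q 0; first by rewrite expr0n /= !mul0r.
  have qs0 := h3 q0.
  have -> : q * s * D = `|q| * (D * `|s|).
    by rewrite mulrCA -normrM gtr0_norm// mulrC.
  by rewrite -real_normK ?num_real// expr2 ler_wpM2l.
have sg : s * g <= q ^+ 2 / (4 * D) + D / D1 ^+ 2 * g ^+ 2.
  apply: (@le_trans _ _ (`|q| * (`|g| / D1))).
    apply: le_trans (ler_norm _) _; rewrite normrM.
    rewrite mulrA [leRHS]mulrAC; apply: ler_wpM2r => //.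
    by rewrite ler_pdivlMr// mulrC.
  apply: le_trans (mul_le_scaled _ _ D0) _.
  rewrite real_normK ?num_real// exprMn exprVn real_normK ?num_real//.
  by rewrite lerD2l mulrA mulrAC.
have eq_ : e * - q <= q ^+ 2 / (4 * D) + D * e ^+ 2.
  apply: le_trans (_ : _ <= (- q) ^+ 2 / (4 * D) + D * e ^+ 2) _; last by rewrite sqrrN.
  by rewrite mulrC; exact: mul_le_scaled.
have eg : e * g <= 1 / 2 * e ^+ 2 + 1 / 2 * g ^+ 2.
  by have := sqr_ge0 (e - g); lra.
have gg : g ^+ 2 <= 2 * (B ^+ 2 * e ^+ 2) + 2 * ep ^+ 2.
  by rewrite /g; have := sqr_ge0 (de - ep); lra.
set K := D / D1 ^+ 2 in sg *.
have K0 : 0 <= K by rewrite /K divr_ge0 ?sqr_ge0// ltW.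
have Kg : (K + 1 / 2) * g ^+ 2 <= (K + 1 / 2) * (2 * (B ^+ 2 * e ^+ 2) + 2 * ep ^+ 2).
  by apply: ler_wpM2l => //; lra.
have -> : q ^+ 2 / (2 * D) = 2 * (q ^+ 2 / (4 * D)) by field; lra.
have qD : q ^+ 2 / D = 4 * (q ^+ 2 / (4 * D)) by field; lra.
rewrite qD in qs.
have -> : s * (de - q + ep) + e * (de - q + ep) = s * g - q * s + e * g + e * - q.
  by rewrite /g; ring.
move: sg eq_ qs; set X := q ^+ 2 / (4 * D) => sg eq_ qs; lra.
Qed.

(** The factor 3 (1 + 2 D) dominates both 6 D, needed for q^2, and 3, needed for
    the Lipschitz error. *)
Lemma residual_ineq (D q de ep e B : R) : 0 < D -> de ^+ 2 <= B ^+ 2 * e ^+ 2 ->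
  (de - q + ep) ^+ 2 <=
  3 * (1 + 2 * D) * (q ^+ 2 / (2 * D) + (1 + B ^+ 2) * e ^+ 2) + 3 * ep ^+ 2.
Proof.
move=> D0 h.
have h1 : (de - q + ep) ^+ 2 <= 3 * (de ^+ 2 + q ^+ 2 + ep ^+ 2).
  have := sqr_ge0 (de + q); have := sqr_ge0 (de - ep); have := sqr_ge0 (q + ep); lra.
have -> : 3 * (1 + 2 * D) * (q ^+ 2 / (2 * D) + (1 + B ^+ 2) * e ^+ 2) =
    3 * (q ^+ 2 / (2 * D)) + 3 * q ^+ 2
    + 3 * (1 + 2 * D) * ((1 + B ^+ 2) * e ^+ 2) by field; lra.
have h2 : 0 <= q ^+ 2 / (2 * D) by rewrite divr_ge0 ?sqr_ge0//; lra.
have h3 : B ^+ 2 * e ^+ 2 <= (1 + 2 * D) * ((1 + B ^+ 2) * e ^+ 2).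
  have := sqr_ge0 e; have := mulr_ge0 (sqr_ge0 B) (sqr_ge0 e); nra.
lra.
Qed.

(** Nonlinear damping: the term z^2 (sum_j M_j^2) absorbs the products z dd_j M_j
    whatever the size of M, leaving only the dd_j^2. *)
Lemma tracking_ineq (I : finType) (z zn di : R) (dd M : I -> R) :
  z * (zn - (3 + \sum_j M j ^+ 2) * z + di - \sum_j dd j * M j) <=
  - 2 * z ^+ 2 + 1 / 2 * zn ^+ 2 + 1 / 2 * di ^+ 2 + \sum_j dd j ^+ 2.
Proof.
have h : - (z * \sum_j dd j * M j) <= z ^+ 2 * (\sum_j M j ^+ 2) + \sum_j dd j ^+ 2.
  rewrite !mulr_sumr -sumrN -big_split /=; apply: ler_sum => j _.
  have := sqr_ge0 (z * M j + dd j); have := sqr_ge0 (z * M j);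
    have := sqr_ge0 (dd j); lra.
have := sqr_ge0 (z - zn); have := sqr_ge0 (z - di); lra.
Qed.

End Alg.

(** * Square-integrable signals *)

Section L2Tools.
Context {R : realType}.
Notation mu := (@lebesgue_measure R).
Implicit Types (g y w : R -> R) (T : R).

Lemma sub_halfline T : `[0, T] `<=` (`[0, +oo[ : set R).
Proof. by move=> t /=; rewrite !in_itv /= => /andP[->]. Qed.

Lemma L2_integ_sq g T : L2 g -> integ T (fun t => g t ^+ 2).
Proof.
move=> [mg ig].
have mg2 : measurable_fun (`[0, +oo[ : set R) (fun t => (g t ^+ 2)%:E).
  by apply/measurable_EFinP; exact: measurable_funX.
have iP : mu.-integrable `[0%R, +oo[ (EFin \o (fun t => g t ^+ 2)).
  apply/integrableP; split; first exact: mg2.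
  apply: le_lt_trans ig; apply: ge0_le_integral => //.
  - by apply: measurableT_comp => //; exact: mg2.
  - by move=> t _; rewrite /= ger0_norm ?sqr_ge0.
by apply: integrableS iP => //; exact: sub_halfline.
Qed.

Lemma integ_cst T (k : R) : integ T (fun=> k).
Proof. by apply: integ_continuous; apply: continuous_subspaceT => t; exact: cvg_cst. Qed.

Lemma L2_integ g T : L2 g -> integ T g.
Proof.
move=> Lg; have ig := L2_integ_sq T Lg.
apply: (@le_integrable _ _ _ mu `[0, T] _ _ (EFin \o (fun t => 1 + g t ^+ 2))).
- by [].
- apply/measurable_EFinP; apply: measurable_funS Lg.1 => //; exact: sub_halfline.
- move=> t _; rewrite /= lee_fin [leRHS]ger0_norm ?addr_ge0 ?sqr_ge0//.
  rewrite ler_norml; have := sqr_ge0 (g t - 1); have := sqr_ge0 (g t + 1).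
  by move=> *; apply/andP; split; lra.
- exact: (integD (integ_cst T 1) ig).
Qed.

Lemma prim_ge0 w T : (forall t, 0 <= t <= T -> 0 <= w t) -> 0 <= prim w T.
Proof. by move=> w0; apply: Rintegral_ge0 => t /=; rewrite in_itv /=; exact: w0. Qed.

Lemma prim_EFin w T : integ T w ->
  (\int[mu]_(t in `[0%R, T]) (w t)%:E = (prim w T)%:E)%E.
Proof. by move=> iw; rewrite /prim /Rintegral fineK//;
  exact: (integrable_fin_num _ iw). Qed.

Lemma L2_bound g : L2 g ->
  exists2 B, 0 <= B & forall T, 0 <= T -> prim (fun t => g t ^+ 2) T <= B.
Proof.
move=> Lg; have [mg ig] := Lg.
exists (fine (\int[mu]_(t in `[0%R, +oo[) ((g t) ^+ 2)%:E)%E).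
  by apply: fine_ge0; apply: integral_ge0 => t _; rewrite lee_fin sqr_ge0.
move=> T T0; rewrite -lee_fin -(prim_EFin (L2_integ_sq T Lg)) fineK.
  apply: ge0_subset_integral => //.
  - by apply/measurable_EFinP; exact: measurable_funX.
  - by move=> t _; rewrite lee_fin sqr_ge0.
  - exact: sub_halfline.
rewrite ge0_fin_numE//; apply: integral_ge0 => t _.
by rewrite lee_fin sqr_ge0.
Qed.

(** Square integrability follows from bounds over [0, T] uniform in T, by monotone
    convergence along T = 0, 1, 2, ... *)
Lemma L2_intro g B : measurable_fun (`[0, +oo[ : set R) g ->
  (forall T, integ T (fun t => g t ^+ 2)) ->
  (forall T, 0 <= T -> prim (fun t => g t ^+ 2) T <= B) -> L2 g.
Proof.
move=> mg ig HB; split=> //.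
have mg2 : measurable_fun (`[0, +oo[ : set R) (fun t => (g t ^+ 2)%:E).
  by apply/measurable_EFinP; exact: measurable_funX.
have E : `[0, +oo[%classic = \bigcup_i `[0, i%:R]%classic :> set R.
  rewrite itv_bndy_bigcup_BRight; apply: eq_bigcupr => i _.
  by rewrite add0r.
rewrite E; apply: (@le_lt_trans _ _ B%:E); last exact: ltry.
have mono : nondecreasing_seq (fun i => `[0, i%:R]%classic : set R).
  apply/nondecreasing_seqP => k; apply/subsetPset => t /=.
  by rewrite !in_itv /= => /andP[-> h]; rewrite (le_trans h)// ler_nat.
have cv : (\int[mu]_(t in `[0%R, i%:R]) (g t ^+ 2)%:E)%E @[i --> \oo] -->
    (\int[mu]_(t in \bigcup_i `[0%R, i%:R]%classic) (g t ^+ 2)%:E)%E.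
  apply: (ge0_nondecreasing_set_cvg_integral (mu := @lebesgue_measure R)) => //.
  - by move=> i; apply: measurable_funS mg2 => //; exact: sub_halfline.
  - by move=> i t _; rewrite lee_fin sqr_ge0.
rewrite -(cvg_lim _ cv)//; apply: lime_le; first by apply: cvgP cv.
by apply: nearW => i; rewrite prim_EFin// lee_fin; exact: HB.
Qed.

Lemma halfline_measurable y : (forall T, {within `[0, T], continuous y}) ->
  measurable_fun (`[0, +oo[ : set R) y.
Proof.
move=> cy; rewrite itv_bndy_bigcup_BRight; apply/measurable_fun_bigcup => // i.
by rewrite add0r; exact: within_measurable.
Qed.

(** The logarithm linearizes inequalities of the form g' <= a + b g with a, b
    integrable: it turns Gronwall's lemma into one integration. *)
Lemma ln1p_chain m n (g : 'M[R]_(m, n) -> R) : smooth g -> (forall S, 0 <= g S) ->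
  [/\ (forall S, differentiable (fun S => ln (1 + g S)) S),
      (forall S v, 'D_v (fun S => ln (1 + g S)) S = (1 + g S)^-1 * 'D_v g S) &
      (forall v, continuous ('D_v (fun S => ln (1 + g S))))].
Proof.
move=> sg g0.
have g1 S : 0 < 1 + g S by rewrite ltr_pwDl.
have dln S : is_derive (1 + g S) 1 (@ln R) (1 + g S)^-1 by exact: is_derive1_ln.
have dl S : differentiable (@ln R) (1 + g S).
  by apply/derivable1_diffP; case: (dln S).
have s1 : smooth (fun S => 1 + g S) by apply: smoothD => //; exact: smooth_cst.
have d1 S := smooth_differentiable s1 S.
have dc S : differentiable (fun S => ln (1 + g S)) S.
  exact: (differentiable_comp (d1 S) (dl S)).
have DE S v : 'D_v (fun S => ln (1 + g S)) S = (1 + g S)^-1 * 'D_v g S.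
  rewrite deriveE// (diff_comp (d1 S) (dl S)) /=.
  rewrite -[X in 'd _ _ X]mulr1 -[_ * 1]/(_ *: (1 : R)) linearZ /= -!deriveE//.
  have [_ ->] := dln S.
  rewrite /GRing.scale /= mulrC; congr (_ * _).
  rewrite deriveD; [|exact: derivable_cst|]; last first.
    exact/diff_derivable/smooth_differentiable.
  by rewrite (derive_cst (1 : R)) add0r.
split=> // v; rewrite (_ : 'D_v _ = fun S => (1 + g S)^-1 * 'D_v g S); last exact/funext.
move=> S; have c2 : 'D_v g x @[x --> S] --> 'D_v g S.
  exact: (smooth_continuous (smooth_derive v sg)).
have n1 : 1 + g S != 0 by rewrite gt_eqF.
have c0 : 1 + g x @[x --> S] --> 1 + g S by exact: (smooth_continuous s1).
have c1 := cvgV n1 c0 (FF := nbhs_filter S).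
exact: (@cvgM _ _ (nbhs S) (nbhs_filter S) _ _ _ _ c1 c2).
Qed.

Lemma prim_mono w s t : integ t w -> 0 <= s -> s <= t ->
  (forall r, 0 <= r <= t -> 0 <= w r) -> prim w s <= prim w t.
Proof.
move=> iw s0 st w0; rewrite -subr_ge0 (primB iw)//.
apply: Rintegral_ge0 => r /=; rewrite in_itv /= => /andP[sr rt].
by apply: w0; rewrite rt (le_trans s0 (ltW sr)).
Qed.

Lemma prim_upper T w y K t : abscont T w y -> integ T K -> 0 <= t <= T ->
  (forall s, 0 <= s <= t -> w s <= K s) -> y t <= y 0 + prim K t.
Proof.
move=> ac iK /andP[t0 tT] wK.
have := @abscont_mono R T _ _ _ _ 0 t ac (prim_abscont iK) (lexx _) t0 tT wK.
by rewrite prim0 subr0 -lerBlDl.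
Qed.

Lemma abscont_square T w y : abscont T w y ->
  abscont T (fun t => 2 * y t * w t) (fun t => y t ^+ 2).
Proof.
move=> ac.
have acm : abscont_mx T (fun t => const_mx (w t) : 'M[R]_1)
  (fun t => const_mx (y t) : 'M[R]_1).
  move=> i j; under eq_fun do rewrite mxE.
  by under [X in abscont _ _ X]eq_fun do rewrite mxE.
have s0 : smooth (fun M : 'M[R]_1 => M 0 0) by exact/smooth_coord/smooth_id.
have sg : smooth (fun M : 'M[R]_1 => M 0 0 ^+ 2) by exact: smoothX2.
have := abscont_chain acm (smooth_differentiable sg)
  (fun i j => smooth_continuous (smooth_derive (delta_mx i j) sg)).
congr abscont.
  apply/funext => t; rewrite derive_sum_delta; last exact: smooth_differentiable.
  rewrite !big_ord1 mxE.
  have -> : (fun M : 'M[R]_1 => M 0 0 ^+ 2) =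
    (fun M : 'M[R]_1 => M 0 0) * (fun M : 'M[R]_1 => M 0 0).
    by apply/funext => M; rewrite expr2.
  rewrite deriveM; [|exact/diff_derivable/smooth_differentiable..].
  have -> : 'D_(delta_mx ord0 ord0) (fun M : 'M[R]_1 => M 0 0) (const_mx (y t)) = 1.
    have := derive_mx (@derivable_id R _ (const_mx (y t)) (delta_mx ord0 ord0 : 'M[R]_1)).
    by rewrite derive_id => /(congr1 (fun M : 'M[R]_1 => M 0 0)); rewrite !mxE.
  by rewrite !mxE /GRing.scale /=; ring.
by apply/funext => t; rewrite mxE.
Qed.

(** Beyond a large time the integral of y^2 + w^2 over any interval is at most
    eta. As the derivative of y^2 is 2 y w >= - (y^2 + w^2), the function y^2 stays
    above y(t)^2 - eta on [t, t + 1]; integrating over this interval gives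
    y(t)^2 <= 2 eta. *)
Lemma square_integrable_cvg0 y w B :
  (forall T, abscont T w y) ->
  (forall T, integ T (fun t => y t ^+ 2)) -> (forall T, integ T (fun t => w t ^+ 2)) ->
  (forall T, 0 <= T -> prim (fun t => y t ^+ 2) T <= B) ->
  (forall T, 0 <= T -> prim (fun t => w t ^+ 2) T <= B) ->
  y t @[t --> +oo] --> 0.
Proof.
move=> ac iy iw By Bw.
pose P T := prim (fun t => y t ^+ 2 + w t ^+ 2) T.
have iP T : integ T (fun t => y t ^+ 2 + w t ^+ 2) by exact: integD.
have acP T := prim_abscont (iP T).
have PB T : 0 <= T -> P T <= 2 * B.
  move=> T0; rewrite /P /prim (RintegralD _ (iy T) (iw T))//.
  have := By T T0; have := Bw T T0; rewrite /prim; lra.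
pose S := [set P T | T in [set T : R | 0 <= T]].
have hS : has_sup S.
  by split; [exists (P 0), 0 => //=|exists (2 * B) => _ [T T0 <-]; exact: PB].
apply/cvgrPdist_le => e e0.
pose eta := e ^+ 2 / 2.
have eta0 : 0 < eta by rewrite divr_gt0// exprn_gt0.
have [_ [T0 T00 <-] PT0] := sup_adherent eta0 hS.
have tail a b : T0 <= a -> a <= b -> P b - P a <= eta.
  move=> Ta ab; have a0 : 0 <= a by exact: le_trans T00 Ta.
  have Pb : P b <= sup S.
    by apply: (ub_le_sup hS.2); exists b => //=; exact: le_trans ab.
  have Pa : P T0 <= P a.
    by apply: prim_mono => // r _; rewrite addr_ge0 ?sqr_ge0.
  lra.
near=> t.
have Tt : T0 <= t by near: t; apply: nbhs_pinfty_ge; exact: num_real.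
have t0 : 0 <= t by exact: le_trans T00 Tt.
have step s : t <= s -> s <= t + 1 -> y t ^+ 2 - eta <= y s ^+ 2.
  move=> ts st1; have acs := abscont_square (ac s).
  have := @abscont_mono R s _ _ _ _ t s (abscontZ (-1) acs) (acP s) t0 ts (lexx _) _.
  move=> /(_ (fun r _ => ltac:(have := sqr_ge0 (y r + w r); lra))) h.
  have := tail t s Tt ts; rewrite /P; lra.
have acy := prim_abscont (iy (t + 1)).
have acc := prim_abscont (integ_cst (t + 1) (y t ^+ 2 - eta)).
have t1 : t <= t + 1 by rewrite lerDl.
have h1 := abscont_mono acc acy t0 t1 (lexx _)
   (fun s h => step s (proj1 (andP h)) (proj2 (andP h))).
have h2 : prim (fun t => y t ^+ 2) (t + 1) - prim (fun t => y t ^+ 2) t <= P (t + 1) - P t.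
  apply: (abscont_mono acy (acP (t + 1)) t0 t1 (lexx _)) => s _.
  by rewrite lerDl sqr_ge0.
have h3 := tail t (t + 1) Tt t1.
rewrite !prim_cst// in h1; last by rewrite addr_ge0.
have : y t ^+ 2 <= e ^+ 2 by rewrite /eta in h1 h3; lra.
rewrite sub0r normrN -[leLHS]real_normK ?num_real// ler_pXn2r// ?nnegrE//.
exact: ltW.
Unshelve. all: by end_near.
Qed.

End L2Tools.

(** * Directional derivatives *)

Section DeriveRules.
Context {R : realType} {m n : nat}.
Local Notation E := 'M[R]_(m, n).
Implicit Types (g h : E -> R) (S v w : E).

Lemma derive_add_dir g S v w : differentiable g S ->
  'D_(v + w) g S = 'D_v g S + 'D_w g S.
Proof. by move=> dg; rewrite !deriveE// linearD. Qed.

Lemma derive_scale_dir g S v (k : R) : differentiable g S ->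
  'D_(k *: v) g S = k * 'D_v g S.
Proof. by move=> dg; rewrite !deriveE// linearZ. Qed.

Lemma derive_sum_dir g S (I : Type) (r : seq I) (v : I -> E) :
  differentiable g S -> 'D_(\sum_(j <- r) v j) g S = \sum_(j <- r) 'D_(v j) g S.
Proof.
move=> dg; elim: r => [|j r IH]; first by rewrite !big_nil derive0.
by rewrite !big_cons derive_add_dir// IH.
Qed.

Lemma derive_coord S v i j : 'D_v (fun S : E => S i j) S = v i j.
Proof.
rewrite (_ : (fun S : E => S i j) = (fun M : E => M i j) \o id)//.
have := derive_mx (@derivable_id R E S v).
by rewrite derive_id => /(congr1 (fun M : E => M i j)); rewrite mxE.
Qed.

Lemma derive_plus g h S v : smooth g -> smooth h ->
  'D_v (fun S => g S + h S) S = 'D_v g S + 'D_v h S.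
Proof.
by move=> sg sh; apply: deriveD; apply: diff_derivable; exact: smooth_differentiable.
Qed.

Lemma derive_minus g h S v : smooth g -> smooth h ->
  'D_v (fun S => g S - h S) S = 'D_v g S - 'D_v h S.
Proof.
by move=> sg sh; apply: deriveB; apply: diff_derivable; exact: smooth_differentiable.
Qed.

Lemma derive_times g h S v : smooth g -> smooth h ->
  'D_v (fun S => g S * h S) S = g S * 'D_v h S + h S * 'D_v g S.
Proof.
move=> sg sh; rewrite (@deriveM _ _ g h S v)//; apply: diff_derivable;
  exact: smooth_differentiable.
Qed.

Lemma derive_const S v (k : R) : 'D_v (fun=> k) S = 0.
Proof. exact: (derive_cst k). Qed.

Lemma derive_cmul (k : R) g S v : smooth g ->
  'D_v (fun S => k * g S) S = k * 'D_v g S.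
Proof.
move=> sg; rewrite (@derive_times (fun=> k))//; last exact: smooth_cst.
by rewrite derive_const mulr0 addr0.
Qed.

Lemma derive_square g S v : smooth g ->
  'D_v (fun S => g S ^+ 2) S = 2 * g S * 'D_v g S.
Proof.
move=> sg; under eq_fun do rewrite expr2.
rewrite derive_times//; ring.
Qed.

Lemma derive_bigsum (I : Type) (r : seq I) (g : I -> E -> R) S v :
  (forall i, smooth (g i)) ->
  'D_v (fun S => \sum_(i <- r) g i S) S = \sum_(i <- r) 'D_v (g i) S.
Proof.
move=> sg; elim: r => [|i r IH].
  by under eq_fun do rewrite big_nil; rewrite big_nil derive_const.
under eq_fun do rewrite big_cons.
rewrite big_cons derive_plus ?IH//; exact: smooth_sum.
Qed.

(** Dependence on the coordinates in P only. Such functions have the same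
    directional derivatives in directions that agree on P ([derive_dep]), which is
    how the triangular structure of the system is used. *)
Definition dep (P : 'I_m -> 'I_n -> bool) g :=
  forall S S', (forall i j, P i j -> S i j = S' i j) -> g S = g S'.

Lemma derive_dep P g S S' v v' : dep P g ->
  (forall i j, P i j -> S i j = S' i j) ->
  (forall i j, P i j -> v i j = v' i j) -> 'D_v g S = 'D_v' g S'.
Proof.
move=> dg HS Hv; rewrite /derive; congr (lim (_ @ 0^')).
apply/funext => k /=; congr (_ *: (_ - _)); last exact: dg.
by apply: dg => i j Pij; rewrite !mxE HS ?Hv.
Qed.

End DeriveRules.

(** * The design *)

Section Design.
Context {R : realType} (n d : nat).
Context (f : forall i : 'I_n.+1, 'rV[R]_i.+1 -> 'rV[R]_d -> R).
Context (alpha : forall i : 'I_n.+1, 'rV[R]_i.+1 -> 'rV[R]_d).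
Context (D D1 : R).
Context (Dbar : forall i : 'I_n.+1, 'rV[R]_i.+1 -> 'rV[R]_i.+1 -> R).
Context (c : R).

Local Notation E := 'M[R]_(n.+1, 1 + 1 + d).
Definition col_x : 'I_(1 + 1 + d) := lshift d (lshift 1 ord0).
Definition col_xi : 'I_(1 + 1 + d) := lshift d (rshift 1 ord0).
Definition col_nu (l : 'I_d) : 'I_(1 + 1 + d) := rshift (1 + 1) l.

Definition mk_state (x xi : 'I_n.+1 -> R) (nu : 'I_n.+1 -> 'I_d -> R) : E :=
  row_mx (row_mx (\col_i x i) (\col_i xi i)) (\matrix_(i, l) nu i l).

Lemma mk_state_x x xi nu i : mk_state x xi nu i col_x = x i.
Proof. by rewrite /mk_state row_mxEl row_mxEl mxE. Qed.
Lemma mk_state_xi x xi nu i : mk_state x xi nu i col_xi = xi i.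
Proof. by rewrite /mk_state row_mxEl row_mxEr mxE. Qed.
Lemma mk_state_nu x xi nu i l : mk_state x xi nu i (col_nu l) = nu i l.
Proof. by rewrite /mk_state row_mxEr mxE. Qed.

Lemma state_col_ind (P : 'I_(1 + 1 + d) -> Prop) :
  P col_x -> P col_xi -> (forall l, P (col_nu l)) -> forall j, P j.
Proof.
move=> Px Pxi Pnu j; case: (split_ordP j) => k ->; last exact: Pnu.
by case: (split_ordP k) => k' ->; rewrite ord1.
Qed.

Definition x_dir (j : 'I_n.+1) : E := delta_mx j col_x.

Lemma x_dir_x j i : x_dir j i col_x = (i == j)%:R.
Proof. by rewrite mxE eqxx andbT. Qed.
Lemma x_dir_xi j i : x_dir j i col_xi = 0.
Proof. by rewrite mxE /col_xi /col_x !eq_shift andbF. Qed.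
Lemma x_dir_nu j i l : x_dir j i (col_nu l) = 0.
Proof. by rewrite mxE /col_nu /col_x !eq_shift andbF. Qed.

Definition below_index (i : 'I_n.+1) (j : 'I_i.+1) : 'I_n.+1 := widen_ord (ltn_ord i) j.

(** Using the observer state xi_i for x_i makes the regressor independent of x_i,
    so that in the derivative of e_i * regressor the unmeasured velocity rho_i of
    e_i has exactly the regressor as its coefficient: the update
    rho_i * regressor is realized without knowing rho_i. *)
Definition mixed_point (i : 'I_n.+1) (S : E) : 'rV[R]_i.+1 :=
  \row_(j < i.+1) S (below_index j) (if (j < i)%N then col_x else col_xi).
Definition plant_state (S : E) : 'rV[R]_n.+1 := \row_k S k col_x.
Definition regressor (i : 'I_n.+1) (l : 'I_d) (S : E) : R := alpha (mixed_point i S) 0 l.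
Definition observer_error (i : 'I_n.+1) (S : E) : R := S i col_x - S i col_xi.
Definition prop_term (i : 'I_n.+1) l (S : E) : R := observer_error i S * regressor i l S.

(** Adaptation in finite form: an integral part stored in nu plus a part that
    is a static function of the state. *)
Definition estimate (i : 'I_n.+1) l (S : E) : R := S i (col_nu l) + prop_term i l S.
Definition estimate_vec (i : 'I_n.+1) (S : E) : 'rV[R]_d := \row_l estimate i l S.
Definition compensator (i : 'I_n.+1) (S : E) : R := f (mixed_point i S) (estimate_vec i S).

(** The coefficient of the perturbation left over by [estimator_ineq]. *)
Definition sector_const : R := D / D1 ^+ 2 + 1 / 2.

(** The gain pays for every multiple of the squared observer error that occurs
    in [est_energy_decrease]: the Lipschitz error made by using [mixed_point]
    for the plant state, and the motion of the regressor caused by the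
    residuals of the lower equations. *)
Definition observer_gain (i : 'I_n.+1) (S : E) : R :=
  2 + D
  + (2 * sector_const + 1) * Dbar (Defs.prefix i (plant_state S)) (mixed_point i S) ^+ 2
  + 1 / 2 * \sum_j \sum_l ('D_(x_dir j) (regressor i l) S) ^+ 2.

Definition next_input (i : 'I_n.+1) (w : R) (S : E) : R :=
  if (i < n)%N then S (inord i.+1) col_x else w.
Definition drift_x (i : 'I_n.+1) (w : R) (S : E) : R := next_input i w S + compensator i S.
Definition drift_xi (i : 'I_n.+1) (w : R) (S : E) : R :=
  drift_x i w S + observer_gain i S * observer_error i S.
Definition drift_known (w : R) (S : E) : E :=
  mk_state (fun i => drift_x i w S) (fun i => drift_xi i w S) (fun _ _ => 0).

(** The adaptation law for the stored part nu of the estimate: it removes from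
    the derivative of [estimate] everything that is known on line, so that
    along [drift] the estimates stand still. *)
Definition drift (w : R) (S : E) : E :=
  mk_state (fun i => drift_x i w S) (fun i => drift_xi i w S)
    (fun i l => - 'D_(drift_known w S) (prop_term i l) S).

(** Backstepping with target value c: [virtual k.+1] is the value of x_(k+1)
    which makes x_k follow [virtual k]. It cancels the estimated nonlinearity
    and the known part of the velocity of [virtual k]; the unknown part of that
    velocity is dominated by nonlinear damping in the gradient. The drift with
    input 0 may be used since [virtual k] only sees rows whose drift does not
    involve the input ([dep_virtual]). *)
Fixpoint virtual (k : nat) : E -> R :=
  if k is i.+1 then fun S : E =>
    - compensator (inord i) S + 'D_(drift 0 S) (virtual i) S
    - (3 + \sum_j ('D_(x_dir j) (virtual i) S) ^+ 2) * (S (inord i) col_x - virtual i S)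
  else fun _ => c.
Definition damping (k : nat) (S : E) : R := \sum_j ('D_(x_dir j) (virtual k) S) ^+ 2.

Lemma virtualS k S : virtual k.+1 S =
  - compensator (inord k) S + 'D_(drift 0 S) (virtual k) S
  - (3 + damping k S) * (S (inord k) col_x - virtual k S).
Proof. by []. Qed.

Definition control (S : E) := virtual n.+1 S.
Definition track_error (i : 'I_n.+1) (S : E) := S i col_x - virtual i S.

(** The velocity of the true closed loop: all that is unknown enters through
    the scalars rho_j, in the directions of the plant states only. *)
Definition velocity (rho : 'I_n.+1 -> R) (S : E) : E :=
  drift (control S) S + \sum_j rho j *: x_dir j.

Context (Dbar_smooth : forall i : 'I_n.+1,
     smooth (fun p : 'rV[R]_i.+1 * 'rV[R]_i.+1 => Dbar p.1 p.2)).
Context (alpha_smooth : forall i : 'I_n.+1, smooth (@alpha i)).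
Context (f_smooth : forall i : 'I_n.+1,
     smooth (fun p : 'rV[R]_i.+1 * 'rV[R]_d => f p.1 p.2)).

Lemma smooth_entry i j : smooth (fun S : E => S i j).
Proof. exact/smooth_coord/smooth_id. Qed.
Hint Resolve smooth_entry : core.

Lemma smooth_mixed_point i : smooth (mixed_point i).
Proof.
by apply: smooth_mx => a b; under eq_fun do rewrite mxE; exact: smooth_entry.
Qed.

Lemma smooth_regressor i l : smooth (regressor i l).
Proof.
apply: (@smooth_comp _ _ _ _ (mixed_point i) (fun p => alpha p 0 l)).
  exact: smooth_mixed_point.
exact: smooth_coord.
Qed.

Lemma smooth_observer_error i : smooth (observer_error i).
Proof. exact: smoothB. Qed.

Lemma smooth_prop_term i l : smooth (prop_term i l).
Proof. by apply: smoothM; [exact: smooth_observer_error|exact: smooth_regressor]. Qed.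

Lemma smooth_estimate i l : smooth (estimate i l).
Proof. by apply: smoothD => //; exact: smooth_prop_term. Qed.

Lemma smooth_compensator i : smooth (compensator i).
Proof.
apply: (@smooth_pair R _ _ _ _ (mixed_point i) (estimate_vec i) (@f_smooth i));
  first exact: smooth_mixed_point.
by apply: smooth_mx => a b; under eq_fun do rewrite mxE; exact: smooth_estimate.
Qed.

Lemma smooth_observer_gain i : smooth (observer_gain i).
Proof.
apply: smoothD; last first.
  apply: smoothM; first exact: smooth_cst.
  apply: smooth_sum => j _; apply: smooth_sum => l _.
  by apply/smoothX2/smooth_derive/smooth_regressor.
apply: smoothD; first exact: smooth_cst.
apply: smoothM; first exact: smooth_cst.
apply: smoothX2.
apply: (@smooth_pair R _ _ _ _ (fun S => Defs.prefix i (plant_state S)) (mixed_point i)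
  (@Dbar_smooth i)); last exact: smooth_mixed_point.
by apply: smooth_mx => a b; under eq_fun do rewrite !mxE; exact: smooth_entry.
Qed.

Lemma smooth_mk_state (U : normedModType R) x xi nu :
  (forall i, smooth (x i)) -> (forall i, smooth (xi i)) ->
  (forall i l, smooth (nu i l)) ->
  smooth (fun S : U => mk_state (fun i => x i S) (fun i => xi i S) (fun i l => nu i l S)).
Proof.
move=> sx sxi snu; apply: smooth_mx => i; apply: state_col_ind => [||l].
- by under eq_fun do rewrite mk_state_x; exact: sx.
- by under eq_fun do rewrite mk_state_xi; exact: sxi.
- by under eq_fun do rewrite mk_state_nu; exact: snu.
Qed.

Section ControlSmooth.
Context (w : E -> R) (sw : smooth w).

Lemma smooth_drift_x i : smooth (fun S => drift_x i (w S) S).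
Proof.
apply: smoothD; last exact: smooth_compensator.
rewrite /next_input; case: (i < n)%N; last exact: sw.
exact: smooth_entry.
Qed.

Lemma smooth_drift_xi i : smooth (fun S => drift_xi i (w S) S).
Proof.
apply: smoothD; first exact: smooth_drift_x.
by apply: smoothM; [exact: smooth_observer_gain|exact: smooth_observer_error].
Qed.

Lemma smooth_drift_known : smooth (fun S => drift_known (w S) S).
Proof.
apply: (@smooth_mk_state _ (fun i S => drift_x i (w S) S) (fun i S => drift_xi i (w S) S)
  (fun _ _ _ => 0)) => *.
- exact: smooth_drift_x.
- exact: smooth_drift_xi.
- exact: smooth_cst.
Qed.

Lemma smooth_drift : smooth (fun S => drift (w S) S).
Proof.
apply: (@smooth_mk_state _ (fun i S => drift_x i (w S) S) (fun i S => drift_xi i (w S) S)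
  (fun i l S => - 'D_(drift_known (w S) S) (prop_term i l) S)) => *.
- exact: smooth_drift_x.
- exact: smooth_drift_xi.
- apply: smoothN; apply: smooth_derive_along; first exact: smooth_drift_known.
  exact: smooth_prop_term.
Qed.

End ControlSmooth.

Lemma smooth_virtual k : smooth (virtual k).
Proof.
elim: k => [|i IH]; first exact: smooth_cst.
apply: smoothB.
  apply: smoothD; first by apply: smoothN; exact: smooth_compensator.
  by apply: smooth_derive_along => //; apply: smooth_drift; exact: smooth_cst.
apply: smoothM; last exact: smoothB.
apply: smoothD; first exact: smooth_cst.
by apply: smooth_sum => j _; apply/smoothX2/smooth_derive.
Qed.

Lemma smooth_control : smooth control. Proof. exact: (smooth_virtual n.+1). Qed.

Lemma smooth_track_error i : smooth (track_error i).
Proof.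
apply: (@smoothB _ _ (fun S : E => S i col_x) (virtual i)); first exact: smooth_entry.
exact: smooth_virtual.
Qed.

Lemma derive_velocity g rho S : smooth g ->
  'D_(velocity rho S) g S = 'D_(drift (control S) S) g S + \sum_j rho j * 'D_(x_dir j) g S.
Proof.
move=> sg; have dg := smooth_differentiable sg S.
rewrite derive_add_dir// derive_sum_dir//; congr (_ + _).
by apply: eq_bigr => j _; rewrite derive_scale_dir.
Qed.

Lemma drift_colx w S i : drift w S i col_x = next_input i w S + compensator i S.
Proof. by rewrite mk_state_x. Qed.

Lemma sum_pick (rho : 'I_n.+1 -> R) i : \sum_j rho j * (i == j)%:R = rho i.
Proof.
rewrite (bigD1 i)//= eqxx mulr1 big1 ?addr0// => j ji.
by rewrite eq_sym (negbTE ji) mulr0.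
Qed.

(** The drifts of x_i and xi_i differ by the observer injection only; what remains
    is the residual. *)
Lemma derive_observer_error rho S i :
  'D_(velocity rho S) (observer_error i) S = rho i - observer_gain i S * observer_error i S.
Proof.
have Dh h : 'D_h (observer_error i) S = h i col_x - h i col_xi.
  by rewrite derive_minus// !derive_coord.
rewrite derive_velocity; last exact: smooth_observer_error.
under eq_bigr do rewrite Dh x_dir_x x_dir_xi subr0.
rewrite sum_pick Dh mk_state_x mk_state_xi /drift_xi; ring.
Qed.

Lemma mixed_point_dep (i : 'I_n.+1) (S S' : E) :
  (forall j : 'I_n.+1, (j < i)%N -> S j col_x = S' j col_x) ->
  S i col_xi = S' i col_xi -> mixed_point i S = mixed_point i S'.
Proof.
move=> Hx Hxi; apply/rowP => j; rewrite !mxE; case: ifP => ji; first exact: Hx.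
suff -> : below_index j = i by [].
apply/val_inj => /=; apply/eqP; rewrite eqn_leq -ltnS ltn_ord /=.
by rewrite leqNgt ji.
Qed.

Lemma derive_regressor_zero (i : 'I_n.+1) l (j : 'I_n.+1) (S : E) :
  (i <= j)%N -> 'D_(x_dir j) (regressor i l) S = 0.
Proof.
move=> ij; rewrite -(@derive0 _ _ _ (regressor i l) S).
apply: (@derive_dep _ _ _ (fun (a : 'I_n.+1) b =>
  (b == col_xi) || ((b == col_x) && (a < i)%N))) => //.
- move=> S1 S2 HS; rewrite /regressor (@mixed_point_dep i S1 S2)//.
  + by move=> a ai; apply: HS; rewrite eqxx ai orbT.
  + by apply: HS; rewrite eqxx.
- move=> a b; case/orP => [/eqP->|/andP[/eqP-> ai]]; first by rewrite x_dir_xi mxE.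
  by rewrite x_dir_x mxE -val_eqE /= ltn_eqF// (leq_trans ai).
Qed.

Lemma derive_prop_term_eq i l (S h h' : E) :
  (forall a, h a col_x = h' a col_x) -> (forall a, h a col_xi = h' a col_xi) ->
  'D_h (prop_term i l) S = 'D_h' (prop_term i l) S.
Proof.
move=> hx hxi.
apply: (@derive_dep _ _ _ (fun a b => (b == col_xi) || (b == col_x))) => //.
- move=> S1 S2 HS; rewrite /prop_term /regressor /observer_error
    (@mixed_point_dep i S1 S2)//.
  + by rewrite !HS ?eqxx ?orbT.
  + by move=> a ai; apply: HS; rewrite eqxx orbT.
  + by apply: HS; rewrite eqxx.
- by move=> a b; case/orP => /eqP->.
Qed.

(** The update by the unmeasured rho_i: of the velocity of [prop_term] the adaptation
    law has removed the part along [drift], and e_i moves with rho_i while the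
    regressor moves with the rho_j, j < i, only. *)
Lemma derive_estimate rho S i l : 'D_(velocity rho S) (estimate i l) S =
  rho i * regressor i l S +
  observer_error i S * \sum_j rho j * 'D_(x_dir j) (regressor i l) S.
Proof.
have Dth h : 'D_h (estimate i l) S = h i (col_nu l) + 'D_h (prop_term i l) S.
  by rewrite derive_plus ?derive_coord//; exact: smooth_prop_term.
rewrite derive_velocity; last exact: smooth_estimate.
rewrite Dth mk_state_nu (@derive_prop_term_eq _ _ _
  (drift (control S) S) (drift_known (control S) S)); last 2 first.
- by move=> a; rewrite !mk_state_x.
- by move=> a; rewrite !mk_state_xi.
rewrite addNr add0r mulr_sumr -(sum_pick rho i) mulr_suml -big_split /=.
apply: eq_bigr => j _; rewrite Dth x_dir_nu add0r derive_times; last 2 first.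
- exact: smooth_observer_error.
- exact: smooth_regressor.
rewrite (_ : 'D_(x_dir j) (observer_error i) S = (i == j)%:R); last first.
  by rewrite derive_minus// !derive_coord x_dir_x x_dir_xi subr0.
ring.
Qed.

Let below (k : nat) (i : 'I_n.+1) (_ : 'I_(1 + 1 + d)) := (i < k)%N.

Lemma dep_compensator (k : nat) (i : 'I_n.+1) : (i < k)%N -> dep (below k) (compensator i).
Proof.
move=> ik S S' HS.
have Hp : mixed_point i S = mixed_point i S'.
  apply: mixed_point_dep => [j ji|]; apply: HS => //; exact: ltn_trans ji ik.
rewrite /compensator Hp (_ : estimate_vec i S = estimate_vec i S')//.
by apply/rowP => l; rewrite !mxE /estimate /prop_term /regressor /observer_error Hp !HS.
Qed.

Lemma dep_regressor (k : nat) (i : 'I_n.+1) l : (i < k)%N -> dep (below k) (regressor i l).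
Proof.
move=> ik S S' HS; rewrite /regressor (@mixed_point_dep i S S')// => [j ji|];
  apply: HS => //.
exact: ltn_trans ji ik.
Qed.

Lemma dep_observer_error (k : nat) (i : 'I_n.+1) :
  (i < k)%N -> dep (below k) (observer_error i).
Proof. by move=> ik S S' HS; rewrite /observer_error !HS. Qed.

Lemma dep_prop_term (k : nat) (i : 'I_n.+1) l : (i < k)%N -> dep (below k) (prop_term i l).
Proof. by move=> ik S S' HS; rewrite /prop_term (dep_observer_error ik HS)
  (dep_regressor l ik HS). Qed.

Lemma dep_observer_gain (k : nat) (i : 'I_n.+1) :
  (i < k)%N -> dep (below k) (observer_gain i).
Proof.
move=> ik S S' HS.
have Hp : mixed_point i S = mixed_point i S'.
  apply: mixed_point_dep => [j ji|]; apply: HS => //; exact: ltn_trans ji ik.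
have Hx : Defs.prefix i (plant_state S) = Defs.prefix i (plant_state S').
  apply/rowP => j; rewrite !mxE; apply: HS; rewrite /below /=.
  by apply: leq_trans ik; rewrite ltnS -ltnS ltn_ord.
rewrite /observer_gain Hp Hx; congr (_ + _ * _); apply: eq_bigr => j _;
  apply: eq_bigr => l _.
by rewrite (derive_dep (dep_regressor l ik) HS (fun _ _ _ => erefl)).
Qed.

Lemma dep_drift_x (k : nat) (i : 'I_n.+1) w (S S' : E) : (i < k)%N -> (i < n)%N ->
  (forall a b, below k.+1 a b -> S a b = S' a b) -> drift_x i w S = drift_x i w S'.
Proof.
move=> ik iN HS; have ik1 : (i < k.+1)%N by exact: ltn_trans ik _.
rewrite /drift_x (dep_compensator ik1 HS) /next_input iN HS//.
by rewrite /below inordK// !ltnS.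
Qed.

Lemma dep_drift_xi (k : nat) (i : 'I_n.+1) w (S S' : E) : (i < k)%N -> (i < n)%N ->
  (forall a b, below k.+1 a b -> S a b = S' a b) -> drift_xi i w S = drift_xi i w S'.
Proof.
move=> ik iN HS; have ik1 : (i < k.+1)%N by exact: ltn_trans ik _.
by rewrite /drift_xi (dep_drift_x _ ik iN HS) (dep_observer_gain ik1 HS)
  (dep_observer_error ik1 HS).
Qed.

(** The first k rows of the drift involve the first k.+1 rows of the state, the
    last of them as the next input, and not the input w as long as k <= n. *)
Lemma agree_drift (k : nat) w w' (S S' : E) : (k <= n)%N ->
  (forall a b, below k.+1 a b -> S a b = S' a b) ->
  forall a b, below k a b -> drift w S a b = drift w' S' a b.
Proof.
move=> kn HS a b ak; rewrite /below in ak; have an : (a < n)%N by exact: leq_trans ak kn.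
have Axw (a' : 'I_n.+1) : (a' < n)%N -> drift_x a' w S = drift_x a' w' S by move=> an';
  rewrite /drift_x /next_input an'.
have eqx (a' : 'I_n.+1) : (a' < k)%N -> drift_x a' w S = drift_x a' w' S'.
  move=> ak'; have an' : (a' < n)%N by exact: leq_trans ak' kn.
  by rewrite Axw// (dep_drift_x _ ak' an' HS).
have eqxi (a' : 'I_n.+1) : (a' < k)%N -> drift_xi a' w S = drift_xi a' w' S'.
  move=> ak'; have an' : (a' < n)%N by exact: leq_trans ak' kn.
  by rewrite -(dep_drift_xi _ ak' an' HS) /drift_xi Axw.
elim/state_col_ind: b => [||l]; rewrite ?mk_state_x ?mk_state_xi ?mk_state_nu;
  [exact: eqx|exact: eqxi|].
congr (- _); apply: (derive_dep (dep_prop_term l ak)) => i j ij.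
  by apply: HS; exact: ltn_trans ij _.
elim/state_col_ind: j ij => [||l'] ij; rewrite ?mk_state_x ?mk_state_xi ?mk_state_nu//;
  [exact: eqx|exact: eqxi].
Qed.

(** Each step of the recursion looks one row further: through the drift of the
    preceding rows and through row k itself. *)
Lemma dep_virtual (k : nat) : (k <= n.+1)%N -> dep (below k) (virtual k).
Proof.
elim: k => [|k IH] kn; first by [].
have kn' : (k <= n)%N by rewrite -ltnS.
have dv := IH (ltnW kn).
move=> S S' HS; rewrite !virtualS.
have HS' a b : below k a b -> S a b = S' a b.
  by move=> ak; apply: HS; exact: ltn_trans ak _.
have inK : (@inord n k < k.+1)%N by rewrite inordK.
have E1 := dep_compensator inK HS.
have E2 := dv S S' HS'.
have E3 := HS (inord k) col_x inK.
have E4 := derive_dep dv HS' (@agree_drift k 0 0 S S' kn' HS).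
have E5 : damping k S = damping k S'.
  apply: eq_bigr => j _.
  by rewrite (derive_dep dv HS' (fun _ _ _ => erefl)).
by rewrite E1 E2 E3 E4 E5.
Qed.

(** The last equation is driven by the control itself, without error. *)
Definition next_error (i : 'I_n.+1) (S : E) :=
  if (i < n)%N then track_error (inord i.+1) S else 0.

(** The known velocity of [virtual i] along the true drift is the one along
    [drift 0], which the next virtual control cancels. The residuals act on z_i
    directly and through the gradient of [virtual i]. *)
Lemma derive_track_error rho S i : 'D_(velocity rho S) (track_error i) S =
  next_error i S - (3 + damping i S) * track_error i S + rho i
  - \sum_j rho j * 'D_(x_dir j) (virtual i) S.
Proof.
rewrite derive_minus//; last exact: smooth_virtual.
rewrite !derive_velocity//; last exact: smooth_virtual.
have HA := @agree_drift i (control S) 0 S S (ltn_ord i) (fun _ _ _ => erefl).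
rewrite (derive_dep (dep_virtual (ltnW (ltn_ord i))) (fun _ _ _ => erefl) HA).
rewrite derive_coord mk_state_x.
under [X in _ + X - _]eq_bigr do rewrite derive_coord x_dir_x.
rewrite sum_pick /drift_x.
have -> : next_input i (control S) S = next_error i S + virtual i.+1 S.
  rewrite /next_input /next_error; case: ltnP => iN;
    first by rewrite /track_error inordK// subrK.
  have iE : val i = n by apply/eqP; rewrite eqn_leq -ltnS ltn_ord.
  by rewrite add0r; exact: (congr1 (fun k => virtual k.+1 S) (esym iE)).
rewrite virtualS inord_val /track_error.
set a1 := compensator i S; set a2 := 'D__ _ _; set a3 := virtual i S; set a4 := damping i S.
set a5 := next_error i S; set a6 := \sum_j _; ring.
Qed.

(** * Decrease of the energies *)

Context (Omega : set 'rV[R]_d) (theta : 'I_n.+1 -> 'rV[R]_d).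
Context (D_gt0 : 0 < D) (D1_gt0 : 0 < D1) (theta_in : forall i, Omega (theta i)).
Context (f_monotone : forall (i : 'I_n.+1) (x : 'rV[R]_i.+1) (q' q : 'rV[R]_d),
     Omega q -> f x q' <> f x q ->
     0 < (f x q' - f x q) * dot (alpha x) (q' - q)).
Context (f_sector : forall (i : 'I_n.+1) (x : 'rV[R]_i.+1) (q' q : 'rV[R]_d),
     Omega q ->
     D1 * `|dot (alpha x) (q' - q)| <= `|f x q' - f x q| /\
     `|f x q' - f x q| <= D * `|dot (alpha x) (q' - q)|).
Context (f_lipschitz : forall (i : 'I_n.+1) (q : 'rV[R]_d) (x x' : 'rV[R]_i.+1),
     Omega q ->
     (f x q - f x' q) ^+ 2 <= Dbar x x' ^+ 2 * sqnorm (x - x')).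

Definition plant_term (i : 'I_n.+1) (S : E) : R :=
  f (Defs.prefix i (plant_state S)) (theta i).
Definition mismatch (i : 'I_n.+1) (S : E) : R :=
  compensator i S - f (mixed_point i S) (theta i).
Definition lip_bound (i : 'I_n.+1) (S : E) : R :=
  Dbar (Defs.prefix i (plant_state S)) (mixed_point i S).
Definition residual (ep : 'I_n.+1 -> R) (S : E) (i : 'I_n.+1) : R :=
  plant_term i S - compensator i S + ep i.
Definition est_energy (i : 'I_n.+1) (S : E) : R :=
  1 / 2 * \sum_l (estimate i l S - theta i 0 l) ^+ 2 + 1 / 2 * observer_error i S ^+ 2.
(** The factor lip_bound^2 makes the dissipation dominate the squared residual. *)
Definition dissipation (i : 'I_n.+1) (S : E) : R :=
  mismatch i S ^+ 2 / (2 * D) + (1 + lip_bound i S ^+ 2) * observer_error i S ^+ 2.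
Definition track_energy (S : E) : R := 1 / 2 * \sum_i track_error i S ^+ 2.

Lemma smooth_prefix (i : 'I_n.+1) : smooth (fun S => Defs.prefix i (plant_state S)).
Proof.
by apply: smooth_mx => a b; under eq_fun do rewrite !mxE; exact: smooth_entry.
Qed.

Lemma smooth_plant_term i : smooth (plant_term i).
Proof.
apply: (@smooth_pair R _ _ _ _ (fun S => Defs.prefix i (plant_state S)) (fun=> theta i)
  (@f_smooth i)); [exact: smooth_prefix|exact: smooth_cst].
Qed.

Lemma smooth_mismatch i : smooth (mismatch i).
Proof.
apply: smoothB; first exact: smooth_compensator.
apply: (@smooth_pair R _ _ _ _ (mixed_point i) (fun=> theta i) (@f_smooth i));
  [exact: smooth_mixed_point|exact: smooth_cst].
Qed.

Lemma smooth_lip_bound i : smooth (lip_bound i).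
Proof.
apply: (@smooth_pair R _ _ _ _ (fun S => Defs.prefix i (plant_state S)) (mixed_point i)
  (@Dbar_smooth i)); [exact: smooth_prefix|exact: smooth_mixed_point].
Qed.

Lemma smooth_dissipation i : smooth (dissipation i).
Proof.
apply: smoothD.
  apply: smoothM; last exact: smooth_cst.
  exact/smoothX2/smooth_mismatch.
apply: smoothM; last exact/smoothX2/smooth_observer_error.
apply: smoothD; first exact: smooth_cst.
exact/smoothX2/smooth_lip_bound.
Qed.

Lemma smooth_estimate_error i l : smooth (fun S => estimate i l S - theta i 0 l).
Proof. by apply: smoothB; [exact: smooth_estimate|exact: smooth_cst]. Qed.

Lemma smooth_est_energy i : smooth (est_energy i).
Proof.
apply: smoothD; (apply: smoothM; first exact: smooth_cst).
  by apply: smooth_sum => l _; exact/smoothX2/smooth_estimate_error.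
exact/smoothX2/smooth_observer_error.
Qed.

Lemma smooth_track_energy : smooth track_energy.
Proof.
apply: smoothM; first exact: smooth_cst.
by apply: smooth_sum => i _; exact/smoothX2/smooth_track_error.
Qed.

Lemma dissipation_ge0 i S : 0 <= dissipation i S.
Proof.
apply: addr_ge0; first by rewrite divr_ge0 ?sqr_ge0// mulr_ge0 ?(ltW D_gt0).
by rewrite mulr_ge0 ?sqr_ge0// addr_ge0 ?sqr_ge0.
Qed.

Lemma est_energy_ge0 i S : 0 <= est_energy i S.
Proof.
rewrite /est_energy; have := sqr_ge0 (observer_error i S).
have : 0 <= \sum_l (estimate i l S - theta i 0 l) ^+ 2.
  by apply: sumr_ge0 => l _; exact: sqr_ge0.
lra.
Qed.

(** The two points differ in their last entry only. *)
Lemma sqnorm_prefix_mixed i S :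
  sqnorm (Defs.prefix i (plant_state S) - mixed_point i S) = observer_error i S ^+ 2.
Proof.
have wm : widen_ord (ltn_ord i) ord_max = i by apply/val_inj.
rewrite /sqnorm /dot (bigD1 ord_max)//= big1 => [|j jm]; rewrite !mxE.
  by rewrite ltnn /below_index wm addr0 -expr2.
have ji : (j < i)%N.
  rewrite ltn_neqAle -ltnS ltn_ord andbT; apply: contraNneq jm => ji.
  exact/eqP/val_inj.
by rewrite ji subrr mul0r.
Qed.

Lemma lipschitz_observer_error i S :
  (plant_term i S - f (mixed_point i S) (theta i)) ^+ 2 <=
  lip_bound i S ^+ 2 * observer_error i S ^+ 2.
Proof. by rewrite -sqnorm_prefix_mixed; exact: f_lipschitz. Qed.

Lemma residual_split ep S i :
  residual ep S i = (plant_term i S - f (mixed_point i S) (theta i)) - mismatch i S + ep i.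
Proof. by rewrite /residual /mismatch; ring. Qed.

Lemma residual_sq_le ep S i :
  residual ep S i ^+ 2 <= 3 * (1 + 2 * D) * dissipation i S + 3 * ep i ^+ 2.
Proof. by rewrite residual_split; apply: residual_ineq => //;
  exact: lipschitz_observer_error. Qed.

Lemma derive_est_energy (de : 'I_n.+1 -> R) S i : 'D_(velocity de S) (est_energy i) S =
  \sum_l (estimate i l S - theta i 0 l) *
    (de i * regressor i l S +
      observer_error i S * \sum_j de j * 'D_(x_dir j) (regressor i l) S)
  + observer_error i S * (de i - observer_gain i S * observer_error i S).
Proof.
rewrite derive_plus; last 2 first.
- apply: smoothM; first exact: smooth_cst.
  by apply: smooth_sum => l _; exact/smoothX2/smooth_estimate_error.
- by apply: smoothM; [exact: smooth_cst|exact/smoothX2/smooth_observer_error].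
rewrite (@derive_cmul _ _ _ _ (fun S => \sum_l (estimate i l S - theta i 0 l) ^+ 2));
  last by apply: smooth_sum => l _; exact/smoothX2/smooth_estimate_error.
rewrite (@derive_cmul _ _ _ _ (fun S => observer_error i S ^+ 2));
  last exact/smoothX2/smooth_observer_error.
rewrite derive_square; last exact: smooth_observer_error.
rewrite derive_observer_error derive_bigsum; last by move=> l;
  exact/smoothX2/smooth_estimate_error.
congr (_ + _); last by field.
rewrite mulr_sumr; apply: eq_bigr => l _.
rewrite derive_square; last exact: smooth_estimate_error.
rewrite derive_minus; [|exact: smooth_estimate|exact: smooth_cst].
rewrite derive_const subr0 derive_estimate; by field.
Qed.

(** By [estimator_ineq], up to the cross terms (th_i - theta_i) e_i rho_j times
    derivatives of the regressor, for j < i. Each is split by Young's inequality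
    into e_i^2 times a squared derivative, paid by [observer_gain], and
    |th_i - theta_i|^2 rho_j^2, which is left as a multiple of the energy with an
    integrable coefficient. *)
Lemma est_energy_decrease (ep : 'I_n.+1 -> R) S i :
  'D_(velocity (residual ep S) S) (est_energy i) S <=
  - dissipation i S + 2 * sector_const * ep i ^+ 2 +
    est_energy i S * \sum_(j < n.+1 | (j < i)%N) residual ep S j ^+ 2.
Proof.
rewrite derive_est_energy.
set de := residual ep S.
pose s := dot (alpha (mixed_point i S)) (estimate_vec i S - theta i).
have sE : \sum_l (estimate i l S - theta i 0 l) *
    (de i * regressor i l S +
      observer_error i S * \sum_j de j * 'D_(x_dir j) (regressor i l) S) =
  s * de i + \sum_l \sum_j
    (estimate i l S - theta i 0 l) * observer_error i S * (de j * 'D_(x_dir j) (regressor i l) S).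
  rewrite /s /dot mulr_suml -big_split /=; apply: eq_bigr => l _.
  rewrite !mxE mulrDr; congr (_ + _); first by rewrite /regressor; ring.
  by rewrite mulrA mulr_sumr.
pose thn := \sum_l (estimate i l S - theta i 0 l) ^+ 2.
pose dal := \sum_j \sum_l ('D_(x_dir j) (regressor i l) S) ^+ 2.
have cross : \sum_l \sum_j
    (estimate i l S - theta i 0 l) * observer_error i S * (de j * 'D_(x_dir j) (regressor i l) S)
   <= 1 / 2 * observer_error i S ^+ 2 * dal
      + 1 / 2 * thn * \sum_(j < n.+1 | (j < i)%N) de j ^+ 2.
  rewrite exchange_big /= /dal mulr_sumr [X in _ + _ * X]big_mkcond mulr_sumr.
  rewrite -big_split /=; apply: ler_sum => j _.
  case: ifPn => [ji|]; last first.
    rewrite -leqNgt => ij; rewrite mulr0 addr0 big1.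
      apply: mulr_ge0; first by rewrite mulr_ge0 ?sqr_ge0.
      by apply: sumr_ge0 => l _; exact: sqr_ge0.
    by move=> l _; rewrite derive_regressor_zero// !mulr0.
  rewrite /thn !mulr_sumr mulr_suml -big_split /=.
  apply: ler_sum => l _.
  set a := estimate i l S - _; set b := 'D__ _ _.
  by have := sqr_ge0 (a * de j - observer_error i S * b); lra.
have [m1 m2] := f_sector (mixed_point i S) (estimate_vec i S) (theta_in i).
have m3 := @f_monotone _ (mixed_point i S) (estimate_vec i S) _ (theta_in i).
have qne : mismatch i S <> 0 -> 0 < mismatch i S * s.
  by move=> q0; apply: m3 => h; apply: q0; rewrite /mismatch /compensator h subrr.
have main := estimator_ineq (ep i) D_gt0 D1_gt0 m1 m2 qne (lipschitz_observer_error i S).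
rewrite sE -/sector_const in main *; rewrite -(residual_split ep) -/de in main.
have Wge : 1 / 2 * thn <= est_energy i S.
  by rewrite /est_energy lerDl mulr_ge0 ?sqr_ge0.
have sum0 : 0 <= \sum_(j < n.+1 | (j < i)%N) de j ^+ 2.
  by apply: sumr_ge0 => j _; exact: sqr_ge0.
have Wm := ler_wpM2r sum0 Wge.
rewrite (_ : observer_error i S * (de i - observer_gain i S * observer_error i S) =
  observer_error i S * de i - observer_gain i S * observer_error i S ^+ 2); last by ring.
rewrite /dissipation.
have -> : observer_gain i S = 2 + D + (2 * sector_const + 1) * lip_bound i S ^+ 2 +
  1 / 2 * dal by [].
have e2 := sqr_ge0 (observer_error i S).
move: main cross Wm e2; rewrite -/s -/(mismatch i S) /lip_bound.
set A1 := mismatch i S ^+ 2 / _; set A2 := s * de i; set A3 := observer_error i S * de i.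
set A4 := est_energy i S * _; set A5 := _ * thn * _; set A6 := \sum_l _.
lra.
Qed.

Lemma next_error_le S : \sum_i next_error i S ^+ 2 <= \sum_i track_error i S ^+ 2.
Proof.
rewrite big_ord_recr /= {2}/next_error /= ltnn expr0n /= addr0.
rewrite [leRHS]big_ord_recl /= -[leLHS]add0r lerD ?sqr_ge0//.
apply: ler_sum => i _; rewrite /next_error /= ltn_ord.
by rewrite (_ : inord _ = lift ord0 i)//; apply/val_inj; rewrite /= inordK// ltnS.
Qed.

(** Summation of [tracking_ineq]: the terms next_error^2 / 2 are the tracking errors
    shifted by one index, so they are absorbed ([next_error_le]). *)
Lemma track_energy_decrease (de : 'I_n.+1 -> R) S : 'D_(velocity de S) track_energy S <=
  - (\sum_i track_error i S ^+ 2) + (1 + n.+1%:R) * \sum_i de i ^+ 2.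
Proof.
rewrite (@derive_cmul _ _ _ _ (fun S => \sum_i track_error i S ^+ 2)); last first.
  by apply: smooth_sum => i _; exact/smoothX2/smooth_track_error.
rewrite derive_bigsum; last by move=> i; exact/smoothX2/smooth_track_error.
have -> : 1 / 2 * \sum_i 'D_(velocity de S) (fun S => track_error i S ^+ 2) S =
   \sum_i track_error i S * 'D_(velocity de S) (track_error i) S.
  rewrite mulr_sumr; apply: eq_bigr => i _.
  by rewrite derive_square; [field|exact: smooth_track_error].
apply: (@le_trans _ _ (\sum_i (- 2 * track_error i S ^+ 2 + 1 / 2 * next_error i S ^+ 2
    + 1 / 2 * de i ^+ 2 + \sum_j de j ^+ 2))).
  by apply: ler_sum => i _; rewrite derive_track_error; exact: tracking_ineq.
rewrite !big_split /= -!mulr_sumr sumr_const card_ord -[_ *+ _]mulr_natl.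
have := next_error_le S.
have : 0 <= \sum_i de i ^+ 2 by apply: sumr_ge0 => i _; exact: sqr_ge0.
have : 0 <= \sum_i track_error i S ^+ 2 by apply: sumr_ge0 => i _; exact: sqr_ge0.
set a := \sum_i track_error i S ^+ 2; set b := \sum_i de i ^+ 2.
set N := n.+1%:R; set e := \sum_i _; lra.
Qed.

(** * Bounds along trajectories *)

Context (eps : R -> R) (eps_L2 : L2 eps).

Definition disturbance (t : R) (i : 'I_n.+1) : R := if (i < n)%N then 0 else eps t.
Definition residual_at (Y : R -> E) (i : 'I_n.+1) (t : R) : R :=
  residual (disturbance t) (Y t) i.
Definition velocity_at (Y : R -> E) (t : R) : E :=
  velocity (residual (disturbance t) (Y t)) (Y t).
Definition solution_upto (T : R) (Y : R -> E) : Prop := abscont_mx T (velocity_at Y) Y.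

Lemma solution_upto_le T T' Y : solution_upto T Y -> T' <= T -> solution_upto T' Y.
Proof. by move=> sY TT i j; apply: abscont_le TT; exact: sY. Qed.

Lemma solution_chain T Y g : solution_upto T Y -> smooth g ->
  abscont T (fun t => 'D_(velocity_at Y t) g (Y t)) (fun t => g (Y t)).
Proof.
move=> sY sg; apply: abscont_chain => //; first exact: smooth_differentiable.
by move=> i j; exact/smooth_continuous/smooth_derive.
Qed.

Lemma solution_within T Y (g : E -> R) : solution_upto T Y -> smooth g ->
  {within `[0, T], continuous (fun t => g (Y t))}.
Proof.
move=> sY sg; apply: within_comp; first exact: abscont_mx_continuous sY.
exact: smooth_continuous.
Qed.

Lemma solution_integ T Y g : solution_upto T Y -> smooth g -> integ T (fun t => g (Y t)).
Proof. by move=> sY sg; apply: integ_continuous; exact: solution_within. Qed.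

Lemma disturbance_integ T i : integ T (fun t => disturbance t i).
Proof.
rewrite /disturbance; case: (i < n)%N; first exact: integ_cst.
exact: L2_integ.
Qed.

Lemma disturbance_integ_sq T i : integ T (fun t => disturbance t i ^+ 2).
Proof.
rewrite /disturbance; case: (i < n)%N; last exact: L2_integ_sq.
exact: integ_cst.
Qed.

Lemma perturbed_integ_sq T Y g i : solution_upto T Y -> smooth g ->
  integ T (fun t => (g (Y t) + disturbance t i) ^+ 2).
Proof.
move=> sY sg.
have -> : (fun t => (g (Y t) + disturbance t i) ^+ 2) =
    fun t => (g (Y t) ^+ 2 + 2 * (disturbance t i * g (Y t))) + disturbance t i ^+ 2.
  by apply/funext => t; ring.
apply: integD; last exact: disturbance_integ_sq.
apply: integD; first by apply: (solution_integ sY (g := fun S => g S ^+ 2));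
  exact: smoothX2.
by apply: integZ; apply: integM; [exact: disturbance_integ|exact: solution_within].
Qed.

Lemma residual_integ_sq T Y i : solution_upto T Y ->
  integ T (fun t => residual_at Y i t ^+ 2).
Proof.
move=> sY; apply: (perturbed_integ_sq
  (g := fun S => plant_term i S - compensator i S)) => //.
by apply: smoothB; [exact: smooth_plant_term|exact: smooth_compensator].
Qed.

Lemma disturbance_bound : exists2 B, 0 <= B &
  forall i T, 0 <= T -> prim (fun t => disturbance t i ^+ 2) T <= B.
Proof.
have [B B0 HB] := L2_bound eps_L2; exists B => // i T T0.
rewrite /disturbance; case: (i < n)%N; last exact: HB.
by rewrite (_ : (fun t => _) = fun=> 0) ?prim_cst ?mul0r//; apply/funext => t;
  rewrite expr0n.
Qed.

Lemma sector_const_ge0 : 0 <= sector_const.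
Proof. by rewrite addr_ge0// divr_ge0 ?sqr_ge0// ltW. Qed.

Section InitialState.
Context (Y0 : E).

(** Induction on the row. The residuals of the lower rows being square integrable,
    the logarithm of 1 + est_energy gains at most the integral of
    C eps^2 + sum_(j < i) rho_j^2. Once the energy is bounded, integrating its
    derivative bounds the integral of the dissipation, hence of rho_i^2. The
    constants depend on Y0, but neither on T nor on the solution. *)
Lemma estimator_bound_ind k : forall i : 'I_n.+1, (i < k)%N -> exists2 M, 0 <= M &
  forall T Y, 0 <= T -> solution_upto T Y -> Y 0 = Y0 ->
    est_energy i (Y T) <= M /\ prim (fun t => residual_at Y i t ^+ 2) T <= M.
Proof.
elim: k => // k IH i; rewrite ltnS => ik.
have [Be Be0 HBe] := disturbance_bound.
have k10 := sector_const_ge0.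
have /choice[G HG] : forall j : 'I_n.+1, exists M, (j < i)%N -> 0 <= M /\
   forall T Y, 0 <= T -> solution_upto T Y -> Y 0 = Y0 ->
    prim (fun t => residual_at Y j t ^+ 2) T <= M.
  move=> j; case: (ltnP j i) => ji; last by exists 0.
  have [M M0 HM] := IH j (leq_trans ji ik).
  by exists M => _; split=> // T Y T0 sY Y00; case: (HM T Y T0 sY Y00).
pose GG := \sum_(j < n.+1 | (j < i)%N) G j.
have GG0 : 0 <= GG by apply: sumr_ge0 => j /HG[].
pose A0 := 2 * sector_const * Be + GG.
have A00 : 0 <= A0 by rewrite addr_ge0// !mulr_ge0//.
(* M1 bounds the energy, M2 the integral of the dissipation and M3 that of the
   squared residual. *)
pose M1 := expR (ln (1 + est_energy i Y0) + A0).
have M10 : 0 <= M1 by exact: expR_ge0.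
pose M2 := est_energy i Y0 + 2 * sector_const * Be + M1 * GG.
have M20 : 0 <= M2.
  apply: addr_ge0; last exact: mulr_ge0.
  by apply: addr_ge0; [exact: est_energy_ge0|rewrite !mulr_ge0].
pose M3 := 3 * (1 + 2 * D) * M2 + 3 * Be.
have D0 := D_gt0.
have M30 : 0 <= M3 by rewrite /M3 addr_ge0// !mulr_ge0//; lra.
exists (M1 + M3); first exact: addr_ge0.
move=> T Y T0 sY Y00.
pose Sd t := \sum_(j < n.+1 | (j < i)%N) residual_at Y j t ^+ 2.
have Sd0 t : 0 <= Sd t by apply: sumr_ge0 => j _; exact: sqr_ge0.
have iSd : integ T Sd by apply: integ_sum => j _; exact: residual_integ_sq.
have ie := disturbance_integ_sq T i.
have ike : integ T (fun t => 2 * sector_const * disturbance t i ^+ 2) by exact: integZ.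
have pSd t : 0 <= t <= T -> prim Sd t <= GG.
  move=> /andP[t0 tT].
  have acs : abscont T Sd (fun t => \sum_(j < n.+1 | (j < i)%N)
      prim (fun t => residual_at Y j t ^+ 2) t).
    by apply: abscont_sum => j _; apply: prim_abscont; exact: residual_integ_sq.
  have := acs.2 t; rewrite t0 tT => /(_ isT).
  rewrite [X in _ = X + _]big1 => [|j _]; last exact: prim0.
  rewrite add0r => <-; apply: ler_sum => j ji.
  by have [_] := HG j ji; apply => //; exact: solution_upto_le sY tT.
have pe t : 0 <= t <= T -> prim (fun t => 2 * sector_const * disturbance t i ^+ 2) t <=
  2 * sector_const * Be.
  move=> /andP[t0 tT]; rewrite /prim RintegralZl//; last exact: integ_le ie tT.
  by apply: ler_wpM2l; [rewrite mulr_ge0//|exact: HBe].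
have sW := smooth_est_energy i.
have [dln DE cln] := ln1p_chain sW (est_energy_ge0 i).
have acl := abscont_chain sY dln (fun i j => cln (delta_mx i j)).
have dec t := est_energy_decrease (disturbance t) (Y t) i.
have Wle t : 0 <= t <= T -> est_energy i (Y t) <= M1.
  move=> tT.
  have := prim_upper acl (integD ike iSd) tT.
  rewrite Y00 => H1.
  have {}H1 : ln (1 + est_energy i (Y t)) <= ln (1 + est_energy i Y0) + A0.
    apply: le_trans (H1 _) _ => [s /andP[s0 st]|].
      rewrite DE ler_pdivrMl ?ltr_pwDl ?est_energy_ge0//.
      apply: le_trans (dec s) _.
      have key (a b e g : R) : 0 <= a -> 0 <= b -> 0 <= e -> 0 <= g ->
          - e + a + b * g <= (1 + b) * (a + g).
        by move=> a0 b0 e0 g0; have := mulr_ge0 b0 a0; lra.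
      apply: (key _ _ _ (Sd s)); [|exact: est_energy_ge0|exact: dissipation_ge0|exact: Sd0].
      by rewrite mulr_ge0 ?sqr_ge0// mulr_ge0.
    rewrite lerD2l /prim RintegralD//.
    - by apply: lerD; [exact: pe|exact: pSd].
    - by case/andP: tT => _; exact: integ_le.
    - by case/andP: tT => _; exact: integ_le.
  have pos : 0 < 1 + est_energy i (Y t) by rewrite ltr_pwDl ?est_energy_ge0.
  move: H1; rewrite -ler_expR lnK ?posrE// => H1.
  by apply: le_trans H1; rewrite lerDr.
have TT : 0 <= T <= T by rewrite T0 lexx.
split; first by apply: le_trans (Wle T TT) _; rewrite lerDl.
have idiss : integ T (fun t => dissipation i (Y t)) by apply: solution_integ => //;
  exact: smooth_dissipation.
have acW := solution_chain sY sW.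
have dissle : prim (fun t => dissipation i (Y t)) T <= M2.
  have := prim_upper acW (integD (integD (integZ (-1) idiss) ike) (integZ M1 iSd)) TT.
  rewrite Y00 => H2.
  have : est_energy i (Y T) <= est_energy i Y0 +
    (- prim (fun t => dissipation i (Y t)) T + 2 * sector_const * Be + M1 * GG).
    apply: le_trans (H2 _) _ => [s sT|].
      apply: le_trans (dec s) _; rewrite -/(Sd s) mulN1r lerD2l.
      by apply: ler_wpM2r; [exact: Sd0|exact: Wle].
    rewrite lerD2l /prim RintegralD//; last 2 first.
    - exact: (integD (integZ (-1) idiss) ike).
    - exact: integZ.
    rewrite RintegralD//; last exact: integZ.
    rewrite !RintegralZl// mulN1r; apply: lerD.
      by rewrite lerD2l; have := pe T TT; rewrite /prim RintegralZl.
    by apply: ler_wpM2l => //; exact: pSd.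
  have := est_energy_ge0 i (Y T); rewrite /M2; lra.
have pdd : prim (fun t => residual_at Y i t ^+ 2) T <= M3.
  have ac1 := prim_abscont (residual_integ_sq i sY).
  have := prim_upper ac1 (integD (integZ (3 * (1 + 2 * D)) idiss) (integZ 3 ie)) TT.
  rewrite prim0 add0r => H3; apply: le_trans (H3 _) _ => [s _|].
    exact: residual_sq_le.
  rewrite /prim RintegralD//; [|exact: integZ|exact: integZ].
  rewrite !RintegralZl//; apply: lerD.
    by apply: ler_wpM2l => //; lra.
  by apply: ler_wpM2l => //; exact: HBe.
by apply: le_trans pdd _; rewrite lerDr.
Qed.

Lemma estimator_bound : exists2 B, 0 <= B & forall T Y i, 0 <= T -> solution_upto T Y ->
  Y 0 = Y0 -> est_energy i (Y T) <= B /\ prim (fun t => residual_at Y i t ^+ 2) T <= B.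
Proof.
have /choice[M HM] : forall i, exists M, 0 <= M /\
    forall T Y, 0 <= T -> solution_upto T Y -> Y 0 = Y0 ->
    est_energy i (Y T) <= M /\ prim (fun t => residual_at Y i t ^+ 2) T <= M.
  by move=> i; have [M M0 HM] := estimator_bound_ind (ltn_ord i); exists M.
exists (\sum_i M i); first by apply: sumr_ge0 => i _; case: (HM i).
move=> T Y i T0 sY Y00; have [_ /(_ T Y T0 sY Y00)[h1 h2]] := HM i.
have le : M i <= \sum_i M i.
  by rewrite (bigD1 i)//= lerDl sumr_ge0// => j _; case: (HM j).
by split; [exact: le_trans h1 le|exact: le_trans h2 le].
Qed.

Lemma track_energy_ge0 S : 0 <= track_energy S.
Proof. by rewrite mulr_ge0// sumr_ge0// => i _; exact: sqr_ge0. Qed.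

Definition error_sum (S : E) : R := \sum_i track_error i S ^+ 2.
Lemma smooth_error_sum : smooth error_sum.
Proof. by apply: smooth_sum => i _; exact/smoothX2/smooth_track_error. Qed.

Lemma tracking_bound : exists2 B, 0 <= B & forall T Y, 0 <= T -> solution_upto T Y ->
  Y 0 = Y0 -> track_energy (Y T) <= B /\ prim (fun t => error_sum (Y t)) T <= B.
Proof.
have [M M0 HM] := estimator_bound.
pose N : R := 1 + n.+1%:R.
have N0 : 0 <= N by rewrite addr_ge0.
exists (track_energy Y0 + N * (n.+1%:R * M)).
  by rewrite addr_ge0 ?track_energy_ge0// !mulr_ge0.
move=> T Y T0 sY Y00.
have TT : 0 <= T <= T by rewrite T0 lexx.
have izz := solution_integ sY smooth_error_sum.
have idd : integ T (fun t => \sum_i residual_at Y i t ^+ 2).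
  by apply: integ_sum => i _; exact: residual_integ_sq.
have := prim_upper (solution_chain sY smooth_track_energy)
  (integD (integZ (-1) izz) (integZ N idd)) TT.
rewrite Y00 => H1.
have {}H1 : track_energy (Y T) <=
  track_energy Y0 + (- prim (fun t => error_sum (Y t)) T + N * (n.+1%:R * M)).
  apply: le_trans (H1 _) _ => [s _|]; first by rewrite mulN1r; exact: track_energy_decrease.
  rewrite lerD2l /prim RintegralD//; [|exact: integZ|exact: integZ].
  rewrite !RintegralZl// mulN1r lerD2l; apply: ler_wpM2l => //.
  have acs : abscont T (fun t => \sum_i residual_at Y i t ^+ 2) (fun t => \sum_i
      prim (fun t => residual_at Y i t ^+ 2) t).
    by apply: abscont_sum => i _; apply: prim_abscont; exact: residual_integ_sq.
  have := acs.2 T TT; rewrite [X in _ = X + _]big1 => [|i _]; last exact: prim0.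
  rewrite add0r /prim => <-.
  apply: (@le_trans _ _ (\sum_(i < n.+1) M)).
    by apply: ler_sum => i _; case: (HM T Y i T0 sY Y00).
  by rewrite sumr_const card_ord mulr_natl.
have V0 := track_energy_ge0 (Y T).
have z0 : 0 <= prim (fun t => error_sum (Y t)) T.
  by apply: prim_ge0 => t _; apply: sumr_ge0 => i _; exact: sqr_ge0.
by split; lra.
Qed.

(** Setting the coordinates outside P to 0 leaves g unchanged and brings the
    argument into a ball. *)
Lemma dep_bounded (P : 'I_n.+1 -> 'I_(1 + 1 + d) -> bool) (g : E -> R) (r : R) :
  continuous g -> dep P g -> 0 <= r ->
  exists2 K, 0 <= K & forall S : E, (forall i j, P i j -> `|S i j| <= r) -> `|g S| <= K.
Proof.
move=> cg dg r0; have [K K0 HK] := bounded_on_ball r cg; exists K => // S HS.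
pose S' : E := \matrix_(i, j) if P i j then S i j else 0.
rewrite (dg S S') => [|i j Pij]; last by rewrite mxE Pij.
apply: HK; apply: mx_norm_le => // i j; rewrite mxE; case: ifP => // Pij.
  exact: HS.
by rewrite normr0.
Qed.

Lemma abs_le_of_sq (x y : R) : x ^+ 2 <= y -> `|x| <= 1 + y.
Proof.
move=> h; rewrite ler_norml; have := sqr_ge0 (x - 1); have := sqr_ge0 (x + 1).
by move=> *; apply/andP; split; lra.
Qed.

Definition reach (S : E) : Prop :=
  exists T Y, [/\ 0 <= T, solution_upto T Y, Y 0 = Y0 & Y T = S].

(** Row k, the rows below being bounded: [virtual k] is a continuous function of
    those rows, and the two energies bound z_k, e_k and th_k. So one gets bounds of
    x_k = z_k + virtual k, then of xi_k = x_k - e_k, then of the regressor, which is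
    a function of these, and finally of nu_k = th_k - e_k * regressor. *)
Lemma state_bound_ind (k : nat) : (k <= n.+1)%N -> exists2 B, 0 <= B &
  forall S : E, reach S -> forall i j, below k i j -> `|S i j| <= B.
Proof.
elim: k => [|k IH] kn; first by exists 0.
have [B B0 HB] := IH (ltnW kn).
have [Mw Mw0 HMw] := estimator_bound.
have [Mv Mv0 HMv] := tracking_bound.
have WM S i : reach S -> est_energy i S <= Mw.
  by move=> [T [Y [T0 sY Y00 <-]]]; case: (HMw T Y i T0 sY Y00).
have VM S : reach S -> track_energy S <= Mv.
  by move=> [T [Y [T0 sY Y00 <-]]]; case: (HMv T Y T0 sY Y00).
pose ki : 'I_n.+1 := Ordinal kn.
have kiE : nat_of_ord ki = k by [].
have [Kv Kv0 HKv] := dep_bounded (smooth_continuous (smooth_virtual k))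
  (dep_virtual (ltnW kn)) B0.
have zM S : reach S -> `|track_error ki S| <= 1 + 2 * Mv.
  move=> rS; apply: abs_le_of_sq; have := VM S rS; rewrite /track_energy (bigD1 ki)//=.
  have : 0 <= \sum_(i < n.+1 | i != ki) track_error i S ^+ 2.
    by apply: sumr_ge0 => i _; exact: sqr_ge0.
  lra.
pose Bx := 1 + 2 * Mv + Kv.
have xM S : reach S -> `|S ki col_x| <= Bx.
  move=> rS; have -> : S ki col_x = track_error ki S + virtual k S.
    by rewrite /track_error kiE; ring.
  apply: le_trans (ler_normD _ _) _; apply: lerD; first exact: zM.
  by apply: HKv; exact: HB.
have eM S : reach S -> `|observer_error ki S| <= 1 + 2 * Mw.
  move=> rS; apply: abs_le_of_sq; have := WM S ki rS; rewrite /est_energy.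
  have : 0 <= \sum_l (estimate ki l S - theta ki 0 l) ^+ 2.
    by apply: sumr_ge0 => l _; exact: sqr_ge0.
  lra.
pose Bxi := Bx + (1 + 2 * Mw).
have xiM S : reach S -> `|S ki col_xi| <= Bxi.
  move=> rS; have -> : S ki col_xi = S ki col_x - observer_error ki S.
    by rewrite /observer_error; ring.
  by apply: le_trans (ler_normB _ _) _; apply: lerD; [exact: xM|exact: eM].
have Bx0 : 0 <= Bx by rewrite /Bx; lra.
have Bxi0 : 0 <= Bxi by rewrite /Bxi; lra.
pose B' := B + Bx + Bxi.
have B'0 : 0 <= B' by rewrite /B'; lra.
pose P (i : 'I_n.+1) (j : 'I_(1 + 1 + d)) := (i <= k)%N && ((j == col_x) || (j == col_xi)).
have PB S : reach S -> forall i j, P i j -> `|S i j| <= B'.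
  move=> rS i j /andP[]; rewrite leq_eqVlt => /orP[/eqP ik|ik] hj.
    have {ik} -> : i = ki by exact/val_inj.
    case/orP: hj => /eqP ->; first by apply: le_trans (xM S rS) _; rewrite /B'; lra.
    by apply: le_trans (xiM S rS) _; rewrite /B'; lra.
  by apply: le_trans (HB S rS i j ik) _; rewrite /B'; lra.
have /choice[Ka HKa] : forall l, exists K, 0 <= K /\
    forall S : E, reach S -> `|regressor ki l S| <= K.
  move=> l; have dl : dep P (regressor ki l).
    move=> S S' HS; rewrite /regressor (@mixed_point_dep ki S S')// => [j ji|]; apply: HS.
      by rewrite /P (ltnW ji) eqxx.
    by rewrite /P leqnn eqxx orbT.
  have [K K0 HK] := dep_bounded (smooth_continuous (smooth_regressor ki l)) dl B'0.
  by exists K; split=> // S rS; apply: HK; exact: PB.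
pose Bn := (1 + 2 * Mw) + \sum_l `|theta ki 0 l| + (1 + 2 * Mw) * \sum_l Ka l.
have nM S l : reach S -> `|S ki (col_nu l)| <= Bn.
  move=> rS; have -> : S ki (col_nu l) = (estimate ki l S - theta ki 0 l) + theta ki 0 l
      - observer_error ki S * regressor ki l S by rewrite /estimate /prop_term; ring.
  apply: le_trans (ler_normB _ _) _; apply: lerD; last first.
    rewrite normrM; apply: ler_pM => //; first exact: eM.
    have [_ /(_ S rS) h] := HKa l; apply: le_trans h _.
    by rewrite (bigD1 l)//= lerDl sumr_ge0// => j _; case: (HKa j).
  apply: le_trans (ler_normD _ _) _; apply: lerD; last first.
    by rewrite (bigD1 l)//= lerDl sumr_ge0.
  apply: abs_le_of_sq; have := WM S ki rS; rewrite /est_energy (bigD1 l)//=.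
  have : 0 <= \sum_(i < d | i != l) (estimate ki i S - theta ki 0 i) ^+ 2.
    by apply: sumr_ge0 => i _; exact: sqr_ge0.
  have := sqr_ge0 (observer_error ki S); lra.
have Bn0 : 0 <= Bn.
  rewrite /Bn !addr_ge0// ?mulr_ge0 ?addr_ge0 ?mulr_ge0//.
    by apply: sumr_ge0.
  by apply: sumr_ge0 => l _; case: (HKa l).
exists (B' + Bn); first exact: addr_ge0.
move=> S rS i j; rewrite /below ltnS leq_eqVlt => /orP[/eqP ik|ik]; last first.
  by apply: le_trans (HB S rS i j ik) _; rewrite /B'; lra.
have {ik} -> : i = ki by exact/val_inj.
elim/state_col_ind: j => [||l].
- by apply: le_trans (xM S rS) _; rewrite /B'; lra.
- by apply: le_trans (xiM S rS) _; rewrite /B'; lra.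
- by apply: le_trans (nM S l rS) _; lra.
Qed.

Lemma state_bound : exists2 B, 0 <= B &
  forall T Y, 0 <= T -> solution_upto T Y -> Y 0 = Y0 ->
  `|Y T| <= B.
Proof.
have [B B0 HB] := state_bound_ind (leqnn _); exists B => // T Y T0 sY Y00.
apply: mx_norm_le => // i j; apply: HB; last exact: ltn_ord.
by exists T, Y.
Qed.

(** The virtual control [virtual 0] is the constant c, so the tracking error of row 0
    has no gradient terms. *)
Lemma output_velocity Y t : velocity_at Y t ord0 col_x =
  next_error ord0 (Y t) - 3 * track_error ord0 (Y t) + residual_at Y ord0 t.
Proof.
have := derive_track_error (residual (disturbance t) (Y t)) (Y t) ord0.
have D0 : 'D_(velocity_at Y t) (track_error ord0) (Y t) = velocity_at Y t ord0 col_x.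
  by rewrite derive_minus ?derive_coord ?derive_const ?subr0//; exact: smooth_cst.
rewrite D0 => ->.
have Mz j : 'D_(x_dir j) (virtual (@ord0 n)) (Y t) = 0 by exact: derive_const.
rewrite /damping big1 => [|j _]; last by rewrite Mz expr0n.
by rewrite big1 => [|j _]; [rewrite addr0 subr0|rewrite Mz mulr0].
Qed.

Lemma velocity_at_x Y t i : velocity_at Y t i col_x =
  next_input i (control (Y t)) (Y t) + plant_term i (Y t) + disturbance t i.
Proof.
rewrite mxE drift_colx summxE.
under eq_bigr do rewrite mxE x_dir_x.
by rewrite sum_pick /residual; ring.
Qed.

Lemma smooth_next_input i : smooth (fun S => next_input i (control S) S).
Proof. by rewrite /next_input; case: (i < n)%N => //; exact: smooth_control. Qed.

Lemma velocity_integ_sq T Y i : solution_upto T Y ->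
  integ T (fun t => velocity_at Y t i col_x ^+ 2).
Proof.
move=> sY; have -> : (fun t => velocity_at Y t i col_x ^+ 2) =
    fun t => ((fun S => next_input i (control S) S + plant_term i S) (Y t) +
      disturbance t i) ^+ 2.
  by apply/funext => t; rewrite velocity_at_x.
apply: (@perturbed_integ_sq T Y
  (fun S => next_input i (control S) S + plant_term i S) i sY).
by apply: smoothD; [exact: smooth_next_input|exact: smooth_plant_term].
Qed.

Lemma output_bound : exists2 B, 0 <= B &
  forall T Y, 0 <= T -> solution_upto T Y -> Y 0 = Y0 ->
  prim (fun t => (Y t ord0 col_x - c) ^+ 2) T <= B /\
  prim (fun t => velocity_at Y t ord0 col_x ^+ 2) T <= B.
Proof.
have [M M0 HM] := estimator_bound.
have [Mz Mz0 HMz] := tracking_bound.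
(* (a - 3 b + e)^2 <= 3 (a^2 + 9 b^2 + e^2), where a^2 and b^2 are at most
   error_sum. *)
exists (30 * Mz + 3 * M); first by rewrite addr_ge0// mulr_ge0.
move=> T Y T0 sY Y00.
have [_ hz] := HMz T Y T0 sY Y00; have [_ hd] := HM T Y ord0 T0 sY Y00.
have TT : 0 <= T <= T by rewrite T0 lexx.
have izz := solution_integ sY smooth_error_sum.
have iv := velocity_integ_sq ord0 sY.
have id0 := residual_integ_sq ord0 sY.
have z0le S : track_error ord0 S ^+ 2 <= error_sum S.
  by rewrite /error_sum (bigD1 ord0)//= lerDl sumr_ge0// => i _; exact: sqr_ge0.
have zn0le S : next_error ord0 S ^+ 2 <= error_sum S.
  apply: le_trans (next_error_le S).
  by rewrite (bigD1 ord0)//= lerDl sumr_ge0// => i _; exact: sqr_ge0.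
have acz := prim_abscont izz.
split.
  have ix : integ T (fun t => (Y t ord0 col_x - c) ^+ 2).
    apply: (solution_integ sY (g := fun S => track_error ord0 S ^+ 2)).
    exact/smoothX2/smooth_track_error.
  have := prim_upper (prim_abscont ix) izz TT (fun s _ => z0le (Y s)).
  rewrite prim0 add0r => h; lra.
have := prim_upper (prim_abscont iv) (integD (integZ 30 izz) (integZ 3 id0)) TT.
rewrite prim0 add0r => h; apply: le_trans (h _) _ => [s _|].
  rewrite output_velocity; have := z0le (Y s); have := zn0le (Y s).
  set a := next_error _ _; set b := track_error _ _; set e := residual_at _ _ _.
  have := sqr_ge0 (a + 3 * b); have := sqr_ge0 (a - e); have := sqr_ge0 (3 * b + e).
  move=> *; lra.
rewrite /prim RintegralD//; [|exact: integZ|exact: integZ].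
rewrite !RintegralZl//; apply: lerD; apply: ler_wpM2l => //.
Qed.

(** The disturbance enters additively, in fixed directions: it is the forcing h of
    [ode_global], and the remaining field is smooth and autonomous. *)
Lemma solution_exists : exists Y, Y 0 = Y0 /\ forall T, solution_upto T Y.
Proof.
have [B _ HB] := state_bound.
pose G S := velocity (fun j => plant_term j S - compensator j S) S.
pose h t : E := \sum_j disturbance t j *: x_dir j.
have vE Y : velocity_at Y = fun t => G (Y t) + h t.
  apply/funext => t; rewrite /velocity_at /velocity /G /h -addrA -big_split /=;
    congr (_ + _).
  by apply: eq_bigr => j _; rewrite /residual scalerDl.
have [|||Y [Y00 HY]] := @ode_global R _ _ G h Y0 B.
- move=> a b; rewrite (_ : (fun S => G S a b) =
    fun S => drift (control S) S a b +
      \sum_j (plant_term j S - compensator j S) * x_dir j a b).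
    apply: smoothD; first exact/smooth_coord/smooth_drift/smooth_control.
    apply: smooth_sum => j _; apply: smoothM; last exact: smooth_cst.
    by apply: smoothB; [exact: smooth_plant_term|exact: smooth_compensator].
  apply/funext => S; rewrite mxE summxE; congr (_ + _).
  by apply: eq_bigr => j _; rewrite mxE.
- move=> T a b; rewrite (_ : (fun t => h t a b) =
  fun t => \sum_j x_dir j a b * disturbance t j).
    by apply: integ_sum => j _; apply: integZ; exact: disturbance_integ.
  apply/funext => t; rewrite summxE.
  by apply: eq_bigr => j _; rewrite mxE mulrC.
- by move=> T Y T0 Y00 HY; apply: HB => //; rewrite /solution_upto vE.
exists Y; split=> // T; rewrite /solution_upto vE; exact: HY.
Qed.

End InitialState.

(** * The controller and its closed loop *)

Definition pack_state (x xi : 'rV[R]_n.+1) (nu : 'rV[R]_(n.+1 * d)) : E :=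
  mk_state (fun i => x 0 i) (fun i => xi 0 i) (fun i l => vec_mx nu i l).

(** The estimates of all n.+1 parameter vectors live in nu, flattened by [mxvec]; the
    signal theta_hat is constant. *)
Definition adaptive_controller : controller R n.+1 d (n.+1 * d) := {|
  f_xi := fun x xi nu => let S := pack_state x xi nu in \row_i drift (control S) S i col_xi;
  f_nu := fun x xi nu => let S := pack_state x xi nu in
    mxvec (\matrix_(i, l) drift (control S) S i (col_nu l));
  ctrl := fun x _ xi nu => control (pack_state x xi nu);
  gain := 1;
  theta_P := fun _ _ => 0;
  f_theta := fun _ _ _ _ => 0 |}.

Lemma smooth_pack_state (U : normedModType R) (x xi : U -> 'rV[R]_n.+1)
    (nu : U -> 'rV[R]_(n.+1 * d)) :
  smooth x -> smooth xi -> smooth nu -> smooth (fun p => pack_state (x p) (xi p) (nu p)).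
Proof.
move=> sx sxi snu.
apply: (@smooth_mk_state U (fun i p => x p 0 i) (fun i p => xi p 0 i)
  (fun i l p => vec_mx (nu p) i l)) => [i|i|i l].
- exact: smooth_coord.
- exact: smooth_coord.
- by under eq_fun do rewrite mxE; exact: smooth_coord.
Qed.

Lemma smooth_adaptive_controller : smooth_controller adaptive_controller.
Proof.
have fst_lin (V W X : normedModType R) (g : V -> X) :
    smooth g -> smooth (fun p : V * W => g p.1).
  apply: (@smooth_precomp_lin _ _ _ _ fst g) => // p; exact: cvg_fst.
have s3 : smooth (fun p : 'rV[R]_n.+1 * 'rV[R]_n.+1 * 'rV[R]_(n.+1 * d) =>
    pack_state p.1.1 p.1.2 p.2).
  apply: smooth_pack_state; last exact: smooth_snd.
  - exact: (fst_lin _ _ _ fst (@smooth_fst R _ _)).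
  - exact: (fst_lin _ _ _ snd (@smooth_snd R _ _)).
have sAu i j : smooth (fun S : E => drift (control S) S i j).
  exact/smooth_coord/smooth_drift/smooth_control.
split=> /=.
- apply: smooth_mx => a b; under eq_fun do rewrite mxE.
  exact: (smooth_comp s3 (sAu b col_xi)).
- apply: smooth_mx => a b; case/mxvec_indexP: b => i l.
  rewrite (ord1 a); under eq_fun do rewrite mxvecE mxE.
  exact: (smooth_comp s3 (sAu i (col_nu l))).
- apply: (smooth_comp (h := fun p : 'rV[R]_n.+1 * 'rV[R]_d * 'rV[R]_n.+1 *
    'rV[R]_(n.+1 * d) => pack_state p.1.1.1 p.1.2 p.2)); last exact: smooth_control.
  apply: smooth_pack_state; last exact: smooth_snd.
  + exact: (fst_lin _ _ _ _ (fst_lin _ _ _ fst (@smooth_fst R _ _))).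
  + exact: (fst_lin _ _ _ snd (@smooth_snd R _ _)).
- exact: smooth_cst.
- exact: smooth_cst.
Qed.

Lemma primitive_ofP (k : nat) (w y : R -> 'rV[R]_k) : primitive_of w y <->
  forall T i, abscont T (fun t => w t 0 i) (fun t => y t 0 i).
Proof.
split=> [pw T i|ac i t t0]; last first.
  by have [iw yE] := ac t i; split; [exact: iw|apply: yE; rewrite t0 lexx].
split.
  have [T0|T0] := leP 0 T; first by case: (pw i T T0).
  by rewrite /integ set_itv_ge ?bnd_simp -?ltNge//; exact: integrable_set0.
by move=> t /andP[t0 _]; case: (pw i t t0).
Qed.

Definition state_of (z : trajectory R n.+1 d (n.+1 * d)) (t : R) : E :=
  pack_state (tx z t) (txi z t) (tnu z t).

Lemma plant_state_pack x xi nu : plant_state (pack_state x xi nu) = x.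
Proof. by apply/rowP => i; rewrite mxE mk_state_x. Qed.

Lemma velocity_state_x z t i :
  velocity_at (state_of z) t i col_x = xdot f theta eps adaptive_controller z t 0 i.
Proof.
rewrite velocity_at_x /xdot /plant mxE /plant_term /disturbance /next_input /state_of
  plant_state_pack /=.
by case: (i < n)%N; rewrite ?mk_state_x; ring.
Qed.

Lemma velocity_at_other Y t i j :
  j != col_x -> velocity_at Y t i j = drift (control (Y t)) (Y t) i j.
Proof.
move=> jx; rewrite mxE summxE big1 ?addr0// => k _.
by rewrite !mxE (negbTE jx) andbF mulr0.
Qed.

Lemma col_xi_neq : col_xi != col_x. Proof. by rewrite !eq_shift. Qed.
Lemma col_nu_neq l : col_nu l != col_x. Proof. by rewrite !eq_shift. Qed.

(** The closed loop in terms of x, xi, nu is the design system in terms of S. *)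
Lemma closed_loop_solution z : closed_loop f theta eps adaptive_controller z ->
  forall T, solution_upto T (state_of z).
Proof.
move=> [/primitive_ofP px /primitive_ofP pxi /primitive_ofP pnu _] T i.
apply: (state_col_ind (P := fun j => abscont T (fun t => velocity_at (state_of z) t i j)
  (fun t => state_of z t i j))) => [||l].
- have := px T i; congr abscont; apply/funext => t; first by rewrite velocity_state_x.
  by rewrite mk_state_x.
- have := pxi T i; congr abscont; apply/funext => t.
    by rewrite velocity_at_other ?col_xi_neq//= mxE.
  by rewrite mk_state_xi.
- have := pnu T (mxvec_index i l); congr abscont; apply/funext => t.
    by rewrite velocity_at_other ?col_nu_neq//= mxvecE mxE.
  by rewrite mk_state_nu mxE.
Qed.

Lemma closed_loop_exists x0 xi0 nu0 thI0 : exists z : trajectory R n.+1 d (n.+1 * d),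
  [/\ closed_loop f theta eps adaptive_controller z,
      tx z 0 = x0, txi z 0 = xi0, tnu z 0 = nu0 & ttheta_I z 0 = thI0].
Proof.
have [Y [Y00 sY]] := solution_exists (pack_state x0 xi0 nu0).
pose z : trajectory R n.+1 d (n.+1 * d) := {|
  tx := fun t => \row_i Y t i col_x; txi := fun t => \row_i Y t i col_xi;
  tnu := fun t => mxvec (\matrix_(i, l) Y t i (col_nu l)); ttheta_I := fun=> thI0 |}.
have zY : state_of z = Y.
  apply/funext => t; apply/matrixP => i; apply: state_col_ind => [||l].
  - by rewrite mk_state_x mxE.
  - by rewrite mk_state_xi mxE.
  - by rewrite mk_state_nu mxvecK mxE.
exists z; split.
- split; apply/primitive_ofP => T i.
  + have := sY T i col_x; congr abscont; apply/funext => t; last by rewrite mxE.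
    by rewrite -velocity_state_x zY.
  + have := sY T i col_xi; congr abscont; apply/funext => t; last by rewrite mxE.
    by rewrite velocity_at_other ?col_xi_neq//= mxE -[pack_state _ _ _]/(state_of z t) zY.
  + case/mxvec_indexP: i => i l; have := sY T i (col_nu l).
    congr abscont; apply/funext => t; last by rewrite mxvecE mxE.
    by rewrite velocity_at_other ?col_nu_neq//= mxvecE mxE
      -[pack_state _ _ _]/(state_of z t) zY.
  + have := abscont_cst T (thI0 0 i); congr abscont; apply/funext => t.
    by rewrite mxE.
- by apply/rowP => i; rewrite mxE Y00 mk_state_x.
- by apply/rowP => i; rewrite mxE Y00 mk_state_xi.
- rewrite /= Y00 -[RHS]vec_mxK; congr mxvec; apply/matrixP => i l.
  by rewrite mxE mk_state_nu.
- by [].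
Qed.

Lemma Linf_intro (U : normedModType R) (g : R -> U) B :
  (forall t, 0 <= t -> `|g t| <= B) -> Linf g.
Proof.
move=> H; exists B; split; first exact: num_real.
by move=> b Bb t; rewrite /= in_itv /= andbT => /H h; exact: le_trans h (ltW Bb).
Qed.

Lemma Linf_elim (g : R -> R) : Linf g ->
  exists2 B, 0 <= B & forall t, 0 <= t -> `|g t| <= B.
Proof.
move=> [M [_ HM]]; exists (`|M| + 1); first by rewrite addr_ge0.
move=> t t0; apply: HM; first by rewrite (le_lt_trans (ler_norm M))// ltrDl.
by rewrite /= in_itv /= t0.
Qed.

(** * The goal function *)

Context (psi : R -> R) (psi_smooth : smooth psi) (psi_c : psi c = 0).

Lemma smooth_coord_comp (g : R -> R) : smooth g -> smooth (fun S : E => g (S ord0 col_x)).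
Proof.
move=> sg; apply: (@smooth_precomp_lin _ _ _ _ (fun S : E => S ord0 col_x) g) => //.
  by move=> a x y; rewrite !mxE.
exact: coord_continuous.
Qed.

Lemma smooth_psi' : smooth (derive1 psi).
Proof.
rewrite (_ : derive1 psi = 'D_1 psi); first exact: smooth_derive.
by apply/funext => x; rewrite derive1E.
Qed.

Lemma derive_psi_x (w S : E) :
  'D_w (fun S : E => psi (S ord0 col_x)) S = derive1 psi (S ord0 col_x) * w ord0 col_x.
Proof.
have dc := differentiable_coord S ord0 col_x.
have dp := smooth_differentiable psi_smooth (S ord0 col_x).
rewrite deriveE; last exact: (smooth_differentiable (smooth_coord_comp psi_smooth)).
rewrite (diff_comp dc dp) /= deriv1E; last exact: diff_derivable.
by rewrite -deriveE// derive_coord /GRing.scale /= mulrC.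
Qed.

(** Since psi vanishes at c, square integrability of x_0 - c carries over to
    psi(x_0). *)
Lemma psi_lipschitz (r : R) : `|c| <= r ->
  exists2 L, 0 <= L & forall x, `|x| <= r -> `|psi x| <= L * `|x - c|.
Proof.
move=> cr; pose g (M : 'M[R]_1) := psi (M 0 0).
have sg : smooth g.
  apply: (@smooth_precomp_lin _ _ _ _ (fun M : 'M[R]_1 => M 0 0) psi) => //.
    by move=> a x y; rewrite !mxE.
  exact: coord_continuous.
have nc (x : R) : `|const_mx x : 'M[R]_1| <= `|x|.
  by apply: mx_norm_le => // i j; rewrite mxE.
have [L L0 HL] := lipschitz_on_ball r sg; exists L => // x xr.
have := HL (const_mx x) (const_mx c) (le_trans (nc x) xr) (le_trans (nc c) cr).
rewrite /g !mxE psi_c subr0 => /le_trans; apply; apply: ler_wpM2l => //.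
have -> : const_mx x - const_mx c = const_mx (x - c) :> 'M[R]_1.
  by apply/matrixP => i j; rewrite !mxE.
exact: nc.
Qed.

Section GoalSignal.
Context (Y : R -> E) (sY : forall T, solution_upto T Y).
Let x1 t := Y t ord0 col_x.
Let v1 t := velocity_at Y t ord0 col_x.

Lemma cont_sig (g : E -> R) T : smooth g -> {within `[0, T], continuous (fun t => g (Y t))}.
Proof. by move=> sg; exact: solution_within (sY T) sg. Qed.

Lemma cont_x1 (g : R -> R) T : smooth g -> {within `[0, T], continuous (fun t => g (x1 t))}.
Proof. by move=> sg; exact: cont_sig (smooth_coord_comp sg). Qed.

Lemma v1_split t : v1 t =
  (fun S => next_input ord0 (control S) S + plant_term ord0 S) (Y t) + disturbance t ord0.
Proof. exact: velocity_at_x. Qed.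

Lemma smooth_v1 : smooth (fun S => next_input ord0 (control S) S + plant_term ord0 S).
Proof. by apply: smoothD; [exact: smooth_next_input|exact: smooth_plant_term]. Qed.

Lemma v1_measurable : measurable_fun (`[0, +oo[ : set R) v1.
Proof.
have -> : v1 =
    (fun t => next_input ord0 (control (Y t)) (Y t) + plant_term ord0 (Y t)) \+ (disturbance ^~ ord0).
  by apply/funext => t; exact: v1_split.
apply: measurable_funD.
  by apply: halfline_measurable => T; exact: (@cont_sig _ T smooth_v1).
by rewrite /disturbance; case: (_ < _)%N => //; case: eps_L2.
Qed.

(** Both x_0 - c and its velocity are square integrable ([output_bound]) and the state
    is bounded; psi and its derivative multiply them by bounded factors. *)
Lemma goal_signal :
  [/\ L2 (fun t => psi (x1 t)), Linf (fun t => psi (x1 t)),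
      L2 (fun t => derive1 psi (x1 t) * v1 t),
      psi (x1 t) @[t --> +oo] --> 0 &
      Linf eps -> Linf (fun t => derive1 psi (x1 t) * v1 t)].
Proof.
have [B B0 HB] := state_bound (Y 0).
have [Bo Bo0 HBo] := output_bound (Y 0).
have YB t : 0 <= t -> `|Y t| <= B by move=> t0; exact: (HB t Y t0 (sY t)).
have x1B t : 0 <= t -> `|x1 t| <= B.
  by move=> t0; apply: le_trans (le_mx_norm _ _ _) (YB t t0).
pose r := B + `|c|.
have cr : `|c| <= r by rewrite lerDr.
have x1r t : 0 <= t -> `|x1 t| <= r by move=> /x1B h; apply: le_trans h _; rewrite lerDl.
have [L L0 HL] := psi_lipschitz cr.
have [K K0 HK] := bounded_on_ball B (smooth_continuous (smooth_coord_comp smooth_psi')).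
have psi'B t : 0 <= t -> `|derive1 psi (x1 t)| <= K by move=> t0; apply: HK; exact: YB.
have psiB t : 0 <= t -> `|psi (x1 t)| <= L * (r + `|c|).
  move=> t0; apply: le_trans (HL _ (x1r t t0)) _; apply: ler_wpM2l => //.
  by apply: le_trans (ler_normB _ _) _; apply: lerD => //; exact: x1r.
have ipsi T : integ T (fun t => psi (x1 t) ^+ 2).
  apply: integ_continuous.
  exact: (@cont_x1 (fun x => psi x ^+ 2) T (smoothX2 psi_smooth)).
have iv1 T : integ T (fun t => v1 t ^+ 2) by exact: velocity_integ_sq.
have ipd T : integ T (fun t => (derive1 psi (x1 t) * v1 t) ^+ 2).
  have := integM (iv1 T) (@cont_x1 (fun x => derive1 psi x ^+ 2) T (smoothX2 smooth_psi')).
  by under [X in _ -> integ _ X]eq_fun do rewrite exprMn mulrC.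
have sq_le (a b k : R) : `|a| <= k * `|b| -> a ^+ 2 <= k ^+ 2 * b ^+ 2.
  move=> h; rewrite -(real_normK (num_real a)) -(real_normK (num_real b)) -exprMn.
  by rewrite lerXn2r// ?nnegrE//; exact: le_trans h.
have TT (T : R) : 0 <= T -> 0 <= T <= T by move=> ->; rewrite lexx.
have ix T : integ T (fun t => (x1 t - c) ^+ 2).
  apply: integ_continuous; apply: (@cont_x1 (fun x => (x - c) ^+ 2) T).
  by apply: smoothX2; apply: smoothB; [exact: smooth_id|exact: smooth_cst].
have psi_int T : 0 <= T -> prim (fun t => psi (x1 t) ^+ 2) T <= L ^+ 2 * Bo.
  move=> T0; have := prim_upper (prim_abscont (ipsi T)) (integZ (L ^+ 2) (ix T)) (TT T T0).
  rewrite prim0 add0r => h; apply: le_trans (h _) _ => [s /andP[s0 _]|].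
    by apply: sq_le; exact: HL (x1r s s0).
  rewrite /prim (RintegralZl _ _ (ix T))//; apply: ler_wpM2l; first exact: sqr_ge0.
  by case: (HBo T Y T0 (sY T)).
have pd_int T : 0 <= T -> prim (fun t => (derive1 psi (x1 t) * v1 t) ^+ 2) T <= K ^+ 2 * Bo.
  move=> T0; have := prim_upper (prim_abscont (ipd T)) (integZ (K ^+ 2) (iv1 T)) (TT T T0).
  rewrite prim0 add0r => h; apply: le_trans (h _) _ => [s /andP[s0 _]|].
    by apply: sq_le; rewrite normrM; apply: ler_wpM2r => //; exact: psi'B.
  rewrite /prim (RintegralZl _ _ (iv1 T))//; apply: ler_wpM2l; first exact: sqr_ge0.
  by case: (HBo T Y T0 (sY T)).
split.
- apply: (L2_intro (B := L ^+ 2 * Bo)) => //.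
  by apply: halfline_measurable => T; exact: (@cont_x1 _ T psi_smooth).
- exact: (Linf_intro psiB).
- apply: (L2_intro (B := K ^+ 2 * Bo)) => //.
  apply: measurable_funM; last exact: v1_measurable.
  by apply: halfline_measurable => T; exact: (@cont_x1 _ T smooth_psi').
- pose B2 := L ^+ 2 * Bo + K ^+ 2 * Bo.
  have h1 : L ^+ 2 * Bo <= B2 by rewrite lerDl mulr_ge0 ?sqr_ge0.
  have h2 : K ^+ 2 * Bo <= B2 by rewrite lerDr mulr_ge0 ?sqr_ge0.
  apply: (@square_integrable_cvg0 R _ (fun t => derive1 psi (x1 t) * v1 t) B2) => //.
  + move=> T; have := solution_chain (sY T) (smooth_coord_comp psi_smooth).
    by under [X in abscont _ X _ -> _]eq_fun do rewrite derive_psi_x.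
  + by move=> T T0; apply: le_trans (psi_int T T0) h1.
  + by move=> T T0; apply: le_trans (pd_int T T0) h2.
- move=> /Linf_elim[Be Be0 HBe].
  have [Kv Kv0 HKv] := bounded_on_ball B (smooth_continuous smooth_v1).
  apply: (@Linf_intro _ _ (K * (Kv + Be))) => t t0.
  rewrite normrM; apply: ler_pM => //; first exact: psi'B.
  rewrite v1_split; apply: le_trans (ler_normD _ _) _; apply: lerD;
    first exact: HKv (YB t t0).
  by rewrite /disturbance; case: (_ < _)%N; rewrite ?normr0//; exact: HBe.
Qed.

End GoalSignal.

Lemma L2_zero : L2 (fun _ : R => 0 : R).
Proof.
apply: (L2_intro (B := 0)) => [|T|T T0].
- exact: measurable_cst.
- by under eq_fun do rewrite expr0n; exact: integ_cst.
- by under [X in prim X _]eq_fun do rewrite expr0n; rewrite prim_cst// mul0r.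
Qed.

Definition goal_functions (i : 'I_n.+1) : R -> R -> R :=
  if i == ord0 then fun x _ => psi x else fun _ _ => 0.

Lemma smooth_goal_functions i : smooth (fun p : R * R => goal_functions i p.1 p.2).
Proof.
rewrite /goal_functions; case: (i == ord0); last exact: smooth_cst.
apply: (@smooth_precomp_lin _ _ _ _ fst psi) => // p; exact: cvg_fst.
Qed.

Lemma closed_loop_good (z : trajectory R n.+1 d (n.+1 * d)) :
  closed_loop f theta eps adaptive_controller z ->
  let C := adaptive_controller in
  let x1 := fun t => tx z t 0 ord0 in
  let psi_t := fun t => psi (x1 t) in
  let psi_dot :=
    total_deriv (fun s _ => psi s) x1 (fun t => xdot f theta eps C z t 0 ord0) in
  let psis_t := fun i t => goal_functions i (tx z t 0 i) t in
  let psis_dot := fun i =>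
    total_deriv (goal_functions i) (fun t => tx z t 0 i)
      (fun t => xdot f theta eps C z t 0 i) in
  let uu := fun th0 t => ctrl C (tx z t) th0 (txi z t) (tnu z t) in
  [/\ (L2 psi_t /\ Linf psi_t /\ L2 psi_dot) /\
      (forall i, L2 (psis_t i) /\ Linf (psis_t i) /\ L2 (psis_dot i)),
      Linf (theta_hat_at C z) /\
      L2 (fun t => uu (theta_hat_at C z t) t - uu (theta ord_max) t),
      Linf (tx z) /\ Linf (txi z) /\ Linf (tnu z) &
      Linf eps ->
        [/\ Linf psi_dot, (forall i, Linf (psis_dot i)),
            psi_t t @[t --> +oo] --> 0 &
            (forall i, psis_t i t @[t --> +oo] --> 0)]].
Proof.
move=> cl C x1 psi_t psi_dot psis_t psis_dot uu.
have sY := closed_loop_solution cl.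
have [g1 g2 g3 g4 g5] := goal_signal sY.
have xE : (fun t => state_of z t ord0 col_x) = x1.
  by apply/funext => t; rewrite mk_state_x.
have pdE : psi_dot = fun t => derive1 psi (state_of z t ord0 col_x) *
  velocity_at (state_of z) t ord0 col_x.
  apply/funext => t; rewrite /psi_dot /total_deriv derive1_cst addr0 velocity_state_x.
  by rewrite -[x1 t]/((fun t => x1 t) t) -xE.
have ptE : psi_t = fun t => psi (state_of z t ord0 col_x).
  by apply/funext => t; rewrite /psi_t -xE.
have [B B0 HB] := state_bound (state_of z 0).
have SB t i j : 0 <= t -> `|state_of z t i j| <= B.
  move=> t0; apply: le_trans (le_mx_norm _ _ _) _.
  exact: (HB t _ t0 (sY t)).
have psis0 : psis_t ord0 = psi_t /\ psis_dot ord0 = psi_dot by [].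
have psisN i : i != ord0 -> psis_t i = (fun=> 0) /\ psis_dot i = (fun=> 0).
  move=> i0; rewrite /psis_t /psis_dot /goal_functions (negbTE i0); split=> //.
  by apply/funext => t; rewrite /total_deriv !derive1_cst mul0r addr0.
have Linf0 : Linf (fun _ : R => 0 : R).
  by apply: (@Linf_intro _ _ 0) => t _; rewrite normr0.
split.
- split; first by rewrite ptE pdE.
  move=> i; have [->|i0] := eqVneq i ord0.
    by case: psis0 => -> ->; rewrite ptE pdE.
  by have [-> ->] := psisN i i0; split; [exact: L2_zero|split=> //; exact: L2_zero].
- split.
    apply: (@Linf_intro _ _ `|ttheta_I z 0|) => t t0.
    rewrite /theta_hat_at /theta_hat /= scale1r add0r.
    case: cl => _ _ _ /primitive_ofP pI.
    suff -> : ttheta_I z t = ttheta_I z 0 by [].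
    apply/rowP => i; have [_ ->] := pI t i; last by rewrite t0 lexx.
    under [X in prim X _]eq_fun do rewrite mxE.
    by rewrite prim_cst// mul0r addr0.
  rewrite (_ : (fun t => _) = fun=> 0); first exact: L2_zero.
  by apply/funext => t; rewrite /uu /= subrr.
- split; [|split]; apply: (@Linf_intro _ _ B) => t t0; apply: mx_norm_le => // a b;
    rewrite ?(ord1 a).
  + by have := SB t b col_x t0; rewrite mk_state_x.
  + by have := SB t b col_xi t0; rewrite mk_state_xi.
  + case/mxvec_indexP: b => i l.
    by have := SB t i (col_nu l) t0; rewrite mk_state_nu mxE.
- move=> Le; split.
  + by rewrite pdE; exact: g5.
  + move=> i; have [->|i0] := eqVneq i ord0; first by case: psis0 => _ ->; rewrite pdE;
    exact: g5.
    by have [_ ->] := psisN i i0.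
  + by rewrite ptE; exact: g4.
  + move=> i; have [->|i0] := eqVneq i ord0; first by case: psis0 => -> _; rewrite ptE;
    exact: g4.
    by have [-> _] := psisN i i0; exact: cvg_cst.
Qed.

End Design.

Theorem theorem4 (R : realType) (n d : nat)
  (Omega : set 'rV[R]_d)
  (f : forall i : 'I_n.+1, 'rV[R]_i.+1 -> 'rV[R]_d -> R)
  (psi : R -> R)
  (alpha : forall i : 'I_n.+1, 'rV[R]_i.+1 -> 'rV[R]_d)
  (D D1 : R)
  (Dbar : forall i : 'I_n.+1, 'rV[R]_i.+1 -> 'rV[R]_i.+1 -> R)
  (D_gt0 : 0 < D) (D1_gt0 : 0 < D1)
  (target_nonempty : exists c : R, psi c = 0)
  (f_monotone : forall (i : 'I_n.+1) (x : 'rV[R]_i.+1) (th' th : 'rV[R]_d),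
     Omega th -> f i x th' <> f i x th ->
     0 < (f i x th' - f i x th) * dot (alpha i x) (th' - th))
  (f_sector : forall (i : 'I_n.+1) (x : 'rV[R]_i.+1) (th' th : 'rV[R]_d),
     Omega th ->
     D1 * `|dot (alpha i x) (th' - th)| <= `|f i x th' - f i x th| /\
     `|f i x th' - f i x th| <= D * `|dot (alpha i x) (th' - th)|)
  (f_lipschitz : forall (i : 'I_n.+1) (th : 'rV[R]_d) (x x' : 'rV[R]_i.+1),
     Omega th ->
     (f i x th - f i x' th) ^+ 2 <= Dbar i x x' ^+ 2 * sqnorm (x - x'))
  (Dbar_smooth : forall i : 'I_n.+1,
     smooth (fun p : 'rV[R]_i.+1 * 'rV[R]_i.+1 => Dbar i p.1 p.2))
  (alpha_smooth : forall i : 'I_n.+1, smooth (alpha i))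
  (f_smooth : forall i : 'I_n.+1,
     smooth (fun p : 'rV[R]_i.+1 * 'rV[R]_d => f i p.1 p.2))
  (psi_smooth : smooth psi)
  (psi_bounded : forall y : R -> R, {within `[0, +oo[, continuous y} ->
     Linf (fun t => psi (y t)) -> Linf y) :
  exists (m : nat) (C : controller R n.+1 d m) (psis : 'I_n.+1 -> R -> R -> R),
    [/\ smooth_controller C, 0 < gain C,
        (forall i : 'I_n.+1, smooth (fun p : R * R => psis i p.1 p.2)) &
    forall (theta : 'I_n.+1 -> 'rV[R]_d) (eps : R -> R),
      (forall i, Omega (theta i)) -> L2 eps ->
      (forall (x0 xi0 : 'rV[R]_n.+1) (nu0 : 'rV[R]_m) (thI0 : 'rV[R]_d),
         exists z : trajectory R n.+1 d m,
           [/\ closed_loop f theta eps C z,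
               tx z 0 = x0, txi z 0 = xi0, tnu z 0 = nu0 & ttheta_I z 0 = thI0]) /\
      (forall z : trajectory R n.+1 d m, closed_loop f theta eps C z ->
         let x1 := fun t => tx z t 0 ord0 in
         let psi_t := fun t => psi (x1 t) in
         let psi_dot :=
           total_deriv (fun s _ => psi s) x1
             (fun t => xdot f theta eps C z t 0 ord0) in
         let psis_t := fun i t => psis i (tx z t 0 i) t in
         let psis_dot := fun i =>
           total_deriv (psis i) (fun t => tx z t 0 i)
             (fun t => xdot f theta eps C z t 0 i) in
         let u := fun th t => ctrl C (tx z t) th (txi z t) (tnu z t) in
         [/\ (L2 psi_t /\ Linf psi_t /\ L2 psi_dot) /\
             (forall i, L2 (psis_t i) /\ Linf (psis_t i) /\ L2 (psis_dot i)),
             Linf (theta_hat_at C z) /\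
             L2 (fun t => u (theta_hat_at C z t) t - u (theta ord_max) t),
             Linf (tx z) /\ Linf (txi z) /\ Linf (tnu z) &
             Linf eps ->
               [/\ Linf psi_dot, (forall i, Linf (psis_dot i)),
                   psi_t t @[t --> +oo] --> 0 &
                   (forall i, psis_t i t @[t --> +oo] --> 0)]])].
Proof.
have [c psi_c] := target_nonempty.
exists (n.+1 * d)%N, (adaptive_controller f alpha D D1 Dbar c), (goal_functions psi).
split.
- exact: smooth_adaptive_controller.
- exact: ltr01.
- exact: smooth_goal_functions.
- move=> theta eps theta_in eps_L2; split.
    exact: (closed_loop_exists c Dbar_smooth alpha_smooth f_smooth D_gt0 D1_gt0
      theta_in f_monotone f_sector f_lipschitz eps_L2).
  exact: (closed_loop_good Dbar_smooth alpha_smooth f_smooth D_gt0 D1_gt0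
    theta_in f_monotone f_sector f_lipschitz eps_L2 psi_smooth psi_c).
Qed.
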